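(* In $D'(\mathbb R^{N+1})$, $$-\hat W_{,i}\mathop{*}_x n_i(x)\delta_S(x)-c^{-2}\left(\hat U\mathop{*}_x H_S^-(x)\right)_{,t}=H_D^-(x,t),$$ with summation over $i=1,\dots,N$.
   Context: $c>0$ is a constant; $\Box_c=\Delta-c^{-2}\partial_t^2$ on $\mathbb R^N\times\mathbb R$. $S^-\subset\mathbb R^N$ is a bounded domain with Lyapunov boundary $S$ and external unit normal $n=(n_1,\dots,n_N)$. $H_S^-(x)$ equals $1$ on $S^-$, $1/2$ on $S$, $0$ elsewhere; $H(t)$ is the Heaviside function with $H(0)=1/2$; $H_D^-(x,t)=H_S^-(x)H(t)$. $\alpha\delta_S(x)$ is the simple layer $\varphi\mapsto\int_S\alpha\varphi\,dS$ on $\mathbb R^N$. $\hat U$ is the Green function: $\Box_c\hat U=\delta(x)\delta(t)$, $\hat U=0$ for $t<0$ and for $\|x\|>ct$. $\hat W=\hat U*\delta(x)H(t)$, so $\partial_t\hat W=\hat U$; $\hat W_{,i}=\partial\hat W/\partial x_i$. $V\mathop{*}_x f$ is convolution over $x$ only, i.e. $V*(f(x)\delta(t))$. *)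

(* Defs.v *)
From HB Require Import structures.
From mathcomp Require Import all_boot all_order all_algebra.
From mathcomp Require Import all_classical all_reals all_analysis.

Set Implicit Arguments.
Unset Strict Implicit.
Unset Printing Implicit Defensive.

Import Order.TTheory GRing.Theory Num.Theory.
Import numFieldNormedType.Exports.

Local Open Scope classical_set_scope.
Local Open Scope ring_scope.

(** * Lebesgue measure on R^n *)

Definition rV_display : measure_display. Proof. exact. Qed.

(* The sigma-algebra generated by the coordinates, i.e. the product (= Borel)
   sigma-algebra of R^n; same construction as the library's for n.-tuple T. *)
Section measurable_rV.
Context (R : realType) (n : nat).

Definition rV_coord (i : 'I_n) (x : 'rV[R]_n) : R := x ord0 i.

Let rV_set0 : g_sigma_preimage rV_coord set0.
Proof. exact: sigma_algebra0. Qed.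

Let rV_setC A : g_sigma_preimage rV_coord A -> g_sigma_preimage rV_coord (~` A).
Proof. exact: sigma_algebraC. Qed.

Let rV_bigcup (F : (set 'rV[R]_n)^nat) :
  (forall i, g_sigma_preimage rV_coord (F i)) ->
  g_sigma_preimage rV_coord (\bigcup_i (F i)).
Proof. exact: sigma_algebra_bigcup. Qed.

HB.instance Definition _ := @isMeasurable.Build rV_display
  'rV[R]_n (g_sigma_preimage rV_coord) rV_set0 rV_setC rV_bigcup.

End measurable_rV.

Section measurable_rV_theory.
Context d (T : measurableType d) (R : realType).

Lemma measurable_rV_coord n (i : 'I_n) :
  measurable_fun [set: 'rV[R]_n] (fun x : 'rV[R]_n => x ord0 i : R).
Proof.
move=> _ Y mY; rewrite setTI; apply: sub_sigma_algebra => /=.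
rewrite -bigcup_seq/=; exists i => /=; first by rewrite mem_index_enum.
by exists Y => //; rewrite setTI.
Qed.

Lemma measurable_fun_rVP n (f : T -> 'rV[R]_n) :
  (forall i, measurable_fun [set: T] (fun x => f x ord0 i : R)) ->
  measurable_fun [set: T] f.
Proof.
move=> mf; apply: (@measurability _ _ T _ setT f
  (\big[setU/set0]_(i < n)
     preimage_set_system setT (@rV_coord R n i) measurable)) => //.
move=> _ [B + <-]; rewrite -bigcup_seq => -[i _ [A mA <-]].
by rewrite !setTI; have := mf i measurableT A mA; rewrite setTI.
Qed.

End measurable_rV_theory.

Section lebesgue_cons.
Context (R : realType) (n : nat).
Variable mu : {sigma_finite_measure set 'rV[R]_n -> \bar R}.

Definition rV_cons (p : measurableTypeR R * 'rV[R]_n) : 'rV[R]_n.+1 :=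
  row_mx (p.1 : R)%:M p.2 : 'rV[R]_(1 + n).

Definition rV_uncons (x : 'rV[R]_n.+1) : measurableTypeR R * 'rV[R]_n :=
  (x ord0 ord0, rsubmx (x : 'rV[R]_(1 + n))).

Lemma rV_unconsK : cancel rV_uncons rV_cons.
Proof.
move=> x; rewrite /rV_cons/=; apply/rowP => i.
rewrite -[in RHS](hsubmxK (x : 'rV[R]_(1 + n))).
congr ((row_mx _ _ : 'rV[R]_(1 + n)) _ _).
by apply/rowP => j; rewrite !mxE !ord1 eqxx mulr1n; congr (x _ _); apply/val_inj.
Qed.

Lemma rV_consK : cancel rV_cons rV_uncons.
Proof.
move=> [a y]; rewrite /rV_uncons /rV_cons row_mxKr; congr pair => /=.
transitivity ((row_mx ((a : R)%:M : 'rV[R]_1) y) ord0 (lshift n ord0)).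
  by congr (fun_of_matrix _ _ _); exact/val_inj.
by rewrite row_mxEl mxE eqxx mulr1n.
Qed.

Lemma measurable_rV_cons : measurable_fun setT rV_cons.
Proof.
apply: measurable_fun_rVP => i.
case: (split_ordP (i : 'I_(1 + n))) => j ->.
- rewrite [X in measurable_fun _ X](_ : _ = fst); first exact: measurable_fst.
  apply/funext => p; apply: etrans (row_mxEl _ _ _ _) _.
  by rewrite mxE !ord1 eqxx mulr1n.
- rewrite [X in measurable_fun _ X](_ : _ = (fun x : 'rV[R]_n => x ord0 j : R) \o snd).
    by apply: measurableT_comp; [exact: measurable_rV_coord|exact: measurable_snd].
  by apply/funext => p; exact: row_mxEr.
Qed.

Lemma measurable_rV_uncons : measurable_fun setT rV_uncons.
Proof.
apply: measurable_fun_pair; first exact: measurable_rV_coord.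
apply: measurable_fun_rVP => i.
rewrite [X in measurable_fun _ X](_ : _ =
  (fun x : 'rV[R]_n.+1 => x ord0 (rshift 1 i : 'I_n.+1) : R)); first exact: measurable_rV_coord.
by apply/funext => x; rewrite mxE.
Qed.

Definition lebesgue_cons : set 'rV[R]_n.+1 -> \bar R :=
  pushforward (lebesgue_measure \x mu)%E rV_cons.

Let measurable_preimage_cons (A : set 'rV[R]_n.+1) :
  measurable A -> measurable (rV_cons @^-1` A).
Proof.
by move=> mA; rewrite -[X in measurable X]setTI; exact: measurable_rV_cons.
Qed.

Let lebesgue_cons0 : lebesgue_cons set0 = 0%E.
Proof. by rewrite /lebesgue_cons /pushforward preimage_set0 measure0. Qed.

Let lebesgue_cons_ge0 A : (0 <= lebesgue_cons A)%E.
Proof. by rewrite /lebesgue_cons /pushforward; exact: measure_ge0. Qed.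

Let lebesgue_cons_sigma_additive : semi_sigma_additive lebesgue_cons.
Proof.
move=> F mF tF mUF; rewrite /lebesgue_cons /pushforward preimage_bigcup.
apply: measure_semi_sigma_additive.
- by move=> k; exact: measurable_preimage_cons.
- apply/trivIsetP => /= i j _ _ ij; rewrite -preimage_setI.
  by move/trivIsetP : tF => /(_ _ _ _ _ ij) ->//; rewrite preimage_set0.
- by rewrite -preimage_bigcup; exact: measurable_preimage_cons.
Qed.

HB.instance Definition _ := isMeasure.Build _ _ _ lebesgue_cons
  lebesgue_cons0 lebesgue_cons_ge0 lebesgue_cons_sigma_additive.

Let lebesgue_cons_sigma_finite : sigma_finite setT lebesgue_cons.
Proof.
have /sigma_finiteP[F [TF ndF Foo]] :=
  sigma_finiteT (@lebesgue_measure R : {sigma_finite_measure set _ -> \bar R}).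
have /sigma_finiteP[G [TG ndG Goo]] := sigma_finiteT mu.
exists (fun k => rV_uncons @^-1` (F k `*` G k)).
  apply/esym/seteqP; split=> // x _.
  have [k _ Fk] : (\bigcup_i F i) (rV_uncons x).1 by rewrite -TF.
  have [l _ Gl] : (\bigcup_i G i) (rV_uncons x).2 by rewrite -TG.
  exists (maxn k l) => //; split.
  - by move: Fk; exact/subsetPset/ndF/leq_maxl.
  - by move: Gl; exact/subsetPset/ndG/leq_maxr.
move=> k; have [mF Fk] := Foo k; have [mG Gk] := Goo k; split.
  rewrite -[X in measurable X]setTI; apply: measurable_rV_uncons => //.
  exact: measurableX.
rewrite /lebesgue_cons /pushforward.
rewrite (_ : _ @^-1` _ = F k `*` G k); last first.
  by apply/seteqP; split=> p; rewrite /preimage/mkset rV_consK.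
by rewrite product_measure1E// lte_mul_pinfty// ge0_fin_numE.
Qed.

HB.instance Definition _ := @Measure_isSigmaFinite.Build _ _ _
  lebesgue_cons lebesgue_cons_sigma_finite.

End lebesgue_cons.

Fixpoint lebesgue_rV (R : realType) (n : nat) :
    {sigma_finite_measure set 'rV[R]_n -> \bar R} :=
  if n is n'.+1 then lebesgue_cons (lebesgue_rV R n')
  else dirac (0 : 'rV[R]_0).

(** * Test functions and distributions on R^n *)

Notation functional R n := (('rV[R]_n -> R) -> R).

Section distributions.
Context {R : realType}.

Definition pderive n (i : 'I_n) (f : 'rV[R]_n -> R) : 'rV[R]_n -> R :=
  fun x => 'D_(delta_mx ord0 i) f x.

Definition pderives n (s : seq 'I_n) (f : 'rV[R]_n -> R) : 'rV[R]_n -> R :=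
  foldr (@pderive n) f s.

Definition C1 n (f : 'rV[R]_n -> R) : Prop :=
  forall i, (forall x, derivable f x (delta_mx ord0 i)) /\
    continuous (pderive i f).

Definition smooth n (f : 'rV[R]_n -> R) : Prop :=
  forall s, continuous (pderives s f) /\
    forall x i, derivable (pderives s f) x (delta_mx ord0 i).

Definition fsupp n (f : 'rV[R]_n -> R) : set 'rV[R]_n :=
  closure [set x | f x != 0].

Definition test_function n (f : 'rV[R]_n -> R) : Prop :=
  smooth f /\ compact (fsupp f).

Definition test_cvg n (f_ : nat -> 'rV[R]_n -> R) (f : 'rV[R]_n -> R) : Prop :=
  (exists2 K : set 'rV[R]_n, compact K & forall k, fsupp (f_ k) `<=` K) /\
  forall s (e : R), 0 < e ->
    \forall k \near \oo, forall x, `|pderives s (f_ k) x - pderives s f x| <= e.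

(* Distributions are functionals on all functions; only the values on test
   functions are meaningful, see [eq_distr]. *)
Definition is_distribution n (T : functional R n) : Prop :=
  (forall a f g, test_function f -> test_function g ->
     T (fun x => a * f x + g x) = a * T f + T g) /\
  (forall f_ f, (forall k, test_function (f_ k)) -> test_function f ->
     test_cvg f_ f -> T (f_ k) @[k --> \oo] --> T f).

Definition eq_distr n (S T : functional R n) : Prop :=
  forall f, test_function f -> S f = T f.

Definition vanishes_on n (T : functional R n) (O : set 'rV[R]_n) : Prop :=
  forall f, test_function f -> fsupp f `<=` O -> T f = 0.

Definition dpderive n (i : 'I_n) (T : functional R n) : functional R n :=
  fun f => - T (pderive i f).

Definition delta_distr n : functional R n := fun f => f 0.

Definition regular_distr n (h : 'rV[R]_n -> R) : functional R n :=
  fun f => \int[lebesgue_rV R n]_x (h x * f x).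

Definition simple_layer n (dS : {measure set 'rV[R]_n -> \bar R})
    (S : set 'rV[R]_n) (a : 'rV[R]_n -> R) : functional R n :=
  fun f => \int[dS]_(x in S) (a x * f x).

Definition tensor_distr m n (S : functional R m) (T : functional R n) :
    functional R (m + n) :=
  fun f => S (fun x => T (fun y => f (row_mx x y))).

(* Sequences of test functions tending to 1, in the sense of Vladimirov *)
Definition unit_sequence n (eta : nat -> 'rV[R]_n -> R) : Prop :=
  [/\ forall k, test_function (eta k),
      forall K : set 'rV[R]_n, compact K ->
        \forall k \near \oo, forall x, K x -> eta k x = 1 &
      forall s, exists C : R, forall k x, `|pderives s (eta k) x| <= C].

(* Vladimirov's convolution,
     <S * T, f> = lim_k <S(x) T(y), eta_k(x, y) f(x + y)>,
   the limit being the same for all unit sequences eta of R^(2n); junk value 0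
   when there is no such limit. *)
Definition conv_distr n (S T : functional R n) : functional R n :=
  fun f => xget 0 [set l : R | forall eta, unit_sequence eta ->
    tensor_distr S T (fun z => eta k z * f (lsubmx z + rsubmx z)) @[k --> \oo] --> l].

End distributions.

(** * Domains with Lyapunov boundary *)

Section domains.
Context {R : realType} {N : nat}.
Implicit Types (D S : set 'rV[R]_N) (n : 'rV[R]_N -> 'rV[R]_N).

(* The norm of the library on 'rV[R]_N is the sup norm. *)
Definition enorm (x : 'rV[R]_N) : R := Num.sqrt (\sum_i x ord0 i ^+ 2).

Definition dotp (x y : 'rV[R]_N) : R := \sum_i x ord0 i * y ord0 i.

Definition boundary D : set 'rV[R]_N := closure D `\` interior D.

Definition bounded_domain D : Prop :=
  [/\ open D, connected D, bounded_set D & D !=set0].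

(* Near each boundary point, up to renumbering and reorienting the axes, D is
   the region above the graph of a C^1 function of N - 1 variables. *)
Definition C1_boundary D : Prop :=
  forall x0, boundary D x0 ->
    exists (j : 'I_N) (b : bool) (gamma : 'rV[R]_N.-1 -> R),
      C1 gamma /\
      \forall x \near x0,
        D x <-> 0 < (-1) ^+ b * (x ord0 j - gamma (col' j x)).

(* n x is a unit vector, orthogonal at x to the surface, pointing outside D. *)
Definition external_unit_normal D n : Prop :=
  forall x, boundary D x ->
    [/\ enorm (n x) = 1,
        forall e : R, 0 < e -> \forall y \near x, boundary D y ->
          `|dotp (n x) (y - x)| <= e * enorm (y - x) &
        \forall s \near 0^'+, ~ closure D (x + s *: n x)].

Definition lyapunov_boundary D n : Prop :=
  C1_boundary D /\
  exists C a : R, [/\ 0 < a, a <= 1 &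
    forall x y, boundary D x -> boundary D y ->
      enorm (n x - n y) <= C * enorm (x - y) `^ a].

Definition graph_point (j : 'I_N) (gamma : 'rV[R]_N.-1 -> R)
    (y : 'rV[R]_N.-1) : 'rV[R]_N :=
  \row_k (if unlift j k is Some k' then y ord0 k' else gamma y).

(* The surface area measure of a C^1 hypersurface S: on each piece of S which is
   a graph x_j = gamma(y), it is sqrt (1 + |grad gamma|^2) dy. *)
Definition surface_measure S (dS : {measure set 'rV[R]_N -> \bar R}) : Prop :=
  dS (~` S) = 0%E /\
  forall (j : 'I_N) (gamma : 'rV[R]_N.-1 -> R) (O : set 'rV[R]_N),
    C1 gamma -> open O ->
    (forall x, O x -> (S x <-> x ord0 j = gamma (col' j x))) ->
    forall A, measurable A -> A `<=` O ->
      dS A = (\int[lebesgue_rV R N.-1]_(y in graph_point j gamma @^-1` A)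
        (Num.sqrt (1 + \sum_i pderive i gamma y ^+ 2))%:E)%E.

Definition char_domain D (x : 'rV[R]_N) : R :=
  if x \in D then 1 else if x \in boundary D then 2^-1 else 0.

End domains.

(** * Space-time R^N x R *)

Section space_time.
Context {R : realType} {N : nat}.

Definition space_index (i : 'I_N) : 'I_(N + 1) := lshift 1 i.
Definition time_index : 'I_(N + 1) := rshift N ord0.

Definition space_part (z : 'rV[R]_(N + 1)) : 'rV[R]_N := lsubmx z.
Definition time_part (z : 'rV[R]_(N + 1)) : R := z ord0 time_index.

Definition heaviside (t : R) : R :=
  if t < 0 then 0 else if t == 0 then 2^-1 else 1.

Definition heaviside_distr : functional R 1 :=
  regular_distr (fun t => heaviside (t ord0 ord0)).

Definition dalembert (c : R) (T : functional R (N + 1)) : functional R (N + 1) :=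
  \sum_(i < N) dpderive (space_index i) (dpderive (space_index i) T)
  - c ^- 2 *: dpderive time_index (dpderive time_index T).

Definition green_function (c : R) (U : functional R (N + 1)) : Prop :=
  [/\ is_distribution U,
      eq_distr (dalembert c U) (tensor_distr (@delta_distr R N) (@delta_distr R 1)),
      vanishes_on U [set z | time_part z < 0] &
      vanishes_on U [set z | c * time_part z < enorm (space_part z)]].

Definition time_primitive (U : functional R (N + 1)) : functional R (N + 1) :=
  conv_distr U (tensor_distr (@delta_distr R N) heaviside_distr).

Definition conv_x (V : functional R (N + 1)) (f : functional R N) :
    functional R (N + 1) :=
  conv_distr V (tensor_distr f (@delta_distr R 1)).

End space_time.

(* Main.v *)
Require Import Defs.
From mathcomp Require Import all_boot all_order all_algebra.
From mathcomp Require Import all_classical all_reals all_analysis measurable_realfun.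
From mathcomp Require Import ring lra.

Import Order.TTheory GRing.Theory Num.Theory.
Import numFieldNormedType.Exports.

Set Implicit Arguments.
Unset Strict Implicit.
Unset Printing Implicit Defensive.

Local Open Scope classical_set_scope.
Local Open Scope ring_scope.

(** Fix a test function f, put g(z) = \int H_S^-(y) f(z + (y, 0)) dy and, for T
    large, Q g(z) = \int_0^T g(z + (0, t)) dt.  When one factor of a convolution
    has compact support, Vladimirov's sequence is eventually constant, so that
    the second term of the identity, tested on f, is c^-2 U(d_t g).  Since U
    vanishes for t < 0, its test function may be changed for t <= -1, hence
    W(h) = U(Q h).  The divergence theorem turns \int_S n_i f(z + (y, 0)) dS(y)
    into (d_i g)(z), so the surface terms add up to \sum_i U(d_i^2 (Q g)).  For
    t > -1 we have d_t (Q g) = - g, hence U(d_t g) = - U(d_t^2 (Q g)) and the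
    left-hand side is U(Box_c (Q g)) = (Q g)(0), which is the right-hand side
    tested on f by Fubini's theorem.

    Near a boundary point the domain lies on one side of a graph; with
    K = \int_0^L phi(x + s r e_j) dr one has d_j K = - s phi, and integrating
    d_i phi = - s d_j (d_i K) along e_j leaves the integral of d_i K over the
    graph.  The total derivatives of y |-> K(graph y) integrate to 0, which
    yields the factors n_i sqrt (1 + |grad gamma|^2).  Bump functions reduce the
    global divergence theorem to this case. *)

(** * Smooth functions and test functions *)

(** H(t) has no compact support, and the integral of g over all later times is constant for very
    negative t, hence not a test function. Cutting at T makes Q g one, at the price of a wrong d_t
    (Q g) for early times. If g vanishes for |z| > M and T >= M + 1, then t > -1 gives t + T > M, so
    the cut does no harm for t > -1. The margin -1 in place of 0 is there because a support is
    closed, while U vanishes on an open half-space. In the divergence theorem gamma is merely C^1.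
    Flattening the boundary would call for a change of variables by a C^1 map; the primitive K,
    taken over a length L that outruns the support, avoids it. K phi is as smooth as phi, so gamma
    only enters as an inner function differentiated once, and Fubini's theorem, the fundamental
    theorem of calculus and a chain rule along curves suffice. The normal is given geometrically
    (unit, tangency, outward), so its components are read off from the tangency condition along the
    coordinate curves of the graph. The values 1/2 on S and at t = 0 sit on null sets of lines. *)

Section smooth_calculus.
Context {R : realType}.

Notation "''e_' i" := (delta_mx ord0 i) (at level 8, i at level 2, format "''e_' i").

Lemma pderives_rcons n (s : seq 'I_n) i (f : 'rV[R]_n -> R) :
  pderives (rcons s i) f = pderives s (pderive i f).
Proof. by rewrite /pderives foldr_rcons. Qed.

Lemma smooth_continuous n (f : 'rV[R]_n -> R) : smooth f -> continuous f.
Proof. by move=> /(_ [::])[]. Qed.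

Lemma smooth_derivable n (f : 'rV[R]_n -> R) i x :
  smooth f -> derivable f x 'e_i.
Proof. by move=> /(_ [::])[_]; exact. Qed.

Lemma smooth_is_derive n (f : 'rV[R]_n -> R) i x :
  smooth f -> is_derive x 'e_i f (pderive i f x).
Proof. by move=> sf; apply/derivableP/smooth_derivable. Qed.

Lemma smooth_pderive n (f : 'rV[R]_n -> R) i : smooth f -> smooth (pderive i f).
Proof. by move=> sf s; rewrite -pderives_rcons; exact: sf. Qed.

Lemma smooth_pderives n (f : 'rV[R]_n -> R) s : smooth f -> smooth (pderives s f).
Proof. by move=> sf; elim: s => [|i s ih]; [exact: sf|exact: smooth_pderive]. Qed.

(** [smooth] speaks of all words of indices, for which products and quotients have no convenient
    formula. Counting orders, with the derivatives as witnesses, makes the closure properties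
    provable by induction on m for all functions at once. *)
Fixpoint Cn (m n : nat) (f : 'rV[R]_n -> R) : Prop :=
  continuous f /\ if m is m'.+1 then forall i,
    exists2 g : 'rV[R]_n -> R, (forall x, is_derive x 'e_i f (g x)) & Cn m' g
  else True.

Lemma Cn_continuous m n (f : 'rV[R]_n -> R) : Cn m f -> continuous f.
Proof. by case: m => [|m] []. Qed.

Lemma is_derive_pderive n (f g : 'rV[R]_n -> R) i :
  (forall x, is_derive x 'e_i f (g x)) -> pderive i f = g.
Proof. by move=> fg; apply/funext => x; rewrite /pderive derive_val. Qed.

Lemma smoothP n (f : 'rV[R]_n -> R) : smooth f <-> forall m, Cn m f.
Proof.
split=> [sf m|].
  elim: m f sf => [|m ih] f sf; split=> //; try exact: smooth_continuous.
  move=> i; exists (pderive i f); first by move=> x; exact: smooth_is_derive.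
  exact/ih/smooth_pderive.
move=> Cf s; have {}Cf : Cn (size s).+1 f by [].
(* The last letter of the word is the derivative taken first, and it is the one that [Cn] provides
   for f itself. *)
elim/last_ind: s f Cf => [|s i ih] f; first split.
- exact: (Cn_continuous Cf).
- by move=> x i; case: Cf => _ /(_ i)[g fg _].
rewrite size_rcons pderives_rcons => -[_ /(_ i)[g fg Cg]].
by apply: ih; rewrite (is_derive_pderive fg).
Qed.

Lemma CnW m n (f : 'rV[R]_n -> R) : Cn m.+1 f -> Cn m f.
Proof.
elim: m f => [|m ih] f; first by case.
move=> [cf df]; split=> // i; have [g fg Cg] := df i.
by exists g => //; exact: ih.
Qed.

Lemma Cn_cst m n (a : R) : Cn m (fun _ : 'rV[R]_n => a).
Proof.
elim: m a => [|m ih] a; (split; first exact: cst_continuous) => // i.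
by exists (fun=> 0); [move=> x; exact: is_derive_cst|exact: ih].
Qed.

Lemma CnD m n (f g : 'rV[R]_n -> R) : Cn m f -> Cn m g -> Cn m (fun x => f x + g x).
Proof.
elim: m f g => [|m ih] f g [cf df] [cg dg];
  (split; first by move=> x; exact: (cvgD (cf x) (cg x))) => //.
move=> i; have [f' ff' Cf'] := df i; have [g' gg' Cg'] := dg i.
exists (fun x => f' x + g' x); last exact: ih.
by move=> x; exact: (is_deriveD (ff' x) (gg' x)).
Qed.

Lemma CnM m n (f g : 'rV[R]_n -> R) : Cn m f -> Cn m g -> Cn m (fun x => f x * g x).
Proof.
elim: m f g => [|m ih] f g Cf Cg;
  have [cf df] := Cf; have [cg dg] := Cg;
  (split; first by move=> x; exact: (cvgM (cf x) (cg x))) => //.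
move=> i; have [f' ff' Cf'] := df i; have [g' gg' Cg'] := dg i.
exists (fun x => f x * g' x + g x * f' x).
  by move=> x; exact: (is_deriveM (ff' x) (gg' x)).
by apply: CnD; apply: ih => //; exact: CnW.
Qed.

Lemma CnV m n (f : 'rV[R]_n -> R) : (forall x, f x != 0) ->
  Cn m f -> Cn m (fun x => (f x)^-1).
Proof.
move=> f0; elim: m => [|m ih] Cf; have [cf df] := Cf;
  (split; first by move=> x; exact: cvgV (f0 x) (cf x)) => //.
move=> i; have [f' ff' Cf'] := df i.
exists (fun x => - 1 * ((f x)^-1 * (f x)^-1) * f' x).
  move=> x; have [dfx f'E] := ff' x.
  apply: DeriveDef; first exact: derivableV.
  by rewrite (deriveV (f0 x) dfx) f'E mulN1r -expr2 exprVn.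
have CV : Cn m (fun x => (f x)^-1) by apply: ih; exact: CnW.
by apply: CnM => //; apply: CnM; [exact: Cn_cst|exact: CnM].
Qed.

Lemma smooth_cst n (a : R) : smooth (fun _ : 'rV[R]_n => a).
Proof. by apply/smoothP => m; exact: Cn_cst. Qed.

Lemma smoothD n (f g : 'rV[R]_n -> R) :
  smooth f -> smooth g -> smooth (fun x => f x + g x).
Proof. by rewrite !smoothP => Cf Cg m; exact: CnD. Qed.

Lemma smoothM n (f g : 'rV[R]_n -> R) :
  smooth f -> smooth g -> smooth (fun x => f x * g x).
Proof. by rewrite !smoothP => Cf Cg m; exact: CnM. Qed.

Lemma smoothV n (f : 'rV[R]_n -> R) : (forall x, f x != 0) ->
  smooth f -> smooth (fun x => (f x)^-1).
Proof. by move=> f0; rewrite !smoothP => Cf m; exact: CnV. Qed.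

Lemma smoothZ n a (f : 'rV[R]_n -> R) : smooth f -> smooth (fun x => a * f x).
Proof. by move=> sf; exact: smoothM (smooth_cst a) sf. Qed.

Lemma smoothB n (f g : 'rV[R]_n -> R) :
  smooth f -> smooth g -> smooth (fun x => f x - g x).
Proof.
move=> sf sg; rewrite (_ : (fun _ => _) = (fun x => f x + -1 * g x)).
  exact: smoothD sf (smoothZ (-1) sg).
by apply/funext => x; rewrite mulN1r.
Qed.

Lemma smooth_prod n (I : Type) (r : seq I) (F : I -> 'rV[R]_n -> R) :
  (forall i, smooth (F i)) -> smooth (fun x => \prod_(i <- r) F i x).
Proof.
move=> sF; elim: r => [|i r ih].
  by under eq_fun do rewrite big_nil; exact: smooth_cst.
by under eq_fun do rewrite big_cons; exact: smoothM (sF i) ih.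
Qed.

Lemma pderiveD n i (f g : 'rV[R]_n -> R) : smooth f -> smooth g ->
  pderive i (fun x => f x + g x) = (fun x => pderive i f x + pderive i g x).
Proof.
move=> sf sg; apply/is_derive_pderive => x.
exact: (is_deriveD (smooth_is_derive i x sf) (smooth_is_derive i x sg)).
Qed.

Lemma pderiveM n i (f g : 'rV[R]_n -> R) : smooth f -> smooth g ->
  pderive i (fun x => f x * g x) = (fun x => f x * pderive i g x + g x * pderive i f x).
Proof.
move=> sf sg; apply/is_derive_pderive => x.
exact: (is_deriveM (smooth_is_derive i x sf) (smooth_is_derive i x sg)).
Qed.

Lemma pderiveZ n i a (f : 'rV[R]_n -> R) : smooth f ->
  pderive i (fun x => a * f x) = (fun x => a * pderive i f x).
Proof.
move=> sf; rewrite (pderiveM i (smooth_cst a) sf).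
apply/funext => x; rewrite (_ : pderive i (fun=> a) x = 0) ?mulr0 ?addr0//.
exact: derive_cst.
Qed.

(** A directional derivative sees only the restriction to a line, so it can be carried between
    functions on different spaces. *)
Lemma is_derive_congr (V W : normedModType R) (f : V -> R) (g : W -> R) x y v w l :
  (forall h : R, f (h *: v + x) = g (h *: w + y)) ->
  is_derive x v f l -> is_derive y w g l.
Proof.
move=> fg [df <-].
have qfg : (fun h => h^-1 *: (f (h *: v + x) - f x)) =
           (fun h => h^-1 *: (g (h *: w + y) - g y)).
  by apply/funext => h; have := fg 0; rewrite !scale0r !add0r fg => ->.
by split; [move: df|]; rewrite /derivable /derive qfg.
Qed.

Lemma derive_scaled_dir n (f : 'rV[R]_n -> R) x v c l :
  is_derive x v f l -> is_derive x (c *: v) f (c * l).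
Proof.
move=> dfl; pose g (h : R) := f (h *: v + x).
have dg : is_derive (0 : R) (1 : R) g l.
  apply: (is_derive_congr _ dfl) => h.
  by rewrite /g addr0 [h *: 1]mulr1.
have dgc : is_derive (0 : R) (1 : R) (fun h => g (h * c)) (c * l).
  have d0 : is_derive (0 : R) (1 : R) (fun h : R => h * c) c.
    have := is_deriveM (is_derive_id (0 : R) (1 : R)) (is_derive_cst c (0 : R) (1 : R)).
    by move/is_derive_eq; apply; rewrite scaler0 add0r [_ *: _]mulr1.
  apply: (@is_derive_eq _ _ _ _ _ _ _ (l *: c)); last by rewrite [LHS]mulrC.
  by apply: is_derive1_comp; rewrite mul0r.
apply: (is_derive_congr _ dgc) => h.
by rewrite /g addr0 scalerA [h *: 1]mulr1.
Qed.

(** A step along e_i moves the value along the single direction e_(k i). Dilations, block insertions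
    and the sum of the two halves of a row (where k is not injective) are of this kind, so partial
    derivatives compose without a general chain rule. *)
Definition coord_affine m n (c : 'I_m -> R) (k : 'I_m -> 'I_n)
    (L : 'rV[R]_m -> 'rV[R]_n) :=
  forall x i h, L (h *: 'e_i + x) = h *: (c i *: 'e_(k i)) + L x.

Lemma is_derive_comp_affine m n c k (L : 'rV[R]_m -> 'rV[R]_n) (f : 'rV[R]_n -> R) x i l :
  coord_affine c k L -> is_derive (L x) 'e_(k i) f l ->
  is_derive x 'e_i (fun x => f (L x)) (c i * l).
Proof.
move=> Lck /(derive_scaled_dir (c i)); apply: is_derive_congr => h.
by rewrite Lck.
Qed.

Lemma Cn_comp_affine p m n c k (L : 'rV[R]_m -> 'rV[R]_n) (f : 'rV[R]_n -> R) :
  continuous L -> coord_affine c k L -> Cn p f -> Cn p (fun x => f (L x)).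
Proof.
move=> cL Lck; elim: p f => [|p ih] f [cf df];
  (split; first by move=> x; exact: (continuous_comp (cL x) (cf (L x)))) => // i.
have [g fg Cg] := df (k i).
exists (fun x => c i * g (L x)).
  by move=> x; exact: is_derive_comp_affine Lck (fg _).
by apply: CnM; [exact: Cn_cst|exact: ih].
Qed.

Lemma smooth_comp_affine m n c k (L : 'rV[R]_m -> 'rV[R]_n) (f : 'rV[R]_n -> R) :
  continuous L -> coord_affine c k L -> smooth f -> smooth (fun x => f (L x)).
Proof. by move=> cL Lck; rewrite !smoothP => Cf p; exact: Cn_comp_affine Lck _. Qed.

Lemma pderive_comp_affine m n c k (L : 'rV[R]_m -> 'rV[R]_n) (f : 'rV[R]_n -> R) i :
  coord_affine c k L -> smooth f ->
  pderive i (fun x => f (L x)) = (fun x => c i * pderive (k i) f (L x)).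
Proof.
move=> Lck sf; apply/is_derive_pderive => x.
by apply: (is_derive_comp_affine Lck); exact: smooth_is_derive.
Qed.

Lemma pderives_comp_affine m n c k (L : 'rV[R]_m -> 'rV[R]_n) (f : 'rV[R]_n -> R) s :
  continuous L -> coord_affine c k L -> smooth f ->
  pderives s (fun x => f (L x)) =
  (fun x => \prod_(i <- s) c i * pderives (map k s) f (L x)).
Proof.
move=> cL Lck sf; elim: s => [|i s ih] /=.
  by apply/funext => x; rewrite big_nil mul1r.
have sg := smooth_pderives (map k s) sf.
rewrite ih (pderiveZ _ _ (smooth_comp_affine cL Lck sg)).
rewrite (pderive_comp_affine i Lck sg); apply/funext => x.
by rewrite big_cons mulrCA mulrA.
Qed.

Lemma addr_right_continuous n (a : 'rV[R]_n) :
  continuous (fun x : 'rV[R]_n => x + a).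
Proof.
by move=> x; exact: (@cvgD _ _ _ (nbhs x) _ id (cst a) x a cvg_id (cvg_cst _)).
Qed.

End smooth_calculus.

Section rV_norm.
Context {R : realType} {n : nat}.
Implicit Types x : 'rV[R]_n.

Lemma coord_le_norm x i : `|x ord0 i| <= `|x|.
Proof.
have -> : `|x| = mx_norm x by []. rewrite mx_normrE.
exact: (le_bigmax _ (fun p : 'I_1 * 'I_n => `|x p.1 p.2|) (ord0, i)).
Qed.

Lemma rV_norm_le x r : 0 <= r -> (forall i, `|x ord0 i| <= r) -> `|x| <= r.
Proof.
move=> r0 xr; have -> : `|x| = mx_norm x by [].
rewrite mx_normrE; apply/bigmax_leP; split=> // -[i j] _ /=.
by rewrite ord1.
Qed.

Lemma coord_continuous_row i : continuous (fun x : 'rV[R]_n => x ord0 i).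
Proof. by move=> x; exact: coord_continuous. Qed.

Lemma norm_le_compact (M : R) : compact [set x : 'rV[R]_n | `|x| <= M].
Proof.
apply: bounded_closed_compact.
  by exists M; split=> [|A MA x /= /le_trans]; [exact: num_real|apply; exact: ltW].
apply: (@preimage_closed _ _ (fun x : 'rV[R]_n => `|x|) [set y | y <= M]).
  by move=> x _; exact: (@norm_continuous _ 'rV[R]_n).
exact: closed_le.
Qed.

Lemma compact_norm_le (K : set 'rV[R]_n) : compact K ->
  exists2 M, 0 < M & forall x, K x -> `|x| <= M.
Proof.
move=> /compact_bounded[M [_ MK]]; exists (`|M| + 1).
  by rewrite ltr_wpDl.
by move=> x; apply: MK; rewrite ltr_pwDr// ler_norm.
Qed.

End rV_norm.

(** * Smooth cutoff functions *)

Section flat_function.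
Context {R : realType}.

(** The powers t^-k make the family closed under differentiation, so smoothness of exp(-1/t)
    extended by 0 follows by one induction for all k. *)
Definition flat k (t : R) : R := if 0 < t then t ^- k * expR (- t^-1) else 0.

Lemma flat_ge0 k t : 0 <= flat k t.
Proof.
rewrite /flat; case: ifPn => // t0.
by rewrite mulr_ge0 ?expR_ge0// invr_ge0 exprn_ge0// ltW.
Qed.

(** For t > 0 this is (1/t)^(k+2) <= (k+2)! exp(1/t). The factor t^2 makes the difference quotient
    at 0 of order |h|, whatever k is. *)
Lemma flat_le k t : flat k t <= (k.+2)`!%:R * t ^+ 2.
Proof.
rewrite /flat; case: ifPn => [t0|_]; last by rewrite mulr_ge0 ?sqr_ge0.
have tV0 : 0 <= t^-1 by rewrite invr_ge0 ltW.
have F0 : 0 < (k.+2)`!%:R :> R by rewrite ltr0n fact_gt0.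
rewrite expRN ler_pdivrMr ?expR_gt0//.
have H : t ^- k.+2 <= (k.+2)`!%:R * expR t^-1.
  rewrite mulrC -ler_pdivrMr// -exprVn (le_trans _ (expR_ge1Dxn k.+1 tV0))//.
  by rewrite lerDr.
rewrite mulrAC (le_trans _ (ler_wpM2r (sqr_ge0 t) H))// -addn2 exprD invfM.
by rewrite -mulrA mulVf ?mulr1// gt_eqF// exprn_gt0.
Qed.

Lemma flat_le0 k t : t <= 0 -> flat k t = 0.
Proof. by rewrite /flat ltNge => ->. Qed.

Lemma flat_gt0 t k : 0 < t -> 0 < flat k t.
Proof.
by move=> t0; rewrite /flat t0 mulr_gt0 ?expR_gt0// invr_gt0 exprn_gt0.
Qed.

Lemma is_derive_flat k (t : R) :
  is_derive t 1 (flat k) (- k%:R * flat k.+1 t + flat k.+2 t).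
Proof.
have [t0|t0|->] := ltgtP t 0.
- apply: (@near_eq_is_derive _ _ _ (cst 0)).
    near=> s; rewrite flat_le0//; apply: ltW; near: s; exact: lt_nbhsl.
  rewrite !flat_le0 ?(ltW t0)// mulr0 addr0; exact: is_derive_cst.
- apply: (@near_eq_is_derive R R R (fun s : R => (s ^+ k)^-1 * expR (- s^-1))).
    near=> s; rewrite /flat ifT//; near: s; exact: lt_nbhsr.
  have tn0 : t != 0 by rewrite gt_eqF.
  have dX : is_derive t 1 (fun s : R => s ^+ k) (k%:R * t ^+ k.-1).
    by split; [exact: exprn_derivable|rewrite exp_derive [_ *: 1]mulr1].
  have dXV : is_derive t 1 (fun s : R => (s ^+ k)^-1) (- (t ^+ k) ^- 2 * (k%:R * t ^+ k.-1)).
    case: dX => dX <-; have tkn0 : (fun s : R => s ^+ k) t != 0 by rewrite expf_neq0.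
    by split; [exact: derivableV|rewrite deriveV].
  have dV : is_derive t 1 (fun s : R => - s^-1) (t ^- 2).
    have [dV VE] : is_derive t 1 (fun s : R => s^-1) (- t ^- 2).
      split; first exact: (derivableV tn0 (@derivable_id _ _ _ _)).
      by rewrite (deriveV tn0 (@derivable_id _ _ _ _)) derive_id [_ *: _]mulr1.
    split; first exact: derivableN.
    by rewrite (deriveN dV) VE opprK.
  have dE : is_derive t 1 (fun s => expR (- s^-1)) (t ^- 2 * expR (- t^-1)).
    have dE : is_derive t 1 (fun s : R => expR (- s^-1)) (expR (- t^-1) * t ^- 2).
      exact: (@is_derive1_comp _ expR (fun s : R => - s^-1) _ _ _ (is_derive_expR _) dV).
    by apply: (is_derive_eq dE); rewrite mulrC.
  have dM : is_derive t 1 (fun s : R => s ^- k * expR (- s^-1)) _ := is_deriveM dXV dE.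
  apply: (is_derive_eq dM).
  rewrite /flat t0 /GRing.scale/=.
  case: k {dX dXV dM} => [|k] /=.
    by rewrite expr0 !invr1 !mul0r !mulr0 oppr0 mul0r addr0 add0r mul1r.
  rewrite !exprS !expr0; field.
  by rewrite tn0 expf_neq0.
- rewrite !flat_le0// mulr0 addr0.
  suff H : h^-1 *: (flat k (h *: 1 + 0) - flat k 0) @[h --> (0:R)^'] --> (0 : R).
    by split; [apply/cvg_ex; exists 0|exact: cvg_lim].
  rewrite flat_le0//; pose C : R := (k.+2)`!%:R.
  have H0 : C * `|h| @[h --> (0:R)^'] --> (0 : R).
    rewrite -[X in _ --> X](mulr0 C); apply: cvgM; first exact: cvg_cst.
    have H := @norm_continuous _ R 0; rewrite /continuous_at normr0 in H.
    exact: (cvg_trans (cvg_app _ (@cvg_within _ _ _ _)) H).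
  apply/cvgr0Pnorm_le => e e0; move/cvgr0Pnorm_le : H0 => /(_ _ e0).
  apply: filter_app; near=> h => Ch.
  have h0 : h != 0 by near: h; exact: nbhs_dnbhs_neq.
  rewrite subr0 addr0 [h *: 1]mulr1 (le_trans _ Ch)// normrZ normrM normr_id.
  rewrite normfV mulrC ler_pdivrMr ?normr_gt0// (ger0_norm (flat_ge0 _ _)).
  by rewrite (le_trans (flat_le _ _))// -mulrA -expr2 real_normK ?num_real// ger0_norm.
Unshelve. all: by end_near. Qed.

Lemma Cn_flat m k : Cn m (fun x : 'rV[R]_1 => flat k (x ord0 ord0)).
Proof.
have cf j : continuous (fun x : 'rV[R]_1 => flat j (x ord0 ord0)).
  move=> x; apply: (continuous_comp (@coord_continuous_row R 1 ord0 x)).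
  apply: differentiable_continuous; apply/derivable1_diffP.
  by case: (is_derive_flat j (x ord0 ord0)).
elim: m k => [|m ih] k; split=> // i.
exists (fun x => - k%:R * flat k.+1 (x ord0 ord0) + flat k.+2 (x ord0 ord0)).
  move=> x; apply: (is_derive_congr _ (is_derive_flat k (x ord0 ord0))) => h.
  by rewrite !mxE !ord1 eqxx.
by apply: CnD => //; apply: CnM => //; exact: Cn_cst.
Qed.

Lemma smooth_flat k : smooth (fun x : 'rV[R]_1 => flat k (x ord0 ord0)).
Proof. by apply/smoothP => m; exact: Cn_flat. Qed.

Definition smoothstep (t : R) : R := flat 0 t / (flat 0 t + flat 0 (1 - t)).

(** The numbers t and 1 - t cannot both be nonpositive. *)
Let smoothstep_den t : 0 < flat 0 t + flat 0 (1 - t).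
Proof.
have [t0|t0] := ltP 0 t; first by rewrite ltr_pwDl ?flat_gt0 ?flat_ge0.
by rewrite ltr_wpDl ?flat_ge0 ?flat_gt0// subr_gt0 (le_lt_trans t0).
Qed.

Lemma smoothstep0 t : t <= 0 -> smoothstep t = 0.
Proof. by move=> t0; rewrite /smoothstep flat_le0 ?mul0r. Qed.

Lemma smoothstep1 t : 1 <= t -> smoothstep t = 1.
Proof.
move=> t1; have := smoothstep_den t; rewrite /smoothstep (@flat_le0 _ (1 - t)) ?subr_le0//.
by rewrite addr0 => /gt_eqF fn0; rewrite divff ?fn0.
Qed.

Lemma smooth_smoothstep (c a : R) :
  smooth (fun x : 'rV[R]_1 => smoothstep (c * x ord0 ord0 + a)).
Proof.
have aff (c' a' : R) : smooth (fun x : 'rV[R]_1 => flat 0 (c' * x ord0 ord0 + a')).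
  rewrite (_ : (fun _ => _) =
    (fun x : 'rV[R]_1 => flat 0 ((c' *: x + const_mx a') ord0 ord0))); last first.
    by apply/funext => x; rewrite !mxE.
  apply: (@smooth_comp_affine _ 1 1 (fun=> c') id (fun x => c' *: x + const_mx a') _ _ _ (smooth_flat 0)).
    move=> x; apply: (@cvgD _ _ _ (nbhs x) _ ( *:%R c') (cst (const_mx a'))).
      exact: scaler_continuous.
    exact: cvg_cst.
  by move=> x i h; rewrite scalerDr addrA !scalerA [c' * h]mulrC.
rewrite /smoothstep; apply: smoothM; first exact: aff.
apply: smoothV; first by move=> x; rewrite gt_eqF.
apply: smoothD; first exact: aff.
rewrite (_ : (fun _ => _) = (fun x : 'rV[R]_1 => flat 0 (- c * x ord0 ord0 + (1 - a)))); first exact: aff.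
by apply/funext => x; congr flat; ring.
Qed.

End flat_function.

Section bumps.
Context {R : realType}.

Lemma smooth_coord_comp n (g : R -> R) (i : 'I_n) c a :
  smooth (fun y : 'rV[R]_1 => g (y ord0 ord0)) ->
  smooth (fun x : 'rV[R]_n => g (c * x ord0 i + a)).
Proof.
move=> sg; pose L (x : 'rV[R]_n) : 'rV[R]_1 := const_mx (c * x ord0 i + a).
rewrite (_ : (fun _ => _) = fun x => g (L x ord0 ord0)); last first.
  by apply/funext => x; rewrite mxE.
apply: (@smooth_comp_affine _ n 1 (fun j => c * (i == j)%:R) (fun=> ord0) L _ _ _ sg).
  move=> x; rewrite /L.
  apply: (@continuous_comp _ _ _ (fun x : 'rV[R]_n => c * x ord0 i + a)
    (fun t => const_mx t : 'rV[R]_1)).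
    apply: (@cvgD _ _ _ (nbhs x) _ (fun x : 'rV[R]_n => c * x ord0 i) (cst a)).
      apply: (@cvgM _ _ (nbhs x) _ (cst c) (fun x : 'rV[R]_n => x ord0 i)).
        exact: cvg_cst.
      exact: coord_continuous_row.
    exact: cvg_cst.
  apply/cvgrPdist_le => e e0; near=> t.
  rewrite rV_norm_le ?(ltW e0)// => j; rewrite !mxE.
  by near: t; apply: cvgr_dist_le => //; exact: cvg_id.
move=> x j h; apply/rowP => k; rewrite !ord1 !mxE /=; ring.
Unshelve. all: by end_near. Qed.

Definition plateau (t : R) : R := smoothstep (t + 2) * smoothstep (2 - t).

Lemma plateau0 t : 2 <= `|t| -> plateau t = 0.
Proof.
rewrite /plateau ler_normr => /orP[t2|t2].
  by rewrite [X in _ * X]smoothstep0 ?mulr0//; lra.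
by rewrite smoothstep0 ?mul0r//; lra.
Qed.

Lemma plateau1 t : `|t| <= 1 -> plateau t = 1.
Proof.
by rewrite /plateau ler_norml => /andP[? ?]; rewrite !smoothstep1 ?mulr1//; lra.
Qed.

Lemma smooth_plateau : smooth (fun y : 'rV[R]_1 => plateau (y ord0 ord0)).
Proof.
rewrite /plateau; apply: smoothM.
  rewrite (_ : (fun _ => _) = fun x : 'rV[R]_1 => smoothstep (1 * x ord0 ord0 + 2)).
    exact: smooth_smoothstep.
  by apply/funext => x; rewrite mul1r.
rewrite (_ : (fun _ => _) = fun x : 'rV[R]_1 => smoothstep (-1 * x ord0 ord0 + 2)).
  exact: smooth_smoothstep.
by apply/funext => x; rewrite mulN1r addrC.
Qed.

Definition box_bump n (a : 'rV[R]_n) (r : R) (x : 'rV[R]_n) : R :=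
  \prod_(i < n) plateau ((x ord0 i - a ord0 i) / r).

Lemma smooth_box_bump n (a : 'rV[R]_n) r : smooth (box_bump a r).
Proof.
apply: smooth_prod => i.
rewrite (_ : (fun _ => _) = fun x : 'rV[R]_n => plateau (r^-1 * x ord0 i + - a ord0 i / r)).
  exact/smooth_coord_comp/smooth_plateau.
by apply/funext => x; congr plateau; ring.
Qed.

Lemma box_bump1 n (a : 'rV[R]_n) r x : 0 < r -> `|x - a| <= r -> box_bump a r x = 1.
Proof.
move=> r0 xar; rewrite /box_bump big1// => i _; apply: plateau1.
rewrite normrM normfV (gtr0_norm r0) ler_pdivrMr// mul1r.
by have := le_trans (coord_le_norm (x - a) i) xar; rewrite !mxE.
Qed.

Lemma box_bump0 n (a : 'rV[R]_n) r x : 0 < r -> 2 * r < `|x - a| -> box_bump a r x = 0.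
Proof.
move=> r0 xar; apply/eqP; apply: contraLR xar => /prodf_neq0 b0.
rewrite -leNgt; apply: rV_norm_le => [|i]; first by rewrite mulr_ge0 ?ltW.
rewrite !mxE; have := b0 i isT; apply: contraNle => xar; apply/eqP/plateau0.
by rewrite normrM normfV (gtr0_norm r0) ler_pdivlMr// ltW.
Qed.

End bumps.

(** * Supports of test functions and unit sequences *)

Section test_functions.
Context {R : realType} {n : nat}.
Implicit Types (f g : 'rV[R]_n -> R) (x : 'rV[R]_n).

Lemma compact_fsupp f (M : R) : (forall x, M < `|x| -> f x = 0) -> compact (fsupp f).
Proof.
move=> fM; apply: (@subclosed_compact _ _ [set x : 'rV[R]_n | `|x| <= M]).
- exact: closed_closure.
- exact: norm_le_compact.
rewrite [X in _ `<=` X](closure_id _).1; last first.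
  by apply: compact_closed; [exact: norm_hausdorff|exact: norm_le_compact].
apply: closureS => x /=; apply: contraNT; rewrite -ltNge => /fM ->.
by rewrite eqxx.
Qed.

Lemma fsupp0 f x : ~ fsupp f x -> f x = 0.
Proof.
move=> nfx; apply/eqP; apply: contrapT => /negP fx0; apply: nfx.
exact: subset_closure.
Qed.

Lemma fsupp0_near f x : ~ fsupp f x -> \forall y \near x, f y = 0.
Proof.
move=> nfx; have : open (~` fsupp f) by apply/closed_openC/closed_closure.
rewrite openE => /(_ _ nfx); rewrite /interior/=.
by apply: filterS => y; exact: fsupp0.
Qed.

Lemma near0_pderive f i x : (\forall y \near x, f y = 0) ->
  \forall y \near x, pderive i f y = 0.
Proof.
move=> /nbhs_interior; apply: filterS => y yf.
rewrite /pderive (near_eq_derive (g := cst 0))//; exact: derive_cst.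
Qed.

Lemma near0_pderives f s x : (\forall y \near x, f y = 0) ->
  \forall y \near x, pderives s f y = 0.
Proof. by move=> f0; elim: s => [|i s ih] //=; exact: near0_pderive. Qed.

Lemma pderives0 f s x : ~ fsupp f x -> pderives s f x = 0.
Proof. by move=> /fsupp0_near/(near0_pderives s)/nbhs_singleton. Qed.

Lemma pderive0 f i x : ~ fsupp f x -> pderive i f x = 0.
Proof. exact: (pderives0 [:: i]). Qed.

Lemma pderive_norm0 f M i x : (forall y, M < `|y| -> f y = 0) ->
  M < `|x| -> pderive i f x = 0.
Proof.
move=> fM Mx; have nM : \forall y \near x, f y = 0.
  have : \forall y \near x, M < `|y|.
    exact: (@cvgr_gt _ _ (nbhs x) _ (fun y : 'rV[R]_n => `|y|) _ (@norm_continuous _ _ x)).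
  by apply: filterS => y; exact: fM.
exact: (nbhs_singleton (near0_pderive i nM)).
Qed.

Lemma fsupp_pderives f s : fsupp (pderives s f) `<=` fsupp f.
Proof.
rewrite [X in _ `<=` X](closure_id _).1; last exact: closed_closure.
apply: closureS => x /= fx; apply: contrapT => /pderives0 fx0.
by rewrite fx0 eqxx in fx.
Qed.

Lemma test_function_pderives f s : test_function f -> test_function (pderives s f).
Proof.
move=> [sf cf]; split; first exact: smooth_pderives.
by apply: (subclosed_compact _ cf); [exact: closed_closure|exact: fsupp_pderives].
Qed.

Lemma test_function_pderive f i : test_function f -> test_function (pderive i f).
Proof. exact: (@test_function_pderives _ [:: i]). Qed.

Lemma test_functionM f g : test_function f -> smooth g ->
  test_function (fun x => f x * g x).
Proof.
move=> [sf cf] sg; split; first exact: smoothM.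
apply: (subclosed_compact _ cf); first exact: closed_closure.
by apply: closureS => x /=; apply: contraNN => /eqP ->; rewrite mul0r.
Qed.

Lemma test_function_bound f : test_function f ->
  exists2 M, 0 < M & forall x, M < `|x| -> f x = 0.
Proof.
move=> [_ /compact_norm_le[M M0 fM]]; exists M => // x Mx; apply: fsupp0 => /fM.
by rewrite leNgt Mx.
Qed.

Lemma test_functionZD a f g : test_function f -> test_function g ->
  test_function (fun x => a * f x + g x).
Proof.
move=> tf tg; split.
  by apply: smoothD (proj1 tg); apply: smoothZ; exact: (proj1 tf).
have [M _ fM] := test_function_bound tf; have [M' _ gM] := test_function_bound tg.
apply: (@compact_fsupp _ (Num.max M M')) => x; rewrite gt_max => /andP[Mx M'x].
by rewrite fM// gM// mulr0 addr0.
Qed.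

Lemma test_function_bounded f s : test_function f ->
  exists2 C, 0 <= C & forall x, `|pderives s f x| <= C.
Proof.
move=> tf; have [sg cg] := test_function_pderives s tf; set g := pderives s f.
have := continuous_compact _ cg; move=> /(_ _ g) cgc.
have : compact (g @` fsupp g).
  by apply: cgc; exact/continuous_subspaceT/smooth_continuous.
move=> /compact_bounded[M [_ Mg]]; exists (`|M| + 1); first by rewrite addr_ge0.
move=> x; have [xg|/fsupp0] := pselect (fsupp g x).
  apply: Mg; first by rewrite ltr_pwDr// ler_norm.
  by exists x.
by rewrite -/g => ->; rewrite normr0 addr_ge0.
Qed.

End test_functions.

(** Without a unit sequence every number would pass for the limit in [conv_distr]. Dilating one bump
    by k + 1 multiplies a derivative of order |s| by (k + 1)^-|s| <= 1, so the bound for the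
    undilated bump serves all k. *)
Lemma unit_sequence_exists (R : realType) (n : nat) :
  exists eta : nat -> 'rV[R]_n -> R, unit_sequence eta.
Proof.
exists (fun k => box_bump 0 k.+1%:R); split.
- move=> k; split; first exact: smooth_box_bump.
  apply: (@compact_fsupp _ _ _ (2 * k.+1%:R)) => x xk.
  by apply: box_bump0; rewrite ?subr0.
- move=> K /compact_norm_le[M _ KM]; near=> k => x /KM xM.
  apply: box_bump1 => //; rewrite subr0 (le_trans xM)//.
  near: k; have := @nbhs_infty_ger R M; apply: filterS => k /le_trans; apply.
  by rewrite ler_nat.
- move=> s.
  have [C C0 bC] : exists2 C : R, 0 <= C & forall x, `|pderives s (@box_bump R n 0 1) x| <= C.
    apply: test_function_bounded; split; first exact: smooth_box_bump.
    apply: (@compact_fsupp _ _ _ 2) => x xk.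
    by apply: box_bump0; rewrite ?subr0 ?mulr1.
  exists C => k x.
  have -> : box_bump 0 k.+1%:R = (fun x : 'rV[R]_n => box_bump 0 1 (k.+1%:R^-1 *: x)).
    apply/funext => y; apply: eq_bigr => i _; congr plateau.
    by rewrite !mxE !subr0 divr1 mulrC.
  rewrite (@pderives_comp_affine _ n n (fun=> k.+1%:R^-1) id); last 3 first.
  - exact: scaler_continuous.
  - by move=> y i h; rewrite scalerDr !scalerA mulrC.
  - exact: smooth_box_bump.
  rewrite normrM map_id; apply: le_trans (bC (k.+1%:R^-1 *: x)).
  rewrite ler_piMl// big_const_seq count_predT iter_mulr_1 normrX.
  by rewrite exprn_ile1// normfV ger0_norm// invf_le1// ler1n.
Unshelve. all: by end_near. Qed.

(** * Integration on R^n *)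

Section borel_rV.
Context {R : realType} {n : nat}.

(** The sigma-algebra is generated by the coordinates, so A is written as a countable union of
    rational cubes. Cubes that leave A are replaced by [set0], which lets the union run over a whole
    countable type. *)
Lemma open_measurable_rV (A : set 'rV[R]_n) : open A -> measurable A.
Proof.
move=> oA.
pose box (p : 'rV[rat]_n * nat) : set 'rV[R]_n :=
  [set y | forall i, `|y ord0 i - ratr (p.1 ord0 i)| < p.2.+1%:R^-1].
pose F (p : 'rV[rat]_n * nat) := if pselect (box p `<=` A) then box p else set0.
have -> : A = \bigcup_p F p.
  apply/seteqP; split=> [x Ax|x [p _]]; last first.
    by rewrite /F; case: pselect => // pA; exact: pA.
  have /nbhs_ballP[e /= e0 xeA] : nbhs x A by exact: open_nbhs_nbhs.
  (* A cube of half-side 1/(k+1) that contains x lies within 2/(k+1) < e of x. *)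
  pose k := Num.truncn (2 / e).
  have ke : k.+1%:R^-1 < e / 2.
    rewrite -[X in _ < X]invf_div ltf_pV2 ?posrE ?divr_gt0//.
    exact: truncnS_gt.
  have /choice[q qP] : forall i, exists q : rat, `|x ord0 i - ratr q| < k.+1%:R^-1.
    move=> i; have xlt : x ord0 i - k.+1%:R^-1 < x ord0 i + k.+1%:R^-1.
      by rewrite ltrD2l gtrN.
    have [q] := rat_in_itvoo xlt.
    by rewrite in_itv/= => /andP[h1 h2]; exists q; rewrite ltr_distlC h1.
  pose p : 'rV[rat]_n * nat := (\row_i q i, k).
  have bpx : box p x by move=> i; rewrite /p/= mxE.
  have bpA : box p `<=` A.
    move=> y bpy; apply: xeA; rewrite -ball_normE/=.
    apply: (@le_lt_trans _ _ (2 * k.+1%:R^-1)); last by rewrite mulrC -ltr_pdivlMr.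
    apply: rV_norm_le => [|i]; first by rewrite mulr_ge0.
    rewrite !mxE (le_trans (ler_distD (ratr (q i)) _ _))// mulr_natl mulr2n lerD//.
      by rewrite ltW.
    by rewrite distrC; have := bpy i; rewrite /p/= mxE => /ltW.
  by exists p => //; rewrite /F; case: pselect.
apply: countable_bigcupT_measurable; first exact: countableP.
move=> p; rewrite /F; case: (pselect (box p `<=` A)) => pA /=; last exact: measurable0.
have -> : box p = \bigcap_(i in [set: 'I_n])
    (fun x : 'rV[R]_n => x ord0 i) @^-1` [set t | `|t - ratr (p.1 ord0 i)| < p.2.+1%:R^-1].
  by apply/seteqP; split=> [y by_ i _|y by_ i]; exact: by_.
apply: fin_bigcap_measurable => // i _.
rewrite -[X in measurable X]setTI; apply: measurable_rV_coord => //.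
rewrite (_ : [set _ | _] = ball (ratr (p.1 ord0 i) : R) p.2.+1%:R^-1); last first.
  by apply/seteqP; split => y; rewrite -ball_normE/= distrC.
by apply: open_measurable; apply: ball_open.
Qed.

Lemma closed_measurable_rV (A : set 'rV[R]_n) : closed A -> measurable A.
Proof. by move/closed_openC/open_measurable_rV/measurableC; rewrite setCK. Qed.

Lemma continuous_within_measurable_rV (A : set 'rV[R]_n) (f : 'rV[R]_n -> R) :
  measurable A -> {within A, continuous f} -> measurable_fun A f.
Proof.
move=> mA /continuousP cf; apply: (measurability _ (measurable_realfun.RGenOpens.measurableE R)).
move=> _ [_ [a [b ->] <-]].
have /open_subspaceP[V oV VA] := cf _ (@interval_open _ (BRight a) (BLeft b) isT isT).
rewrite setIC -VA; apply: measurableI => //; exact: open_measurable_rV.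
Qed.

Lemma continuous_measurable_rV (f : 'rV[R]_n -> R) :
  continuous f -> measurable_fun setT f.
Proof.
move=> cf; apply: continuous_within_measurable_rV => //.
exact: continuous_subspaceT.
Qed.

Lemma compact_measurable_rV (K : set 'rV[R]_n) : compact K -> measurable K.
Proof. by move=> cK; apply: closed_measurable_rV; apply: compact_closed cK; exact: norm_hausdorff. Qed.

End borel_rV.

(** * Mean values and first-order expansion of C^1 functions *)

Section mean_value.
Context {R : realType} {n : nat}.

Lemma rV_nbhs0_lt (r : R) : 0 < r -> \forall h \near (0 : 'rV[R]_n), `|h| < r.
Proof.
move=> r0; apply/nbhs_ballP; exists r => //= y.
by rewrite -ball_normE/= sub0r normrN.
Qed.

Lemma continuous_line (f : 'rV[R]_n -> R) i x :
  (forall x, derivable f x (delta_mx ord0 i)) ->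
  forall t : R, is_derive t (1 : R) (fun t => f (t *: delta_mx ord0 i + x))
    (pderive i f (t *: delta_mx ord0 i + x)).
Proof.
move=> df t; apply: (is_derive_congr _ (derivableP (df (t *: delta_mx ord0 i + x)))) => h.
by rewrite addrA -scalerDl [h *: 1]mulr1.
Qed.

(** From x to x + h one moves along one axis at a time; [hp m] keeps the first m coordinates of h.
    Each leg is a one-variable mean value theorem, hence one intermediate point per coordinate. *)
Lemma MVT_rV (f : 'rV[R]_n -> R) (x h : 'rV[R]_n) :
  (forall i x, derivable f x (delta_mx ord0 i)) ->
  exists xi : 'I_n -> 'rV[R]_n, (forall i, `|xi i - x| <= `|h|) /\
    f (x + h) - f x = \sum_i h ord0 i * pderive i f (xi i).
Proof.
move=> df.
pose hp (m : nat) : 'rV[R]_n := \row_i (if (i < m)%N then h ord0 i else 0).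
have hpS (i : 'I_n) : hp i.+1 = h ord0 i *: delta_mx ord0 i + hp i.
  apply/rowP => j; rewrite !mxE ltnS leq_eqVlt eqxx /=.
  by have [->|] := eqVneq j i; rewrite ?eqxx ?ltnn ?mulr1 ?addr0 ?mulr0 ?add0r//
    => /negPf; rewrite -val_eqE/= => ->.
have H (i : 'I_n) : exists t : R, `|t| <= `|h ord0 i| /\
    f (x + hp i.+1) - f (x + hp i) =
    h ord0 i * pderive i f (t *: delta_mx ord0 i + (x + hp i)).
  pose g t := f (t *: delta_mx ord0 i + (x + hp i)).
  have dg (t : R) : is_derive t (1 : R) g (pderive i f (t *: delta_mx ord0 i + (x + hp i))).
    exact: continuous_line.
  have cg A : {within A, continuous g}.
    apply: continuous_subspaceT => t; apply: differentiable_continuous.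
    by apply/derivable1_diffP; case: (dg t).
  have -> : f (x + hp i.+1) = g (h ord0 i) by rewrite /g hpS addrCA.
  have -> : f (x + hp i) = g 0 by rewrite /g scale0r add0r.
  have [h0|h0] := leP 0 (h ord0 i).
    have [t + gE] := MVT_segment h0 (fun t _ => dg t) (cg _).
    rewrite in_itv/= => /andP[t0 th]; exists t; split.
      by rewrite !ger0_norm.
    by rewrite gE subr0 mulrC.
  have [t + gE] := MVT_segment (ltW h0) (fun t _ => dg t) (cg _).
  rewrite in_itv/= => /andP[t0 th]; exists t; split.
    by rewrite !ler0_norm ?lerN2// ltW.
  by rewrite -opprB gE sub0r mulrN opprK mulrC.
have /choice[t tP] := H.
exists (fun i => t i *: delta_mx ord0 i + (x + hp i)); split=> [i|].
  apply: rV_norm_le => // j; rewrite !mxE eqxx /=.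
  rewrite [X in `|X|](_ : _ = t i * (j == i)%:R + (if (j < i)%N then h ord0 j else 0)); last by ring.
  have [->|_] := eqVneq j i.
    by rewrite ltnn addr0 mulr1 (le_trans (tP i).1)// coord_le_norm.
  by rewrite mulr0 add0r; case: ifPn => _; rewrite ?normr0// coord_le_norm.
transitivity (\sum_(i < n) (f (x + hp i.+1) - f (x + hp i))).
  rewrite -(big_mkord xpredT (fun i => f (x + hp i.+1) - f (x + hp i))).
  rewrite telescope_sumr//; congr (f (x + _) - f _).
    by apply/rowP => i; rewrite !mxE ltn_ord.
  by apply/rowP => i; rewrite !mxE addr0.
by apply: eq_bigr => i _; rewrite (tP i).2.
Qed.

(** [C1] speaks of partial derivatives only. Their continuity, used at the intermediate points of
    [MVT_rV], upgrades them to a total derivative, which the chain rule along curves needs. *)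
Lemma C1_littleo (f : 'rV[R]_n -> R) x (e : R) : C1 f -> 0 < e ->
  \forall h \near (0 : 'rV[R]_n),
    `|f (x + h) - f x - \sum_i h ord0 i * pderive i f x| <= e * `|h|.
Proof.
move=> Cf e0.
(* The n terms share e; dividing by n + 1 stays meaningful for n = 0. *)
have d0 : 0 < e / n.+1%:R by rewrite divr_gt0.
have : \forall y \near x, forall i, `|pderive i f x - pderive i f y| <= e / n.+1%:R.
  apply: (@filter_forall _ _ _ (nbhs x)) => i; have [_ /(_ x) ci] := Cf i.
  exact: (@cvgr_dist_le _ _ _ (nbhs x) _ _ _ ci).
move=> /nbhs_ballP[r /= r0 xr].
have nr := rV_nbhs0_lt r0.
near=> h.
have hr : `|h| < r by near: h.
have [xi [xih ->]] := @MVT_rV f x h (fun i => (Cf i).1).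
rewrite -sumrB (le_trans (ler_norm_sum _ _ _))//.
apply: (@le_trans _ _ (\sum_(i < n) (`|h| * (e / n.+1%:R)))).
  apply: ler_sum => i _; rewrite -mulrBr normrM ler_pM//; first exact: coord_le_norm.
  rewrite distrC; apply: xr; rewrite -ball_normE/= distrC; exact: le_lt_trans (xih i) _.
rewrite sumr_const card_ord -[_ *+ n]mulr_natr -mulrA mulrC.
rewrite ler_wpM2r// -mulrA ler_piMr ?(ltW e0)// mulrC ler_pdivrMr// mul1r ler_nat//.
Unshelve. all: by end_near. Qed.

Lemma C1_continuous (f : 'rV[R]_n -> R) : C1 f -> continuous f.
Proof.
move=> Cf x; apply/(@cvgrPdist_le _ _ _ (nbhs x)) => e e0.
pose S := \sum_i `|pderive i f x|.
have S0 : 0 <= S by apply: sumr_ge0.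
have H := C1_littleo x Cf ltr01.
have : \forall h \near (0 : 'rV[R]_n), `|f x - f (x + h)| <= e.
  near=> h.
  have Hh : `|f (x + h) - f x - \sum_i h ord0 i * pderive i f x| <= 1 * `|h| by near: h.
  have Sh : `|\sum_i h ord0 i * pderive i f x| <= `|h| * S.
    rewrite (le_trans (ler_norm_sum _ _ _))// mulr_sumr; apply: ler_sum => i _.
    by rewrite normrM ler_wpM2r// coord_le_norm.
  have he : `|h| <= e / (S + 1).
    apply: ltW; near: h; apply: rV_nbhs0_lt; rewrite divr_gt0// ltr_wpDl//.
  rewrite distrC -(subrK (\sum_i h ord0 i * pderive i f x) (f (x + h) - f x)).
  rewrite (le_trans (ler_normD _ _))// (le_trans (lerD Hh Sh))//.
  by rewrite mul1r addrC -{2}[`|h|]mulr1 -mulrDr -ler_pdivlMr// ltr_wpDl.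
move=> /nbhs_ballP[r /= r0 hr]; apply/nbhs_ballP; exists r => //= y.
rewrite -ball_normE/= => xy.
have := hr (y - x); rewrite /= [x + _]addrC subrK; apply.
by rewrite -ball_normE/= sub0r normrN distrC.
Unshelve. all: by end_near. Qed.

End mean_value.

(** * Integrals depending on a parameter *)

Section parametric_integral.
Context {R : realType} d (Y : measurableType d) (mu : {measure set Y -> \bar R}) {n : nat}.
Variables (B : set Y) (a : Y -> R) (p : Y -> 'rV[R]_n).
Hypotheses (mB : measurable B) (ia : mu.-integrable B (EFin \o a)).
Hypothesis (mp : measurable_fun setT p).

Definition bounded_derivatives (f : 'rV[R]_n -> R) :=
  forall s, exists2 C, 0 <= C & forall x, `|pderives s f x| <= C.

Lemma bounded_derivatives_pderive f i : bounded_derivatives f ->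
  bounded_derivatives (pderive i f).
Proof. by move=> bf s; have [C C0 H] := bf (rcons s i); exists C => //; rewrite -pderives_rcons. Qed.

(** The average over the domain, the truncated time integral and the vertical primitive are all of
    this form, so smoothness and differentiation under the integral are proved once. *)
Definition param_integral (f : 'rV[R]_n -> R) : 'rV[R]_n -> R :=
  fun x => \int[mu]_(y in B) (a y * f (x + p y)).

Lemma measurable_shift_comp (f : 'rV[R]_n -> R) x : continuous f ->
  measurable_fun B (fun y => f (x + p y)).
Proof.
move=> cf; apply: measurable_funTS.
apply: (@measurableT_comp _ _ _ _ _ _ (fun z => f (x + z))) => //.
apply: continuous_measurable_rV => z.
rewrite (_ : (fun _ => _) = f \o (fun z => z + x)); last first.
  by apply/funext => t /=; rewrite addrC.
by apply: continuous_comp; [exact: addr_right_continuous|exact: cf].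
Qed.

Lemma integrable_param (f : 'rV[R]_n -> R) x : continuous f ->
  (exists C, forall x, `|f x| <= C) ->
  mu.-integrable B (fun y => (a y * f (x + p y))%:E).
Proof.
move=> cf [C fC].
have := integrableMl mB ia (measurable_shift_comp x cf); apply.
exists C; split; first exact: num_real.
by move=> M CM y _ /=; rewrite (le_trans (fC _))// ltW.
Qed.

Lemma bounded_derivatives0 f : bounded_derivatives f -> exists C, forall x, `|f x| <= C.
Proof. by move=> /(_ [::])[C _ fC]; exists C. Qed.

Lemma param_integral_continuous f : smooth f -> bounded_derivatives f ->
  continuous (param_integral f).
Proof.
move=> sf bf x.
have /choice[C CP] : forall i : 'I_n, exists C, 0 <= C /\ forall x, `|pderive i f x| <= C.
  by move=> i; have [C C0 fC] := bf [:: i]; exists C.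
pose S := \sum_i C i; have S0 : 0 <= S by apply: sumr_ge0 => i _; exact: (CP i).1.
have lip u h : `|f (u + h) - f u| <= `|h| * S.
  have [xi [_ ->]] := MVT_rV u h (fun i x => smooth_derivable sf).
  rewrite (le_trans (ler_norm_sum _ _ _))// mulr_sumr; apply: ler_sum => i _.
  by rewrite normrM ler_pM ?coord_le_norm//; exact: (CP i).2.
pose A := \int[mu]_(y in B) `|a y|.
have A0 : 0 <= A by apply: Rintegral_ge0.
have inta : mu.-integrable B (EFin \o (fun y => `|a y|)) := integrable_norm ia.
have plip x' : `|param_integral f x - param_integral f x'| <= `|x - x'| * S * A.
  have If z := integrable_param z (smooth_continuous sf) (bounded_derivatives0 bf).
  rewrite /param_integral -RintegralB//; last 2 first.
    exact: (If x).
    exact: (If x').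
  rewrite (le_trans (le_normr_Rintegral _ _))//; first by have := integrableB mB (If x) (If x').
  rewrite /A -RintegralZl//; apply: le_Rintegral => //.
  - by have := integrable_norm (integrableB mB (If x) (If x')).
  - by have := integrableZl mB (`|x - x'| * S) inta.
  move=> y By; rewrite -mulrBr normrM mulrC ler_wpM2r//.
  have -> : x + p y = x' + p y + (x - x').
    by rewrite [x - x']addrC addrACA subrr add0r [p y + x]addrC.
  exact: lip.
apply/(@cvgrPdist_le _ _ _ (nbhs x)) => e e0.
have SA0 : 0 < S * A + 1 by rewrite ltr_wpDl// mulr_ge0.
apply/nbhs_ballP; exists (e / (S * A + 1)); first by rewrite /= divr_gt0.
move=> x'; rewrite -ball_normE/= ltr_pdivlMr// => xx'.
rewrite (le_trans (plip x'))// -mulrA (le_trans _ (ltW xx'))//.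
by rewrite ler_wpM2l// lerDl.
Qed.

Lemma param_integral_is_derive f i x : smooth f -> bounded_derivatives f ->
  is_derive x (delta_mx ord0 i) (param_integral f) (param_integral (pderive i f) x).
Proof.
move=> sf bf; have [C C0 fC] := bf [:: i].
pose F (h : R) y := a y * f (h *: delta_mx ord0 i + x + p y).
have dF y h : is_derive h (1 : R) (F ^~ y) (a y * pderive i f (h *: delta_mx ord0 i + x + p y)).
  have := @continuous_line R n f i (x + p y) (fun z => smooth_derivable sf) h.
  have -> : (fun t => f (t *: delta_mx ord0 i + (x + p y))) =
            (fun t => f (t *: delta_mx ord0 i + x + p y)).
    by apply/funext => t; rewrite addrA.
  rewrite addrA => df; have := is_deriveM (is_derive_cst (a y) h (1 : R)) df.
  by move/is_derive_eq; apply; rewrite scaler0 addr0.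
(* The parameter is the displacement h along e_i, in (-1, 1) around 0; the dominating function is C
   |a|. *)
have := @cvg_differentiation_under_integral R _ Y mu F B mB 0 (-1) 1.
set G := fun y => C * `|a y|.
have If z := integrable_param z (smooth_continuous sf) (bounded_derivatives0 bf).
move=> /(_ _ _ _ G); rewrite /= in_itv/= ltrN10 ltr01/= => /(_ isT).
have -> : (fun h : R => h^-1 *:
    (\int[mu]_(y in B) F (h + 0) y - \int[mu]_(y in B) F 0 y)) =
  (fun h : R => h^-1 *: (param_integral f (h *: delta_mx ord0 i + x) - param_integral f x)).
  by apply/funext => h; rewrite /F addr0 scale0r add0r.
have -> : \int[mu]_(y in B) partial1of2 F 0 y = param_integral (pderive i f) x.
  apply: eq_Rintegral => y _; rewrite partial1of2E.
  by rewrite (@derive_val _ _ _ _ _ _ _ (dF y 0)) scale0r add0r.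
move=> H.
suff H' : h^-1 *: (param_integral f (h *: delta_mx ord0 i + x) - param_integral f x)
    @[h --> 0^'] --> param_integral (pderive i f) x.
  by split; [apply/cvg_ex; eexists; exact: H'|exact: cvg_lim].
apply: H.
- by move=> h _; exact: If.
- by move=> h y _ _; case: (dF y h).
- by move=> y; rewrite mulr_ge0.
- by have := integrableZl mB C (integrable_norm ia).
- move=> h y _ _; rewrite partial1of2E (@derive_val _ _ _ _ _ _ _ (dF y h)).
  by rewrite normrM mulrC; apply: ler_wpM2r => //; exact: fC.
Qed.

Lemma param_integral_smooth f : smooth f -> bounded_derivatives f ->
  smooth (param_integral f).
Proof.
move=> sf bf; apply/smoothP => m; elim: m f sf bf => [|m ih] f sf bf; split=> //.
- exact: param_integral_continuous.
- exact: param_integral_continuous.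
move=> i; exists (param_integral (pderive i f)).
  by move=> x; exact: param_integral_is_derive.
by apply: ih; [exact: smooth_pderive|exact: bounded_derivatives_pderive].
Qed.

Lemma pderive_param_integral f i : smooth f -> bounded_derivatives f ->
  pderive i (param_integral f) = param_integral (pderive i f).
Proof.
by move=> sf bf; apply/is_derive_pderive => x; exact: param_integral_is_derive.
Qed.

End parametric_integral.

Lemma test_function_bounded_derivatives (R : realType) n (f : 'rV[R]_n -> R) :
  test_function f -> bounded_derivatives f.
Proof. by move=> tf s; exact: test_function_bounded. Qed.

Section transfer.
Context d1 d2 (X : measurableType d1) (Y : measurableType d2) (R : realType).
Variables (phi : X -> Y) (mu : {measure set X -> \bar R}) (nu : {measure set Y -> \bar R}).
Hypothesis mphi : measurable_fun setT phi.
Hypothesis numu : forall A, measurable A -> nu A = mu (phi @^-1` A).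

Lemma ge0_integral_transfer (f : Y -> \bar R) :
  measurable_fun setT f -> (forall y, 0 <= f y)%E ->
  (\int[nu]_y f y = \int[mu]_x f (phi x))%E.
Proof.
move=> mf f0; rewrite (eq_measure_integral (pushforward mu phi)); last first.
  by move=> A mA _ /=; rewrite numu.
by rewrite ge0_integral_pushforward.
Qed.

Lemma integrable_transfer (f : Y -> \bar R) :
  nu.-integrable setT f -> mu.-integrable setT (f \o phi).
Proof.
move=> /integrableP[mf foo]; apply/integrableP; split.
  exact: measurableT_comp.
rewrite -(@ge0_integral_transfer (fun y => `|f y|%E))//.
exact: measurableT_comp.
Qed.

Lemma integral_transfer (f : Y -> \bar R) : measurable_fun setT f ->
  (\int[nu]_y f y = \int[mu]_x f (phi x))%E.
Proof.
move=> mf; rewrite integralE [RHS]integralE.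
rewrite (ge0_integral_transfer (measurable_funepos mf) (funepos_ge0 f)).
rewrite (ge0_integral_transfer (measurable_funeneg mf) (funeneg_ge0 f)).
have p : (fun x => f (phi x))^\+%E = f^\+%E \o phi := funepos_comp f phi.
have m : (fun x => f (phi x))^\-%E = f^\-%E \o phi := funeneg_comp f phi.
by rewrite p m.
Qed.

End transfer.

(** * Fubini's theorem along an arbitrary coordinate *)

Section insertion.
Context {R : realType} {n : nat}.

(** [lebesgue_rV] peels off coordinate 0 only, while a boundary chart has an arbitrary vertical axis
    j. With t = gamma y this row is [graph_point j gamma y] by computation. *)
Definition rV_ins (j : 'I_n.+1) (t : R) (y : 'rV[R]_n) : 'rV[R]_n.+1 :=
  \row_k (if unlift j k is Some k' then y ord0 k' else t).

Lemma rV_ins_at j t y : rV_ins j t y ord0 j = t.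
Proof. by rewrite mxE unlift_none. Qed.

Lemma rV_ins_lift j t y k : rV_ins j t y ord0 (lift j k) = y ord0 k.
Proof. by rewrite mxE liftK. Qed.

Lemma rV_insK j t y : col' j (rV_ins j t y) = y.
Proof. by apply/rowP => k; rewrite !mxE liftK. Qed.

Lemma rV_cons_ins p : rV_cons p = rV_ins ord0 p.1 p.2.
Proof.
apply/rowP => k; rewrite [RHS]mxE; case: (unliftP ord0 k) => [k' ->|->].
  rewrite -[RHS](@row_mxEr _ _ 1 n ((p.1 : R)%:M) p.2 ord0 k').
  by congr (fun_of_matrix _ _ _); exact/val_inj.
transitivity ((row_mx ((p.1 : R)%:M : 'rV[R]_1) p.2) ord0 (lshift n ord0)).
  by congr (fun_of_matrix _ _ _); exact/val_inj.
by rewrite row_mxEl mxE eqxx mulr1n.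
Qed.

Lemma measurable_rV_ins j :
  measurable_fun setT (fun p : measurableTypeR R * 'rV[R]_n => rV_ins j p.1 p.2).
Proof.
apply: measurable_fun_rVP => k; case: (unliftP j k) => [k' ->|->].
  under eq_fun do rewrite rV_ins_lift.
  by apply: (measurableT_comp (measurable_rV_coord k')); exact: measurable_snd.
by under eq_fun do rewrite rV_ins_at; exact: measurable_fst.
Qed.

End insertion.

Lemma rV_cons_rV_ins (R : realType) n (j : 'I_n.+1) (t u : R) (y : 'rV[R]_n) :
  rV_ins ord0 t (rV_ins j u y) = rV_ins (lift ord0 j) u (rV_ins ord0 t y).
Proof.
apply/rowP => k; rewrite [LHS]mxE.
case: (unliftP ord0 k) => [k' ->|->].
  rewrite [LHS]mxE; case: (unliftP j k') => [k'' ->|->].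
    have -> : lift ord0 (lift j k'') = lift (lift ord0 j) (lift ord0 k'').
      by apply/val_inj; rewrite /= /bump !leq0n !add1n ltnS addnS.
    by rewrite !rV_ins_lift.
  by rewrite rV_ins_at.
have -> : ord0 = lift (lift ord0 j) ord0 by exact/val_inj.
by rewrite rV_ins_lift rV_ins_at.
Qed.

Section fubini_rV.
Context {R : realType}.
Local Notation leb := (@lebesgue_measure R).
Local Notation lam := (lebesgue_rV R).

Lemma lebesgue_rVS n (A : set 'rV[R]_n.+1) : measurable A ->
  lam n.+1 A = (leb \x lam n)%E ((@rV_cons R n) @^-1` A).
Proof. by []. Qed.

Lemma ge0_integral_rV_cons n (f : 'rV[R]_n.+1 -> \bar R) :
  measurable_fun setT f -> (forall x, 0 <= f x)%E ->
  (\int[lam n.+1]_x f x = \int[lam n]_y \int[leb]_t f (rV_ins ord0 t y))%E.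
Proof.
move=> mf f0.
rewrite (@ge0_integral_transfer _ _ _ _ R (@rV_cons R n) (leb \x lam n)%E (lam n.+1))//; last first.
  exact: measurable_rV_cons.
under eq_integral do rewrite rV_cons_ins.
rewrite (fubini_tonelli2 (fun p : measurableTypeR R * _ => f (rV_ins ord0 p.1 p.2)))//.
by apply: measurableT_comp => //; exact: measurable_rV_ins.
Qed.

(** Coordinate 0 is peeled off, the induction hypothesis slices the remaining variables, and
    Tonelli's theorem exchanges the two integrations. *)
Lemma ge0_integral_rV_ins n (j : 'I_n.+1) (f : 'rV[R]_n.+1 -> \bar R) :
  measurable_fun setT f -> (forall x, 0 <= f x)%E ->
  (\int[lam n.+1]_x f x = \int[lam n]_y \int[leb]_t f (rV_ins j t y))%E.
Proof.
elim: n j f => [|n ih] j f mf f0.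
  by rewrite (ord1 j); exact: ge0_integral_rV_cons.
case: (unliftP ord0 j) => [j' ->|->]; last exact: ge0_integral_rV_cons.
pose F (p : measurableTypeR R * 'rV[R]_n.+1) := f (rV_ins ord0 p.1 p.2).
have mF : measurable_fun setT F.
  by apply: measurableT_comp => //; exact: measurable_rV_ins.
have F0 p : (0 <= F p)%E by exact: f0.
pose G (y : 'rV[R]_n.+1) := (\int[leb]_u f (rV_ins (lift ord0 j') u y))%E.
have mG : measurable_fun setT G.
  apply: (@measurable_fun_fubini_tonelli_G _ _ _ _ _ leb
    (fun p : measurableTypeR R * _ => f (rV_ins (lift ord0 j') p.1 p.2))) => //.
  by apply: measurableT_comp => //; exact: measurable_rV_ins.
rewrite (ge0_integral_rV_cons mf f0).
transitivity (\int[leb]_t \int[lam n.+1]_y F (t, y))%E.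
  exact: esym (fubini_tonelli F mF F0).
transitivity (\int[leb]_t \int[lam n]_y \int[leb]_u F (t, rV_ins j' u y))%E.
  apply: eq_integral => t _; apply: ih => //.
  by apply: measurableT_comp => //; exact: pair1_measurable.
have G0 y : (0 <= G y)%E by exact: integral_ge0.
pose H (p : measurableTypeR R * 'rV[R]_n) := G (rV_ins ord0 p.1 p.2).
have mH : measurable_fun setT H by exact: measurableT_comp mG (measurable_rV_ins ord0).
rewrite -/(G _) (ge0_integral_rV_cons mG G0).
transitivity (\int[leb]_t \int[lam n]_y H (t, y))%E; last first.
  exact: (fubini_tonelli H mH (fun p => G0 _)).
apply: eq_integral => t _; apply: eq_integral => y _; apply: eq_integral => u _.
by rewrite /F/= rV_cons_rV_ins.
Qed.

(** Stated for sets, this exhibits Lebesgue measure as the image of a product measure, so that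
    integrals of functions of both signs follow by transfer. *)
Lemma lebesgue_rV_insE n (j : 'I_n.+1) (A : set 'rV[R]_n.+1) : measurable A ->
  lam n.+1 A = (leb \x lam n)%E
    ((fun p : measurableTypeR R * 'rV[R]_n => rV_ins j p.1 p.2) @^-1` A).
Proof.
move=> mA; set phi := (fun p => _).
have mpA : measurable (phi @^-1` A).
  by rewrite -[X in measurable X]setTI; exact: measurable_rV_ins.
have mi : measurable_fun setT (fun x => (\1_A x)%:E : \bar R).
  by apply/measurable_EFinP; exact: measurable_indic.
have mpi : measurable_fun setT (fun x => (\1_(phi @^-1` A) x)%:E : \bar R).
  by apply/measurable_EFinP; exact: measurable_indic.
have -> : lam _ A = (\int[lam _]_x (\1_A x)%:E)%E by rewrite integral_indic// setIT.
rewrite (@ge0_integral_rV_ins _ j _ mi); last by move=> x; rewrite lee_fin.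
rewrite -[in RHS](setIT (phi @^-1` A)) -integral_indic// (fubini_tonelli2 _ mpi)//.
Qed.

Lemma integral_rV_ins n (j : 'I_n.+1) (f : 'rV[R]_n.+1 -> \bar R) :
  (lam n.+1).-integrable setT f ->
  (\int[lam n.+1]_x f x = \int[lam n]_y \int[leb]_t f (rV_ins j t y))%E.
Proof.
move=> fi.
rewrite (integral_transfer (@measurable_rV_ins R n j) (@lebesgue_rV_insE n j)); last first.
  exact: measurable_int fi.
have := integrable_transfer (@measurable_rV_ins R n j) (@lebesgue_rV_insE n j) fi.
by move=> /integral21_prod_meas1 <-.
Qed.

Lemma measurable_row_mx m n :
  measurable_fun setT (fun p : 'rV[R]_m * 'rV[R]_n => row_mx p.1 p.2).
Proof.
apply: measurable_fun_rVP => i; case: (split_ordP i) => j ->.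
  under eq_fun do rewrite row_mxEl.
  by apply: (measurableT_comp (measurable_rV_coord j)); exact: measurable_fst.
under eq_fun do rewrite row_mxEr.
by apply: (measurableT_comp (measurable_rV_coord j)); exact: measurable_snd.
Qed.

Lemma row_mx_rV_ins0 m n t (x : 'rV[R]_m) (y : 'rV[R]_n) :
  row_mx (rV_ins ord0 t x) y = rV_ins ord0 t (row_mx x y) :> 'rV[R]_(m.+1 + n).
Proof.
apply/rowP => k; case: (split_ordP k) => i ->; rewrite ?row_mxEl ?row_mxEr.
  case: (unliftP ord0 i) => [i' ->|->].
    rewrite rV_ins_lift.
    have -> : lshift n (lift ord0 i') = lift ord0 (lshift n i') by exact/val_inj.
    by rewrite rV_ins_lift row_mxEl.
  rewrite rV_ins_at; have -> : lshift n (ord0 : 'I_m.+1) = ord0 by exact/val_inj.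
  by rewrite rV_ins_at.
have -> : rshift m.+1 i = lift ord0 (rshift m i) by exact/val_inj.
by rewrite rV_ins_lift row_mxEr.
Qed.

Lemma ge0_integral_row_mx m n (f : 'rV[R]_(m + n) -> \bar R) :
  measurable_fun setT f -> (forall x, 0 <= f x)%E ->
  (\int[lam (m + n)]_x f x = \int[lam m]_x \int[lam n]_y f (row_mx x y))%E.
Proof.
have mfF p q (g : 'rV[R]_(p + q) -> \bar R) : measurable_fun setT g ->
    (forall x, 0 <= g x)%E ->
    measurable_fun setT (fun x => \int[lam q]_y g (row_mx x y))%E.
  move=> mg g0; apply: (@measurable_fun_fubini_tonelli_F _ _ _ _ _ (lam q)
    (fun p : 'rV[R]_p * 'rV[R]_q => g (row_mx p.1 p.2))) => //.
  by apply: measurableT_comp => //; exact: measurable_row_mx.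
elim: m f => [|m ih] f mf f0.
  (* Lebesgue measure on R^0 is the Dirac mass, so the outer integral is an evaluation. *)
  rewrite [RHS]/= integral_dirac//; last exact: (mfF 0%N n).
  rewrite diracT mul1e; apply: eq_integral => y _; congr f.
  apply/rowP => i; have := row_mxEr (0 : 'rV[R]_0) y ord0 i.
  by have -> : rshift 0 i = i by exact/val_inj.
rewrite (ge0_integral_rV_cons mf f0).
have mi k : measurable_fun setT (fun p : measurableTypeR R * 'rV[R]_k => rV_ins ord0 p.1 p.2).
  exact: measurable_rV_ins.
pose F (p : measurableTypeR R * 'rV[R]_(m + n)) := f (rV_ins ord0 p.1 p.2).
have mF : measurable_fun setT F by exact: measurableT_comp mf (mi (m + n)%N).
transitivity (\int[leb]_t \int[lam (m + n)]_y F (t, y))%E.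
  exact: esym (fubini_tonelli F mF (fun p => f0 _)).
have mG := mfF _ _ _ mf f0.
pose G x := (\int[lam n]_y f (row_mx x y))%E.
have G0 x : (0 <= G x)%E by exact: integral_ge0.
rewrite (ge0_integral_rV_cons mG G0).
pose H (p : measurableTypeR R * 'rV[R]_m) := G (rV_ins ord0 p.1 p.2).
have mH : measurable_fun setT H by exact: measurableT_comp mG (mi m).
transitivity (\int[leb]_t \int[lam m]_y H (t, y))%E; last first.
  exact: (fubini_tonelli H mH (fun p => G0 _)).
apply: eq_integral => t _.
have mFt : measurable_fun setT (fun y => F (t, y)).
  by apply: (measurableT_comp mF); exact: pair1_measurable.
rewrite (ih _ mFt (fun y => f0 _)).
by apply: eq_integral => x _; apply: eq_integral => y _; rewrite /F/= row_mx_rV_ins0.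
Qed.

Lemma lebesgue_rV_row_mxE m n (A : set 'rV[R]_(m + n)) : measurable A ->
  lam (m + n) A = (lam m \x lam n)%E
    ((fun p : 'rV[R]_m * 'rV[R]_n => row_mx p.1 p.2) @^-1` A).
Proof.
move=> mA; set phi := (fun p => _).
have mpA : measurable (phi @^-1` A).
  by rewrite -[X in measurable X]setTI; exact: measurable_row_mx.
have mi : measurable_fun setT (fun x => (\1_A x)%:E : \bar R).
  by apply/measurable_EFinP; exact: measurable_indic.
have mpi : measurable_fun setT (fun x => (\1_(phi @^-1` A) x)%:E : \bar R).
  by apply/measurable_EFinP; exact: measurable_indic.
have -> : lam _ A = (\int[lam _]_x (\1_A x)%:E)%E by rewrite integral_indic// setIT.
rewrite (@ge0_integral_row_mx m n _ mi); last by move=> x; rewrite lee_fin.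
rewrite -[in RHS](setIT (phi @^-1` A)) -integral_indic// (fubini_tonelli1 _ mpi)//.
Qed.

Lemma integrable_row_mx m n (f : 'rV[R]_(m + n) -> \bar R) :
  (lam (m + n)).-integrable setT f ->
  (lam m \x lam n)%E.-integrable setT (fun p => f (row_mx p.1 p.2)).
Proof. exact: (integrable_transfer (@measurable_row_mx m n) (@lebesgue_rV_row_mxE m n)). Qed.

Lemma integral_row_mx m n (f : 'rV[R]_(m + n) -> \bar R) :
  (lam (m + n)).-integrable setT f ->
  (\int[lam (m + n)]_x f x = \int[lam n]_y \int[lam m]_x f (row_mx x y))%E.
Proof.
move=> fi.
rewrite (integral_transfer (@measurable_row_mx m n) (@lebesgue_rV_row_mxE m n)); last first.
  exact: measurable_int fi.
by have /integral21_prod_meas1 <- := integrable_row_mx fi.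
Qed.

Lemma lebesgue_rV_norm_le n (M : R) : (lam n [set x | `|x| <= M]%R < +oo)%E.
Proof.
elim: n => [|n ih].
  rewrite /= diracE; case: (_ \in _) => /=; exact: ltry.
have mK k : measurable [set x : 'rV[R]_k | `|x| <= M].
  by apply: compact_measurable_rV; exact: norm_le_compact.
rewrite lebesgue_rVS//.
apply: (@le_lt_trans _ _ ((leb \x lam n)%E (`[- M, M]%classic `*` [set x | `|x| <= M]%R))).
  apply: le_measure; rewrite ?inE.
  - by rewrite -[X in measurable X]setTI; apply: measurable_rV_cons => //; exact: mK.
  - by apply: measurableX; [exact: measurable_itv|exact: mK].
  - move=> [t y] /= tyM; split=> /=.
      rewrite in_itv/= -ler_norml (le_trans _ tyM)//.
      by rewrite -[X in `|X|](rV_ins_at ord0 t y) -(rV_cons_ins (t, y)) coord_le_norm.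
    apply: rV_norm_le => [|i]; first exact: le_trans tyM.
    rewrite (le_trans _ tyM)// -(rV_ins_lift ord0 t y) -(rV_cons_ins (t, y)).
    exact: coord_le_norm.
rewrite product_measure1E//; last by [exact: mK|exact: measurable_itv].
rewrite lte_mul_pinfty// ge0_fin_numE//; apply: compact_finite_measure; exact: segment_compact.
Qed.

End fubini_rV.

Lemma bounded_support_integrable d (T : measurableType d) (R : realType)
    (mu : {measure set T -> \bar R}) (K : set T) (f : T -> R) (C : R) :
  measurable K -> (mu K < +oo)%E -> measurable_fun setT f ->
  (forall x, `|f x| <= C) -> (forall x, ~ K x -> f x = 0) ->
  mu.-integrable setT (EFin \o f).
Proof.
move=> mK Koo mf fC fK.
have -> : EFin \o f = (EFin \o f) \_ K.
  apply/funext => x; rewrite patchE; case: ifPn => //.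
  by move/negP; rewrite inE => /fK /= ->.
apply/(integrable_mkcond _ mK).1/measurable_bounded_integrable => //.
  exact: measurable_funTS.
exists C; split; first exact: num_real.
by move=> M CM x _ /=; rewrite (le_trans (fC _))// ltW.
Qed.

Lemma bounded_support_integrable_rV (R : realType) n (f : 'rV[R]_n -> R) (C M : R) :
  measurable_fun setT f -> (forall x, `|f x| <= C) -> (forall x, M < `|x| -> f x = 0) ->
  (lebesgue_rV R n).-integrable setT (EFin \o f).
Proof.
move=> mf fC fM; apply: (@bounded_support_integrable _ _ _ _ [set x : 'rV[R]_n | `|x| <= M] f C) => //.
- by apply: compact_measurable_rV; exact: norm_le_compact.
- exact: lebesgue_rV_norm_le.
- by move=> x /= /negP; rewrite -ltNge; exact: fM.
Qed.

(** * Integrals on the line *)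

Section one_dimensional.
Context {R : realType}.
Local Notation leb := (@lebesgue_measure R).

(** This disposes of the value 1/2 of the characteristic function at a boundary point and of the
    Heaviside function at 0. *)
Lemma Rintegral_eq_except (f g : R -> R) r : measurable_fun setT g ->
  (forall t, t != r -> f t = g t) -> \int[leb]_t f t = \int[leb]_t g t.
Proof.
move=> mg fg; have mD : measurable ([set: R] `\ r) by exact: measurableD.
have mEg : measurable_fun ([set: R] `\ r) (EFin \o g).
  by apply: measurable_funTS; exact/measurable_EFinP.
have fgD : {in [set: R] `\ r, EFin \o f =1 EFin \o g}.
  by move=> t; rewrite inE => -[_ /eqP tr] /=; rewrite fg.
rewrite /Rintegral; congr fine; rewrite -[LHS](@integral_setD1 _ _ r)//; last first.
  by apply: (eq_measurable_fun _ _ mEg) => t tD; exact/esym/fgD.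
by rewrite -[RHS](@integral_setD1 _ _ r)//; exact: eq_integral.
Qed.

Lemma FTC2 (g g' : R -> R) a b : a <= b ->
  (forall t, is_derive t (1 : R) g (g' t)) -> continuous g' ->
  \int[leb]_(t in `[a, b]) g' t = g b - g a.
Proof.
rewrite le_eqVlt => /predU1P[-> _ _|ab dg cg].
  by rewrite set_itv1 Rintegral_set1 subrr.
have cgg : continuous g.
  move=> t; apply: differentiable_continuous; apply/derivable1_diffP.
  by case: (dg t).
rewrite /Rintegral (@continuous_FTC2 _ _ g)//.
- exact: continuous_subspaceT.
- split; first by move=> x _; case: (dg x).
  + exact/cvg_at_right_filter/cgg.
  + exact/cvg_at_left_filter/cgg.
- by move=> x _; rewrite derive1E derive_val.
Qed.

Lemma integral_derive_compact_support (g g' : R -> R) M :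
  (forall t, is_derive t (1 : R) g (g' t)) -> continuous g' ->
  (forall t, M < `|t| -> g t = 0) -> \int[leb]_t g' t = 0.
Proof.
move=> dg cg gM; pose L := `|M| + 1.
have ML t : t \notin `[- L, L] -> M < `|t|.
  rewrite in_itv/= -ler_norml -ltNge; apply: le_lt_trans.
  by rewrite (le_trans (ler_norm _))// lerDl.
have -> : \int[leb]_t g' t = \int[leb]_(t in `[- L, L]) g' t.
  rewrite [RHS]Rintegral_mkcond; apply: eq_Rintegral => t _.
  rewrite patchE; case: ifPn => //; rewrite notin_setE/= => /negP/ML Mt.
  have [_ <-] := dg t; rewrite (@near_eq_derive _ _ _ _ (cst 0)); first exact: derive_cst.
  have : \forall s \near t, M < `|s|.
    exact: (@cvgr_gt _ _ (nbhs t) _ (fun s : R => `|s|) _ (@norm_continuous _ R t)).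
  by apply: filterS => s; exact: gM.
have L0 : 0 < L by rewrite ltr_wpDl.
have ML' t : `|t| = L -> g t = 0.
  by move=> tL; apply: gM; rewrite tL (le_lt_trans (ler_norm _))// ltrDl.
rewrite (@FTC2 g)//; last by rewrite (le_trans (_ : - L <= 0))// ?oppr_le0 ltW.
by rewrite !ML' ?subrr// ?normrN ger0_norm ?ltW.
Qed.

Lemma Rintegral_affine (h : R -> R) (u s L : R) : s = 1 \/ s = -1 -> 0 <= L ->
  continuous h ->
  \int[leb]_(t in `[Num.min u (u + s * L), Num.max u (u + s * L)]) h t =
  \int[leb]_(r in `[0, L]) h (u + s * r).
Proof.
move=> s1 L0 ch; pose F r : R := u + s * r.
have dF r : is_derive r (1 : R) F s.
  have d0 := is_deriveM (is_derive_cst s r (1 : R)) (is_derive_id r (1 : R)).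
  have dF' : is_derive r (1 : R) F _ := is_deriveD (is_derive_cst u r (1 : R)) d0.
  by apply: (is_derive_eq dF'); rewrite add0r scaler0 addr0 [_ *: _]mulr1.
have F' : F^`()%classic = cst s.
  by apply/funext => r; rewrite derive1E derive_val.
have cF : continuous F.
  move=> t; apply: differentiable_continuous; apply/derivable1_diffP.
  by case: (dF t).
have FL : derivable_oo_LRcontinuous F 0 L.
  split; first by move=> x _; case: (dF x).
  - exact/cvg_at_right_filter/cF.
  - exact/cvg_at_left_filter/cF.
have F0 : F 0 = u by rewrite /F mulr0 addr0.
rewrite /Rintegral; congr fine; case: s1 => s1.
  rewrite min_l ?max_r ?lerDl ?s1 ?mul1r//.
  have := @integration_by_substitution_increasing R F h 0 L L0.
  rewrite F0 /F F' s1 mul1r => -> //.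
  - by apply: eq_integral => r _ /=; rewrite !fctE mulr1.
  - by move=> x y _ _ xy; rewrite ltrD2l !mul1r.
  - by move=> x _; exact: cst_continuous.
  - exact: is_cvg_cst.
  - exact: is_cvg_cst.
  - by move: FL; rewrite /F s1.
  - exact: continuous_subspaceT.
rewrite min_r ?max_l ?gerDl ?s1 ?mulN1r ?oppr_le0//.
have := @integration_by_substitution_decreasing R F h 0 L L0.
rewrite F0 /F F' s1 mulN1r => -> //.
- by apply: eq_integral => r _ /=; rewrite !fctE opprK mulr1.
- by move=> x y _ _ xy; rewrite ltrD2l !mulN1r ltrN2.
- by move=> x _; exact: cst_continuous.
- exact: is_cvg_cst.
- exact: is_cvg_cst.
- by move: FL; rewrite /F s1.
- exact: continuous_subspaceT.
Qed.

(** Common form of a vertical slice through the domain and of the Heaviside factor. The value at u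
    is free, and L > M + |u| means that the segment starting at u on the side s outruns the support
    of h. *)
Lemma Rintegral_half_line (h f : R -> R) (u s M L : R) : s = 1 \/ s = -1 ->
  continuous h -> (forall t, M < `|t| -> h t = 0) -> 0 <= M -> M + `|u| < L ->
  (forall t, t != u -> f t = if 0 < s * (t - u) then h t else 0) ->
  \int[leb]_t f t = \int[leb]_(r in `[0, L]) h (u + s * r).
Proof.
move=> s1 ch hM M0 ML fE.
have u0 : 0 <= `|u| by [].
have L0 : 0 <= L by rewrite (le_trans _ (ltW ML))// addr_ge0.
have mh : measurable_fun setT h by exact: continuous_measurable_fun.
rewrite -Rintegral_affine// [RHS]Rintegral_mkcond; set I := [set` _].
rewrite (@Rintegral_eq_except f (h \_ I) u)//.
  apply/(measurable_restrictT _ _).1; first exact: measurable_itv.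
  exact: measurable_funTS.
have /andP[uM uM'] : - `|u| <= u <= `|u| by rewrite -ler_norml.
move=> t tu; rewrite fE// patchE /I mem_setE.
case: s1 => ->; rewrite ?mul1r ?mulN1r ?opprB subr_gt0 in_itv/=.
  rewrite min_l ?max_r ?lerDl//.
  have [ut|tu'] := ltP u t.
    rewrite (ltW ut)/=; case: leP => // Lt; apply: hM.
    by rewrite ltr_normr; apply/orP; left; lra.
  by rewrite leNgt lt_neqAle tu tu'.
rewrite min_r ?max_l ?gerDl ?oppr_le0//.
have [ut|tu'] := ltP t u.
  rewrite (ltW ut) andbT; case: leP => // Lt; apply: hM.
  by rewrite ltr_normr; apply/orP; right; lra.
by rewrite [t <= u]leNgt lt_neqAle eq_sym tu tu' andbF.
Qed.

End one_dimensional.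

(** * Chain rule along a curve *)

Section curves.
Context {R : realType} {n : nat}.

Lemma C1_is_derive_curve (f : 'rV[R]_n -> R) (v : R -> 'rV[R]_n) (dv : 'I_n -> R) t :
  C1 f -> (forall i, is_derive t (1 : R) (fun h => v h ord0 i) (dv i)) ->
  is_derive t (1 : R) (fun h => f (v h)) (\sum_i dv i * pderive i f (v t)).
Proof.
move=> Cf dv_.
(* Once the difference quotients of v are within 1 of dv, the increment w satisfies |w| <= S |h|.
   Half of e then pays for the quotients (error at most d, weighted by B), the other half for the
   remainder of f. *)
pose S := \sum_i (`|dv i| + 1).
have S0 : 0 <= S by apply: sumr_ge0 => i _; rewrite addr_ge0.
have q i : (v (h + t) ord0 i - v t ord0 i) / h @[h --> 0^'] --> dv i.
  have [dvi <-] := dv_ i; apply: cvg_trans dvi; apply: near_eq_cvg; near=> h.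
  by rewrite [h *: 1]mulr1 [LHS]mulrC.
suff H : h^-1 *: (f (v (h *: 1 + t)) - f (v t)) @[h --> (0 : R)^'] -->
    \sum_i dv i * pderive i f (v t).
  by split; [apply/cvg_ex; eexists; exact: H|exact: cvg_lim].
apply/cvgrPdist_le => e e0.
pose B := \sum_i `|pderive i f (v t)|.
have B0 : 0 <= B by apply: sumr_ge0.
pose d := Num.min 1 (e / 2 / (B + 1)).
have d0 : 0 < d by rewrite lt_min ltr01/= !divr_gt0// ltr_wpDl.
have e'0 : 0 < e / 2 / (S + 1) by rewrite !divr_gt0// ltr_wpDl.
have [r /= r0 lof] : exists2 r, 0 < r & forall w : 'rV[R]_n, `|w| < r ->
    `|f (v t + w) - f (v t) - \sum_i w ord0 i * pderive i f (v t)| <= e / 2 / (S + 1) * `|w|.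
  have /nbhs_ballP[r r0 Hr] := C1_littleo (v t) Cf e'0.
  by exists r => // w wr; apply: Hr; rewrite -ball_normE/= sub0r normrN.
have nq : \forall h \near (0 : R)^', forall i, `|dv i - (v (h + t) ord0 i - v t ord0 i) / h| <= d.
  by apply: filter_forall => i; apply: cvgr_dist_le => //; exact: q.
have nr : \forall h \near (0 : R)^', `|h| < r / (S + 1).
  by apply: dnbhs0_lt; rewrite divr_gt0// ltr_wpDl.
near=> h.
have h0 : h != 0 by near: h; exact: nbhs_dnbhs_neq.
have hq i : `|dv i - (v (h + t) ord0 i - v t ord0 i) / h| <= d by move: i; near: h.
have hr : `|h| < r / (S + 1) by near: h.
pose w := v (h + t) - v t.
have wE : v (h + t) = v t + w by rewrite /w [RHS]addrC subrK.
have wi i : `|w ord0 i| <= (`|dv i| + 1) * `|h|.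
  rewrite -ler_pdivrMr ?normr_gt0// -normf_div -lerBlDl.
  rewrite (le_trans (lerB_dist _ _))// distrC !mxE (le_trans (hq i))//.
  by rewrite ge_min lexx.
have wS : `|w| <= S * `|h|.
  apply: rV_norm_le => [|i]; first by rewrite mulr_ge0.
  have S1 : 0 <= \sum_(j < n | j != i) (`|dv j| + 1).
    by apply: sumr_ge0 => j _; rewrite addr_ge0.
  by rewrite (le_trans (wi i))// ler_wpM2r// /S (bigD1 i)//= lerDl.
have wr : `|w| < r.
  rewrite (le_lt_trans wS)// (@le_lt_trans _ _ ((S + 1) * `|h|))//.
    by rewrite ler_wpM2r// lerDl.
  by rewrite mulrC -ltr_pdivlMr// ltr_wpDl.
rewrite [h *: 1]mulr1 wE; set Y := f (v t + w) - f (v t).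
pose W := \sum_i w ord0 i * pderive i f (v t).
have -> : \sum_i dv i * pderive i f (v t) - h^-1 *: Y =
   \sum_i (dv i - w ord0 i / h) * pderive i f (v t) - h^-1 * (Y - W).
  have -> : \sum_i (dv i - w ord0 i / h) * pderive i f (v t) =
      \sum_i dv i * pderive i f (v t) - h^-1 * W.
    by rewrite /W mulr_sumr -sumrB; apply: eq_bigr => i _; ring.
  by rewrite mulrBr opprB addrA subrK.
rewrite (le_trans (ler_normB _ _))// [leRHS](splitr e) lerD//.
  rewrite (le_trans (ler_norm_sum _ _ _))//.
  apply: (@le_trans _ _ (d * B)).
    rewrite /B mulr_sumr; apply: ler_sum => i _; rewrite normrM ler_wpM2r//.
    by have := hq i; rewrite /w !mxE.
  apply: (@le_trans _ _ (e / 2 / (B + 1) * (B + 1))).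
    by apply: ler_pM; rewrite ?(ltW d0)// ?lerDl// ge_min lexx orbT.
  by rewrite divfK// gt_eqF// ltr_wpDl.
rewrite normrM normfV mulrC ler_pdivrMr ?normr_gt0//.
rewrite (le_trans (lof _ wr))// (le_trans (ler_wpM2l (ltW e'0) wS))// mulrA ler_wpM2r//.
rewrite -[leRHS](@divfK _ (S + 1)) ?gt_eqF ?ltr_wpDl//.
by rewrite (ler_wpM2l (ltW e'0))// lerDl.
Unshelve. all: by end_near. Qed.

End curves.

(** * Integration against the image of a measure with density *)

Section integral_density.
Local Open Scope ereal_scope.
Context d1 d2 (X : measurableType d1) (Y : measurableType d2) (R : realType).
Variables (phi : X -> Y) (w : X -> R) (E : set Y).
Variables (mu : {measure set X -> \bar R}) (nu : {measure set Y -> \bar R}).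
Hypotheses (mphi : measurable_fun setT phi) (mw : measurable_fun setT w).
Hypotheses (w0 : forall x, (0 <= w x)%R) (mE : measurable E).
Hypothesis nuE : forall A, measurable A -> A `<=` E ->
  nu A = \int[mu]_(x in phi @^-1` A) (w x)%:E.

Let mpre A : measurable A -> measurable (phi @^-1` A).
Proof. by move=> mA; rewrite -[X in measurable X]setTI; exact: mphi. Qed.

Import HBNNSimple.

(** The formula for nu is assumed on subsets of E only, so each level set is intersected with E
    before it is used. *)
Let sfun_density (f : {nnsfun Y >-> R}) :
  \int[nu]_(y in E) (f y)%:E = \int[mu]_(x in phi @^-1` E) ((f (phi x))%:E * (w x)%:E).
Proof.
transitivity (\sum_(k \in range f) k%:E * nu (E `&` f @^-1` [set k])).
  under eq_integral do rewrite fimfunE -fsumEFin//.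
  rewrite ge0_integral_fsum//; last 2 first.
  - by move=> y; exact/measurable_EFinP/measurable_funM.
  - by move=> y x _; rewrite nnfun_muleindic_ge0.
  apply: eq_fsbigr => r _; rewrite integralZl_indic_nnsfun// integral_indic//.
  by rewrite setIC.
transitivity (\sum_(k \in range f)
    \int[mu]_(x in phi @^-1` E) ((k * \1_(f @^-1` [set k]) (phi x))%:E * (w x)%:E)).
  apply: eq_fsbigr => r; rewrite inE => -[y _ <-].
  have mI : measurable (E `&` f @^-1` [set f y]) by exact: measurableI.
  rewrite (nuE mI); last by move=> z [].
  rewrite preimage_setI integral_mkcondr -ge0_integralZl//; last 4 first.
  - exact: mpre.
  - apply/(measurable_restrict _ _ _) => //; first exact: mpre.
      exact: mpre.
    by apply: measurable_funTS; exact/measurable_EFinP.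
  - by move=> x _; rewrite patchE; case: ifPn => //; rewrite lee_fin.
  - by rewrite lee_fin.
  apply: eq_integral => x _; rewrite patchE indicE EFinM.
  have -> : (phi x \in f @^-1` [set f y]) = (x \in phi @^-1` (f @^-1` [set f y])).
    by apply/idP/idP; rewrite !inE.
  by case: ifPn => _; rewrite ?mule1 ?mule0 ?mul0e.
rewrite -ge0_integral_fsum//.
- apply: eq_integral => x _; rewrite -ge0_mule_fsuml; last by move=> r; rewrite nnfun_muleindic_ge0.
  by rewrite fsumEFin// -fimfunE.
- exact: mpre.
- move=> r; apply: emeasurable_funM; apply/measurable_EFinP; apply: measurable_funTS => //.
  apply: measurable_funM => //; apply: measurableT_comp => //.
- by move=> r x _; rewrite mule_ge0 ?nnfun_muleindic_ge0// lee_fin.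
Qed.

Lemma ge0_integral_density (f : Y -> \bar R) :
  measurable_fun E f -> (forall y, E y -> 0 <= f y) ->
  \int[nu]_(y in E) f y = \int[mu]_(x in phi @^-1` E) (f (phi x) * (w x)%:E).
Proof.
move=> mf f0; have mpE := mpre mE; pose f_ := nnsfun_approx mE mf.
transitivity (limn (fun n => \int[nu]_(x in E) (f_ n x)%:E)).
  rewrite -monotone_convergence//.
  - apply: eq_integral => y /[!inE] yD; apply/esym/cvg_lim => //.
    exact: cvg_nnsfun_approx.
  - by move=> n; exact/measurable_EFinP/measurable_funP.
  - by move=> n y _; rewrite lee_fin.
  - by move=> y _ m n mn; rewrite lee_fin; exact/lefP/nd_nnsfun_approx.
under eq_fun do rewrite sfun_density.
rewrite -monotone_convergence//; last 3 first.
- move=> n; apply: emeasurable_funM; apply/measurable_EFinP; apply: measurable_funTS => //.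
  exact: measurableT_comp.
- by move=> n x _; rewrite mule_ge0// lee_fin.
- move=> x _ m n mn; rewrite lee_wpmul2r ?lee_fin//; exact/lefP/nd_nnsfun_approx.
apply: eq_integral => x /[!inE] Ex; apply/cvg_lim => //.
by apply: cvgeZr => //; exact: cvg_nnsfun_approx.
Qed.

Lemma integral_density (f : Y -> \bar R) : measurable_fun E f ->
  \int[nu]_(y in E) f y = \int[mu]_(x in phi @^-1` E) (f (phi x) * (w x)%:E).
Proof.
move=> mf; rewrite integralE [RHS]integralE.
rewrite (ge0_integral_density (measurable_funepos mf))//.
rewrite (ge0_integral_density (measurable_funeneg mf))//.
congr (_ - _); apply: eq_integral => x _.
  by rewrite !funeposE maxe_pMl// ?lee_fin// mul0e.
by rewrite !funenegE -mulNe maxe_pMl ?lee_fin// mul0e.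
Qed.

End integral_density.

(** * Boundaries that are graphs *)

Section boundary_graph.
Context {R : realType} {m : nat}.
Variables (D : set 'rV[R]_m.+1) (j : 'I_m.+1) (b : bool) (gamma : 'rV[R]_m -> R).
Variable (O : set 'rV[R]_m.+1).
Hypotheses (oD : open D) (oO : open O) (Cg : C1 gamma).
Let s : R := (-1) ^+ b.
Hypothesis DO : forall x, O x -> (D x <-> 0 < s * (x ord0 j - gamma (col' j x))).

Let graph y : 'rV[R]_m.+1 := rV_ins j (gamma y) y.
Let level (x : 'rV[R]_m.+1) : R := s * (x ord0 j - gamma (col' j x)).

Lemma sgn_cases : s = 1 \/ s = -1.
Proof. by rewrite /s; case: b; [right; rewrite expr1|left; rewrite expr0]. Qed.

Lemma sgn_sqr : s * s = 1.
Proof. by case: sgn_cases => ->; rewrite ?mulr1 ?mulrNN ?mulr1. Qed.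

Lemma continuous_row_by_coord (T : topologicalType) p (f : T -> 'rV[R]_p) :
  (forall i, continuous (fun x => f x ord0 i)) -> continuous f.
Proof.
move=> cf x; apply/cvgrPdist_le => e e0; near=> y.
apply: rV_norm_le => [|i]; first exact: ltW.
rewrite !mxE; move: i; near: y; apply: filter_forall => i.
exact: (@cvgr_dist_le _ _ _ (nbhs x) _ _ _ (cf i x)).
Unshelve. all: by end_near. Qed.

Lemma col'_continuous : continuous (fun x : 'rV[R]_m.+1 => col' j x).
Proof.
apply: continuous_row_by_coord => i; under eq_fun do rewrite mxE.
exact: coord_continuous_row.
Qed.

Lemma rV_ins_continuous (f : 'rV[R]_m -> R) : continuous f ->
  continuous (fun y => rV_ins j (f y) y).
Proof.
move=> cf; apply: continuous_row_by_coord => i; case: (unliftP j i) => [k ->|->].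
  by under eq_fun do rewrite rV_ins_lift; exact: coord_continuous_row.
by under eq_fun do rewrite rV_ins_at.
Qed.

Lemma level_continuous : continuous level.
Proof.
move=> x; apply: (@cvgM _ _ (nbhs x) _ (cst s)); first exact: cvg_cst.
apply: (@cvgB _ _ _ (nbhs x) _ (fun x : 'rV[R]_m.+1 => x ord0 j) (fun x => gamma (col' j x))).
  exact: coord_continuous_row.
exact: (continuous_comp (col'_continuous (x := x)) (C1_continuous Cg (x := col' j x))).
Qed.

(** In O the set where [level] is negative is open and misses D, and the set where it is positive
    lies in the open set D, so only zeros can be boundary points. From a zero, a step of length e/2
    along s e_j enters D. *)
Lemma boundary_graphP x : O x -> (boundary D x <-> x ord0 j = gamma (col' j x)).
Proof.
move=> Ox; have iD : interior D = D by apply/interior_id.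
have O_x : nbhs x O by exact: open_nbhs_nbhs.
rewrite /boundary iD; split=> [[clD nD]|xj].
  have : level x <= 0 by rewrite leNgt; apply/negP => /(DO Ox).
  rewrite le_eqVlt => /orP[/eqP|lx].
    move/eqP; rewrite /level mulf_eq0; case: sgn_cases => ->; rewrite ?oppr_eq0 oner_eq0/=;
    by rewrite subr_eq0 => /eqP.
  exfalso; have : nbhs x (fun y => level y < 0).
    exact: (@cvgr_lt _ _ (nbhs x) _ level _ (level_continuous (x := x))).
  move=> /(filterI O_x) /clD[y [Dy [Oy ly]]].
  by have := (DO Oy).1 Dy; rewrite ltNge (ltW ly).
have lx : level x = 0 by rewrite /level xj subrr mulr0.
split; last by move=> /(DO Ox); rewrite -/(level x) lx ltxx.
move=> B /(filterI O_x) /nbhs_ballP[e /= e0 xB].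
have dn : `|delta_mx ord0 j : 'rV[R]_m.+1| <= 1.
  by apply: rV_norm_le => // i; rewrite mxE eqxx/=; case: eqP; rewrite ?normr1 ?normr0.
pose y := x + (s * (e / 2)) *: delta_mx ord0 j.
have ns : `|s| = 1 by case: sgn_cases => ->; rewrite ?normrN normr1.
have /xB[Oy By] : ball x e y.
  rewrite -ball_normE/= /y opprD addNKr normrN normrZ normrM ns mul1r ger0_norm ?divr_ge0 ?ltW//.
  rewrite (le_lt_trans (ler_wpM2l _ dn)) ?divr_ge0 ?ltW// mulr1 ltr_pdivrMr//.
  by rewrite ltr_pMr// ltr1n.
exists y; split=> //; apply/(DO Oy).
have -> : col' j y = col' j x.
  apply/rowP => k; rewrite !mxE eqxx/= [lift j k == j]eq_sym (negbTE (neq_lift _ _)).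
  by rewrite mulr0 addr0.
by rewrite !mxE !eqxx mulr1 -xj addrAC subrr add0r mulrA sgn_sqr mul1r divr_gt0.
Qed.

Lemma boundary_graph y : O (graph y) -> boundary D (graph y).
Proof. by move=> Oy; apply/(boundary_graphP Oy); rewrite rV_ins_at rV_insK. Qed.

Lemma enorm_le_sum p (v : 'rV[R]_p) : enorm v <= \sum_i `|v ord0 i|.
Proof.
have S0 : 0 <= \sum_i `|v ord0 i| by apply: sumr_ge0.
rewrite /enorm -[leRHS]ger0_norm// -sqrtr_sqr ler_wsqrtr// expr2 mulr_suml.
apply: ler_sum => i _; rewrite -real_normK ?num_real// expr2 ler_wpM2l//.
by rewrite (bigD1 i)//= lerDl sumr_ge0.
Qed.

Variables (nu : 'rV[R]_m.+1 -> 'rV[R]_m.+1) (y : 'rV[R]_m).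
Hypotheses (nuD : external_unit_normal D nu) (Oy : O (graph y)).

Let w : R := Num.sqrt (1 + \sum_i pderive i gamma y ^+ 2).
Let nj : R := nu (graph y) ord0 j.

Let w2 : w * w = 1 + \sum_i pderive i gamma y ^+ 2.
Proof.
by rewrite -expr2 sqr_sqrtr// addr_ge0// sumr_ge0// => i _; exact: sqr_ge0.
Qed.

Let w_gt0 : 0 < w.
Proof.
by rewrite sqrtr_gt0 ltr_pwDl// sumr_ge0// => i _; exact: sqr_ge0.
Qed.


(** The tangency condition is tested along the curve h -> graph (y + h e_k). The dot product of its
    increment with the normal is nj dg(h) + A h; after division by h the limit is nj d_k gamma + A =
    0. *)
Lemma normal_tangent k : nu (graph y) ord0 (lift j k) = - nj * pderive k gamma y.
Proof.
have [_ tan _] := nuD (boundary_graph Oy).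
set A := nu (graph y) ord0 (lift j k); set g' := pderive k gamma y.
pose ek : 'rV[R]_m := delta_mx ord0 k.
pose dg h := gamma (h *: ek + y) - gamma y.
have dq : dg h / h @[h --> (0 : R)^'] --> g'.
  have [dgk _] := Cg k; have := dgk y; rewrite /derivable => Hc.
  rewrite /g' /pderive /derive; apply: cvg_trans Hc; apply: near_eq_cvg; near=> h.
  by rewrite /dg mulrC.
have cgr : (fun h : R => graph (h *: ek + y)) h @[h --> (0 : R)^'] --> graph y.
  have c0 : {for (0 : R), continuous (fun h : R => graph (h *: ek + y))}.
    apply: (continuous_comp (f := fun h : R => h *: ek + y)).
      apply: (@cvgD _ _ _ (nbhs (0 : R)) _ (fun h : R => h *: ek) (cst y)).
        exact: scalel_continuous.
      exact: cvg_cst.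
    apply: rV_ins_continuous; exact: C1_continuous.
  have c0' : graph (h *: ek + y) @[h --> (0 : R)] --> graph (0 *: ek + y) by exact: c0.
  rewrite scale0r add0r in c0'.
  exact: cvg_trans (cvg_app _ (@cvg_within _ _ _ _)) c0'.
have diffE h : dotp (nu (graph y)) (graph (h *: ek + y) - graph y) = nj * dg h + A * h.
  rewrite /dotp (bigD1_ord j)//= !mxE unlift_none; congr (_ + _).
  rewrite (bigD1 k)//= big1 ?addr0; last first.
    move=> i ik; rewrite !mxE !liftK !mxE eqxx/= (negbTE ik) mulr0 add0r subrr.
    by rewrite mulr0.
  by rewrite !mxE liftK !mxE !eqxx mulr1 addrK.
have normE h : enorm (graph (h *: ek + y) - graph y) <= `|dg h| + `|h|.
  rewrite (le_trans (enorm_le_sum _))// (bigD1_ord j)//= !mxE unlift_none lerD//.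
  rewrite (bigD1 k)//= big1 ?addr0; last first.
    move=> i ik; rewrite !mxE !liftK !mxE eqxx/= (negbTE ik) mulr0 add0r subrr.
    by rewrite normr0.
  by rewrite !mxE liftK !mxE !eqxx mulr1 addrK.
suff : nj * g' + A = 0 by move/eqP; rewrite addrC addr_eq0 mulNr => /eqP.
apply/eqP; rewrite -normr_le0; apply/ler_addgt0Pr => e e0; rewrite add0r.
(* The tangency estimate costs d (|g'| + 2) and the difference quotient d (|nj| + 1); C is the total
   cost per unit of d. *)
pose C := `|g'| + 2 + (`|nj| + 1).
have C0 : 0 < C by have := normr_ge0 g'; have := normr_ge0 nj; rewrite /C; lra.
pose d := Num.min 1 (e / C).
have d0 : 0 < d by rewrite lt_min ltr01 divr_gt0.
have d1 : d <= 1 by rewrite ge_min lexx.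
have Otan : \forall h \near (0 : R)^', O (graph (h *: ek + y)) /\
    (boundary D (graph (h *: ek + y)) ->
      `|dotp (nu (graph y)) (graph (h *: ek + y) - graph y)|
        <= d * enorm (graph (h *: ek + y) - graph y)).
  exact: (cgr _ (filterI (open_nbhs_nbhs (conj oO Oy)) (tan d d0))).
have dq' : \forall h \near (0 : R)^', `|g' - dg h / h| <= d.
  by apply: cvgr_dist_le => //; exact: dq.
near (0 : R)^' => h.
have h0 : h != 0 by near: h; exact: nbhs_dnbhs_neq.
have [Oh tanh] : O (graph (h *: ek + y)) /\
    (boundary D (graph (h *: ek + y)) ->
      `|dotp (nu (graph y)) (graph (h *: ek + y) - graph y)|
        <= d * enorm (graph (h *: ek + y) - graph y)) by near: h.
have hq : `|g' - dg h / h| <= d by near: h.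
have {}tanh := tanh (boundary_graph Oh); rewrite diffE in tanh.
have hgt0 : 0 < `|h| by rewrite normr_gt0.
have dgh : `|dg h| <= (`|g'| + 1) * `|h|.
  rewrite -ler_pdivrMr// -normf_div -lerBlDl (le_trans (lerB_dist _ _))//.
  by rewrite distrC (le_trans hq).
have T1 : `|nj * (dg h / h) + A| <= d * (`|g'| + 2).
  rewrite -(ler_pM2r hgt0) -normrM mulrDl -mulrA divfK// (le_trans tanh)//.
  rewrite -mulrA ler_wpM2l ?(ltW d0)// (le_trans (normE h))//.
  rewrite (_ : (`|g'| + 2) * `|h| = (`|g'| + 1) * `|h| + `|h|); last by ring.
  by rewrite lerD2r.
have T2 : `|nj * (g' - dg h / h)| <= (`|nj| + 1) * d.
  by rewrite normrM ler_pM// lerDl.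
have -> : nj * g' + A = (nj * (dg h / h) + A) + nj * (g' - dg h / h) by ring.
rewrite (le_trans (ler_normD _ _))// (le_trans (lerD T1 T2))//.
rewrite [(`|nj| + 1) * d]mulrC -mulrDr -/C -ler_pdivlMr//.
by rewrite ge_min lexx orbT.
Unshelve. all: by end_near. Qed.

Lemma normal_vertical_sqr : nj * nj * (w * w) = 1.
Proof.
have [n1 _ _] := nuD (boundary_graph Oy).
have : enorm (nu (graph y)) ^+ 2 = 1 by rewrite n1 expr1n.
rewrite /enorm sqr_sqrtr; last by apply: sumr_ge0 => i _; exact: sqr_ge0.
rewrite (bigD1_ord j)//= => <-; rewrite w2 mulrDr mulr1 -expr2; congr (_ + _).
rewrite mulr_sumr; apply: eq_bigr => k _; rewrite normal_tangent.
by rewrite mulNr sqrrN exprMn.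
Qed.

(** Along the normal, the signed height [level] has derivative s nj w^2 at 0. Were it positive, the
    points t nu beyond the surface would lie in D for small t > 0. The value 0 is excluded by
    [normal_vertical_sqr]. *)
Lemma normal_vertical_sign : s * nj < 0.
Proof.
rewrite ltNge; apply/negP => sn0.
have {}sn0 : 0 < s * nj.
  rewrite lt_neqAle sn0 andbT eq_sym; apply/eqP => sn.
  have : nj * nj * (w * w) = 0.
    have -> : nj = s * (s * nj) by rewrite mulrA sgn_sqr mul1r.
    by rewrite sn !mulr0 !mul0r.
  by rewrite normal_vertical_sqr => /eqP; rewrite oner_eq0.
have [_ _ out] := nuD (boundary_graph Oy).
set v := nu (graph y) in out *.
pose l t := level (graph y + t *: v).
have l0 : l 0 = 0.
  by rewrite /l scale0r addr0 /level rV_ins_at rV_insK subrr mulr0.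
have dl : is_derive (0 : R) (1 : R) l (s * nj * (w * w)).
  have dlin (a c : R) : is_derive (0 : R) (1 : R) (fun t => a + t * c) c.
    have dM := is_deriveM (is_derive_id (0 : R) (1 : R)) (is_derive_cst c (0 : R) (1 : R)).
    have dD : is_derive (0 : R) (1 : R) (fun t => a + t * c) _ :=
      is_deriveD (is_derive_cst a (0 : R) (1 : R)) dM.
    by apply: (is_derive_eq dD); rewrite scaler0 !add0r [_ *: 1]mulr1.
  pose cv (t : R) := col' j (graph y + t *: v).
  have dgam : is_derive (0 : R) (1 : R) (fun t => gamma (cv t))
      (\sum_k v ord0 (lift j k) * pderive k gamma (cv 0)).
    apply: C1_is_derive_curve => // k; rewrite /cv.
    by under eq_fun do rewrite !mxE; exact: dlin.
  have dd := is_deriveM (is_derive_cst s (0 : R) (1 : R))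
    (is_deriveB (dlin (graph y ord0 j) (v ord0 j)) dgam).
  have {}dd : is_derive (0 : R) (1 : R)
    (fun t => s * (graph y ord0 j + t * v ord0 j - gamma (cv t))) _ := dd.
  have -> : l = (fun t => s * (graph y ord0 j + t * v ord0 j - gamma (cv t))).
    by apply/funext => t; rewrite /l /level !mxE.
  apply: (is_derive_eq dd).
  rewrite scaler0 addr0 /cv scale0r addr0 rV_insK -mulrA; congr (_ * _).
  rewrite w2 mulrDr mulr1; congr (_ + _).
  rewrite mulr_sumr -sumrN; apply: eq_bigr => k _.
  by rewrite /v normal_tangent expr2; ring.
have lpos : 0 < s * nj * (w * w) by rewrite mulr_gt0// mulr_gt0.
have [dl0 dlE] := dl.
have lq : \forall t \near (0 : R)^', 0 < l t / t.
  have Q : l t / t @[t --> (0 : R)^'] --> s * nj * (w * w).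
    rewrite -dlE /derive; apply: cvg_trans dl0; apply: near_eq_cvg; near=> t.
    by rewrite /= l0 subr0 addr0 [t *: 1]mulr1 mulrC.
  exact: (cvgr_gt _ Q).
have lO : \forall t \near (0 : R), O (graph y + t *: v).
  have c0 : {for (0 : R), continuous (fun t : R => graph y + t *: v)}.
    apply: (@cvgD _ _ _ (nbhs (0 : R)) _ (cst (graph y)) (fun t : R => t *: v)).
      exact: cvg_cst.
    exact: scalel_continuous.
  have c0' : graph y + t *: v @[t --> (0 : R)] --> graph y + 0 *: v by exact: c0.
  rewrite scale0r addr0 in c0'.
  by apply: c0'; exact: open_nbhs_nbhs.
have lq' : \forall t \near (0 : R)^'+, 0 < l t / t.
  move: lq; rewrite !near_withinE; apply: filterS => t H t0; apply: H.
  by rewrite gt_eqF.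
have lO' : \forall t \near (0 : R)^'+, O (graph y + t *: v).
  by rewrite near_withinE; apply: filterS lO => t H _.
near (0 : R)^'+ => t.
have t0 : 0 < t by near: t; exact: nbhs_right_gt.
have lt : 0 < l t / t.
  by near: t.
have Ot : O (graph y + t *: v) by near: t.
have : ~ closure D (graph y + t *: v) by near: t.
apply; apply: subset_closure; apply/(DO Ot).
by have := mulr_gt0 lt t0; rewrite divfK ?gt_eqF.
Unshelve. all: by end_near. Qed.

Lemma normal_vertical : nj * w = - s.
Proof.
have := normal_vertical_sqr; have := normal_vertical_sign.
case: sgn_cases => ->; rewrite ?mul1r ?mulN1r ?oppr_lt0 => nj0 E.
  have : nj * w < 0 by rewrite nmulr_rlt0.
  by move: E; nra.
have : 0 < nj * w by rewrite mulr_gt0.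
by move: E; nra.
Qed.

Lemma normal_horizontal k : nu (graph y) ord0 (lift j k) * w = s * pderive k gamma y.
Proof. by rewrite normal_tangent mulrAC mulNr normal_vertical opprK. Qed.

End boundary_graph.

Section continuous_compact_support.
Context {R : realType} {n : nat}.

Lemma compact_support_bounded (f : 'rV[R]_n -> R) M :
  continuous f -> (forall x, M < `|x| -> f x = 0) ->
  exists2 C, 0 <= C & forall x, `|f x| <= C.
Proof.
move=> cf fM.
have := continuous_compact (continuous_subspaceT cf) (@norm_le_compact R n M).
move=> /compact_bounded[B [_ fB]]; exists (`|B| + 1); first by rewrite addr_ge0.
move=> x; have [xM|/fM ->] := leP `|x| M; last by rewrite normr0 addr_ge0.
by apply: fB; [rewrite ltr_pwDr// ler_norm|exists x].
Qed.

Lemma continuous_compact_support_integrable_rV (f : 'rV[R]_n -> R) M :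
  continuous f -> (forall x, M < `|x| -> f x = 0) ->
  (lebesgue_rV R n).-integrable setT (EFin \o f).
Proof.
move=> cf fM; have [C _ fC] := compact_support_bounded cf fM.
by apply: (bounded_support_integrable_rV _ fC fM); exact: continuous_measurable_rV.
Qed.

End continuous_compact_support.

(** * Slices parallel to an axis *)

Section slices.
Context {R : realType} {m : nat} (j : 'I_m.+1).
Local Notation leb := (@lebesgue_measure R).

Lemma rV_ins_affine t h (y : 'rV[R]_m) :
  rV_ins j (t + h) y = rV_ins j t y + h *: delta_mx ord0 j.
Proof.
apply/rowP => k; rewrite !mxE eqxx /=; case: (unliftP j k) => [k' ->|->].
  by rewrite [lift j k' == j]eq_sym (negbTE (neq_lift _ _)) mulr0 addr0.
by rewrite eqxx mulr1.
Qed.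

Lemma norm_rV_ins_t t (y : 'rV[R]_m) : `|t| <= `|rV_ins j t y|.
Proof. by rewrite -[X in `|X| <= _](rV_ins_at j t y) coord_le_norm. Qed.

Lemma norm_rV_ins_y t (y : 'rV[R]_m) : `|y| <= `|rV_ins j t y|.
Proof.
apply: rV_norm_le => // i.
by rewrite -(rV_ins_lift j t y) coord_le_norm.
Qed.

Lemma measurable_slice (f : 'rV[R]_m.+1 -> R) y : measurable_fun setT f ->
  measurable_fun setT (fun t : measurableTypeR R => f (rV_ins j t y)).
Proof.
move=> mf; apply: (measurableT_comp mf).
exact: (measurableT_comp (measurable_rV_ins j) (pair2_measurable y)).
Qed.

Lemma slice_integrable (f : 'rV[R]_m.+1 -> R) C M y :
  measurable_fun setT f -> (forall x, `|f x| <= C) -> (forall x, M < `|x| -> f x = 0) ->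
  leb.-integrable setT (fun t => (f (rV_ins j t y))%:E).
Proof.
move=> mf fC fM.
apply: (@bounded_support_integrable _ _ _ leb `[- M, M] (fun t => f (rV_ins j t y)) C) => //.
- by apply: compact_finite_measure; exact: segment_compact.
- exact: measurable_slice.
move=> t /negP; rewrite /= in_itv/= -ler_norml -ltNge => Mt; apply: fM.
exact: lt_le_trans (norm_rV_ins_t t y).
Qed.

Lemma Rintegral_rV_ins (f : 'rV[R]_m.+1 -> R) C M :
  measurable_fun setT f -> (forall x, `|f x| <= C) -> (forall x, M < `|x| -> f x = 0) ->
  \int[lebesgue_rV R m.+1]_x f x = \int[lebesgue_rV R m]_y \int[leb]_t f (rV_ins j t y).
Proof.
move=> mf fC fM.
have fi := bounded_support_integrable_rV mf fC fM.
rewrite /Rintegral (integral_rV_ins j fi); congr fine; apply: eq_integral => y _.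
rewrite /= fineK//; apply: (integrable_fin_num (mu := leb)) => //.
exact: slice_integrable fM.
Qed.

Lemma is_derive_slice (F : 'rV[R]_m.+1 -> R) y t l :
  is_derive (rV_ins j t y) (delta_mx ord0 j) F l ->
  is_derive t (1 : R) (fun t => F (rV_ins j t y)) l.
Proof.
apply: is_derive_congr => h.
by rewrite [h *: 1]mulr1 addrC -rV_ins_affine addrC.
Qed.

Lemma continuous_slice (f : 'rV[R]_m.+1 -> R) y : continuous f ->
  continuous (fun t : R => f (rV_ins j t y)).
Proof.
move=> cf; suff ci : continuous (fun t : R => rV_ins j t y).
  by move=> t; exact: (continuous_comp (ci t) (cf _)).
apply: continuous_row_by_coord => k; case: (unliftP j k) => [k' ->|->].
  by under eq_fun do rewrite rV_ins_lift; exact: cst_continuous.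
by under eq_fun do rewrite rV_ins_at; move=> ?.
Qed.

Lemma integral_pderive_compact_support (F F' : 'rV[R]_m.+1 -> R) M :
  (forall x, is_derive x (delta_mx ord0 j) F (F' x)) -> continuous F' ->
  (forall x, M < `|x| -> F x = 0) ->
  \int[lebesgue_rV R m.+1]_x F' x = 0.
Proof.
move=> dF cF' FM.
have F'M x : M < `|x| -> F' x = 0.
  by move=> Mx; have [_ <-] := dF x; exact: (pderive_norm0 j FM Mx).
have [C _ FC] := compact_support_bounded cF' F'M.
rewrite (Rintegral_rV_ins (continuous_measurable_rV cF') FC F'M).
rewrite (_ : (fun y => _) = cst 0); first by rewrite Rintegral_cst// mul0r.
apply/funext => y; apply: (@integral_derive_compact_support _ (fun t => F (rV_ins j t y)) _ M).
- by move=> t; exact: (is_derive_slice (dF _)).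
- exact: continuous_slice.
- by move=> t Mt; apply: FM; exact: lt_le_trans (norm_rV_ins_t t y).
Qed.

End slices.

Lemma integral_pderive_eq0 (R : realType) n (k : 'I_n) (F F' : 'rV[R]_n -> R) M :
  (forall x, is_derive x (delta_mx ord0 k) F (F' x)) -> continuous F' ->
  (forall x, M < `|x| -> F x = 0) ->
  \int[lebesgue_rV R n]_x F' x = 0.
Proof.
by case: n k F F' => [[]//|n] k F F'; exact: integral_pderive_compact_support.
Qed.

(** * Primitives along the vertical axis *)

Section vertical_primitive.
Context {R : realType} {m : nat} (j : 'I_m.+1).
Variables (s L : R).
Hypotheses (s1 : s = 1 \/ s = -1) (L0 : 0 <= L).
Local Notation leb := (@lebesgue_measure R).

Definition vertical_primitive (f : 'rV[R]_m.+1 -> R) : 'rV[R]_m.+1 -> R :=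
  param_integral leb `[0, L]%classic (fun=> 1)
    (fun r : measurableTypeR R => (s * r) *: delta_mx ord0 j) f.

Let intL : leb.-integrable `[0, L] (EFin \o (fun=> 1 : R)).
Proof.
apply: continuous_compact_integrable; first exact: segment_compact.
by apply: continuous_subspaceT => t; exact: cst_continuous.
Qed.

Let mshift : measurable_fun setT
  (fun r : measurableTypeR R => (s * r) *: delta_mx ord0 j : 'rV[R]_m.+1).
Proof.
apply: measurable_fun_rVP => i; under eq_fun do rewrite mxE.
apply: measurable_funM => //; exact: measurable_funM.
Qed.

Lemma smooth_vertical_primitive f : test_function f -> smooth (vertical_primitive f).
Proof.
by move=> tf; apply: param_integral_smooth => //;
  [exact: (proj1 tf)|exact: test_function_bounded_derivatives].
Qed.

Lemma pderive_vertical_primitive f i : test_function f ->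
  pderive i (vertical_primitive f) = vertical_primitive (pderive i f).
Proof.
by move=> tf; apply: pderive_param_integral => //;
  [exact: (proj1 tf)|exact: test_function_bounded_derivatives].
Qed.

Lemma vertical_primitive_ins f t y :
  vertical_primitive f (rV_ins j t y) =
  \int[leb]_(r in `[0, L]) f (rV_ins j (t + s * r) y).
Proof.
by apply: eq_Rintegral => r _; rewrite mul1r rV_ins_affine.
Qed.

Lemma vertical_primitive_pderive f x : test_function f ->
  vertical_primitive (pderive j f) x = s * (f (x + (s * L) *: delta_mx ord0 j) - f x).
Proof.
move=> [sf _]; have ss : s * s = 1 by case: s1 => ->; rewrite ?mulrNN mulr1.
(* The outer s cancels the s that comes from the inner derivative. *)
pose g r := s * f (x + (s * r) *: delta_mx ord0 j).
have cdir : continuous (fun r : R => x + (s * r) *: delta_mx ord0 j).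
  move=> r; apply: (@cvgD _ _ _ (nbhs r) _ (cst x)); first exact: cvg_cst.
  apply: (@cvgZr_tmp _ _ _ (nbhs r) _ (fun r : R => s * r)).
  by apply: (@cvgM _ _ (nbhs r) _ (cst s) id); [exact: cvg_cst|exact: cvg_id].
have dg r : is_derive r (1 : R) g (pderive j f (x + (s * r) *: delta_mx ord0 j)).
  have H := derive_scaled_dir s (smooth_is_derive j (x + (s * r) *: delta_mx ord0 j) sf).
  have H1 : is_derive r (1 : R) (fun r => f (x + (s * r) *: delta_mx ord0 j))
      (s * pderive j f (x + (s * r) *: delta_mx ord0 j)).
    apply: (is_derive_congr _ H) => h; congr f.
    by rewrite [h *: 1]mulr1 mulrDr scalerDl scalerA [h * s]mulrC addrCA.
  have H2 : is_derive r (1 : R) g _ := is_deriveM (is_derive_cst s r (1 : R)) H1.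
  apply: (is_derive_eq H2); rewrite scaler0 addr0.
  by rewrite [LHS]mulrA ss mul1r.
have := @FTC2 R g _ 0 L L0 dg.
rewrite /g mulr0 scale0r addr0 mulrBr => <-; first by apply: eq_Rintegral => r _; rewrite mul1r.
move=> r; apply: (continuous_comp (cdir r)).
by apply: smooth_continuous; exact: smooth_pderive.
Qed.

End vertical_primitive.

(** * The volume integral in a chart *)

Section local_divergence.
Context {R : realType} {m : nat}.
Variables (D : set 'rV[R]_m.+1) (j : 'I_m.+1) (b : bool) (gamma : 'rV[R]_m -> R).
Variable (O : set 'rV[R]_m.+1).
Hypotheses (oD : open D) (oO : open O) (Cg : C1 gamma).
Let s : R := (-1) ^+ b.
Hypothesis DO : forall x, O x -> (D x <-> 0 < s * (x ord0 j - gamma (col' j x))).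
Local Notation leb := (@lebesgue_measure R).
Let graph y : 'rV[R]_m.+1 := rV_ins j (gamma y) y.

Lemma measurable_boundary : measurable (boundary D).
Proof.
apply: measurableD.
  by apply: closed_measurable_rV; exact: closed_closure.
by apply: open_measurable_rV; exact: open_interior.
Qed.

Lemma measurable_char_domain : measurable_fun setT (@char_domain R m.+1 D).
Proof.
have -> : @char_domain R m.+1 D = fun x => \1_D x + 2^-1 * \1_(boundary D `\` D) x.
  apply/funext => x; rewrite /char_domain !indicE in_setD.
  by case: (x \in D) => /=; rewrite ?andbF ?mulr0 ?addr0//; case: ifP; rewrite ?mulr1 ?mulr0 add0r.
have mD : measurable D by exact: open_measurable_rV.
apply: measurable_funD; first exact: measurable_indic.
apply: measurable_funM => //; apply: measurable_indic.
exact: measurableD measurable_boundary mD.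
Qed.

Lemma char_domain_bounded x : `|@char_domain R m.+1 D x| <= 1.
Proof.
rewrite /char_domain; case: ifP => _; first by rewrite normr1.
case: ifP => _; last by rewrite normr0.
by rewrite ger0_norm// invf_le1// ler1n.
Qed.

Lemma char_domain_graph x : O x -> x ord0 j != gamma (col' j x) ->
  char_domain D x = if 0 < s * (x ord0 j - gamma (col' j x)) then 1 else 0.
Proof.
move=> Ox xj; rewrite /char_domain [x \in D](_ : _ = (0 < s * (x ord0 j - gamma (col' j x)))); last first.
  by apply/idP/idP => [/set_mem/(DO Ox)|/(DO Ox) ?]; [|exact: mem_set].
case: ifP => // _; case: ifP => //; rewrite inE => /(boundary_graphP oD oO Cg DO Ox) xE.
by rewrite xE eqxx in xj.
Qed.

Variables (phi : 'rV[R]_m.+1 -> R) (M G L : R).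
Hypotheses (tphi : test_function phi) (phiM : forall x, M < `|x| -> phi x = 0).
Hypotheses (phiO : fsupp phi `<=` O).
Hypotheses (M0 : 0 <= M) (gG : forall y, `|y| <= M -> `|gamma y| <= G) (ML : M + G < L).
Local Notation K := (vertical_primitive j s L).

Let s1 : s = 1 \/ s = -1.
Proof. exact: sgn_cases. Qed.

Let L0 : 0 <= L.
Proof.
apply/ltW/(le_lt_trans _ ML); rewrite addr_ge0//.
by apply: le_trans (gG (y := 0) _); rewrite ?normr0.
Qed.

(** For |y| <= M the slice meets the graph at a height of size at most G, so L > M + G takes the
    segment out of the support; for |y| > M both sides vanish. Outside O nothing is known of D, but
    psi is 0 there. *)
Lemma Rintegral_slice_char (psi : 'rV[R]_m.+1 -> R) y :
  continuous psi -> (forall x, M < `|x| -> psi x = 0) ->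
  (forall x, ~ O x -> psi x = 0) ->
  \int[leb]_t (char_domain D (rV_ins j t y) * psi (rV_ins j t y)) =
  K psi (graph y).
Proof.
move=> cpsi psiM psiO; rewrite vertical_primitive_ins.
have [yM|My] := leP `|y| M; last first.
  have z t : psi (rV_ins j t y) = 0.
    by apply: psiM; exact: lt_le_trans (norm_rV_ins_y j t y).
  rewrite (_ : (fun t => _ * _) = cst 0); last by apply/funext => t /=; rewrite z mulr0.
  rewrite [in RHS](_ : (fun r => psi _) = cst 0); last by apply/funext => t /=; rewrite z.
  by rewrite !Rintegral_cst ?mul0r//; exact: measurable_itv.
apply: (@Rintegral_half_line _ (fun t => psi (rV_ins j t y)) _ _ _ M) => //.
- exact: continuous_slice.
- by move=> t Mt; apply: psiM; exact: lt_le_trans (norm_rV_ins_t j t y).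
- by rewrite (le_lt_trans _ ML)// lerD2l gG.
move=> t tg; have [Ot|/psiO ->] := pselect (O (rV_ins j t y)); last first.
  by rewrite mulr0; case: ifP.
rewrite char_domain_graph//; rewrite ?rV_ins_at ?rV_insK//.
by case: ifP => _; rewrite ?mul1r ?mul0r.
Qed.

Let pphiO i x : ~ O x -> pderive i phi x = 0.
Proof. by move=> nOx; apply: pderive0 => /phiO. Qed.

Let pphiM i x : M < `|x| -> pderive i phi x = 0.
Proof. exact: pderive_norm0. Qed.

Let cphi i : continuous (pderive i phi).
Proof. by have [sphi _] := tphi; exact/smooth_continuous/smooth_pderive. Qed.

Lemma Rintegral_char_pderive i :
  \int[lebesgue_rV R m.+1]_x (char_domain D x * pderive i phi x) =
  \int[lebesgue_rV R m]_y K (pderive i phi) (graph y).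
Proof.
have [C _ fC] := test_function_bounded [:: i] tphi.
rewrite (@Rintegral_rV_ins _ _ j _ C M).
- by apply: eq_Rintegral => y _; rewrite Rintegral_slice_char//; [exact: pphiM|exact: pphiO].
- apply: measurable_funM; first exact: measurable_char_domain.
  exact: continuous_measurable_rV.
- move=> x; rewrite normrM -[C]mul1r ler_pM//; first exact: char_domain_bounded.
  exact: fC.
- by move=> x Mx; rewrite pphiM// mulr0.
Qed.

(** For |y| <= M the far end gamma y + s L has absolute value at least L - G > M, so only the end on
    the graph contributes. *)
Let K_vertical y : K (pderive j phi) (graph y) = - s * phi (graph y).
Proof.
rewrite vertical_primitive_pderive// /graph -rV_ins_affine.
suff -> : phi (rV_ins j (gamma y + s * L) y) = 0 by rewrite sub0r mulrN mulNr.
have [yM|My] := leP `|y| M; last first.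
  by apply: phiM; exact: lt_le_trans (norm_rV_ins_y j _ y).
apply: phiM; apply: lt_le_trans (norm_rV_ins_t j _ y).
have := gG yM; rewrite ler_norml => /andP[g1 g2].
have h : M < L - G by rewrite ltrBrDr.
rewrite ltr_normr; apply/orP; case: s1 => E; rewrite E ?mul1r ?mulN1r; [left|right].
  by rewrite (lt_le_trans h)// addrC lerD2r.
by rewrite opprB (lt_le_trans h)// lerD2l lerN2.
Qed.

Let Kgraph0 i y : M < `|y| -> K (pderive i phi) (graph y) = 0.
Proof.
move=> My; rewrite vertical_primitive_ins.
rewrite (_ : (fun r => _) = cst 0) ?Rintegral_cst ?mul0r//.
by apply/funext => r; apply: pphiM; exact: lt_le_trans (norm_rV_ins_y j _ y).
Qed.

Let cgraph : continuous graph.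
Proof. by apply: rV_ins_continuous; exact: C1_continuous. Qed.

Lemma phi_graph0 y : M < `|y| -> phi (graph y) = 0.
Proof. by move=> My; apply: phiM; exact: lt_le_trans (norm_rV_ins_y j _ y). Qed.

Lemma local_divergence_vertical :
  \int[lebesgue_rV R m.+1]_x (char_domain D x * pderive j phi x) =
  \int[lebesgue_rV R m]_y (- s * phi (graph y)).
Proof.
by rewrite Rintegral_char_pderive; apply: eq_Rintegral => y _; exact: K_vertical.
Qed.

Lemma local_divergence_horizontal k :
  \int[lebesgue_rV R m.+1]_x (char_domain D x * pderive (lift j k) phi x) =
  \int[lebesgue_rV R m]_y (s * pderive k gamma y * phi (graph y)).
Proof.
rewrite Rintegral_char_pderive; set i := lift j k.
have [sphi _] := tphi.
have sK : smooth (K phi) by exact: smooth_vertical_primitive.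
have CK : C1 (K phi).
  move=> l; split; first by move=> x; exact: smooth_derivable.
  exact/smooth_continuous/smooth_pderive.
pose F y := K phi (graph y).
(* Moving y along e_k changes the height, which contributes - s phi times d_k gamma, and the
   coordinate [lift j k], which contributes the integrand sought. *)
pose F' y := - s * phi (graph y) * pderive k gamma y + K (pderive i phi) (graph y).
have dF y : is_derive y (delta_mx ord0 k) F (F' y).
  have [dgk _] := Cg k.
  have dv l : is_derive (0 : R) (1 : R) (fun h => graph (h *: delta_mx ord0 k + y) ord0 l)
      (if unlift j l is Some l' then (l' == k)%:R else pderive k gamma y).
    case: (unliftP j l) => [l' ->|->].
      under eq_fun do rewrite rV_ins_lift !mxE eqxx /=.
      have dM := is_deriveM (is_derive_id (0 : R) (1 : R)) (is_derive_cst ((l' == k)%:R : R) (0 : R) (1 : R)).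
      have dD : is_derive (0 : R) (1 : R) (fun t : R => t * (l' == k)%:R + y ord0 l') _ :=
        is_deriveD dM (is_derive_cst (y ord0 l') (0 : R) (1 : R)).
      by apply: (is_derive_eq dD); rewrite scaler0 add0r addr0 [_ *: 1]mulr1.
    under eq_fun do rewrite rV_ins_at.
    have := continuous_line (f := gamma) y dgk 0.
    by rewrite scale0r add0r.
  have H := C1_is_derive_curve CK dv.
  have {}H : is_derive y (delta_mx ord0 k) F
    (\sum_l (if unlift j l is Some l' then (l' == k)%:R else pderive k gamma y) *
       pderive l (K phi) (graph (0 *: delta_mx ord0 k + y))).
    by apply: (is_derive_congr _ H) => h; rewrite addr0 [h *: 1]mulr1.
  apply: (is_derive_eq H); rewrite scale0r add0r (bigD1_ord j)//= unlift_none.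
  rewrite (bigD1 k)//= liftK eqxx mul1r big1 ?addr0; last first.
    by move=> l /negPf lk; rewrite liftK lk mul0r.
  rewrite !pderive_vertical_primitive// K_vertical /F'.
  by rewrite [pderive k gamma y * _]mulrC.
have cF' : continuous F'.
  move=> y; have [_ cgk] := Cg k.
  apply: (@cvgD _ _ _ (nbhs y) _ (fun y => - s * phi (graph y) * pderive k gamma y)
    (fun y => K (pderive i phi) (graph y))).
    apply: (@cvgM _ _ (nbhs y) _ (fun y => - s * phi (graph y)) (pderive k gamma)).
      apply: (@cvgM _ _ (nbhs y) _ (cst (- s)) (fun y => phi (graph y))).
        exact: cvg_cst.
      exact: (continuous_comp (cgraph (x := y)) (smooth_continuous sphi (x := _))).
    exact: cgk.
  apply: (continuous_comp (cgraph (x := y))).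
  apply: smooth_continuous; apply: smooth_vertical_primitive.
  exact: test_function_pderive.
have FM y : M < `|y| -> F y = 0.
  move=> My; rewrite /F vertical_primitive_ins.
  rewrite (_ : (fun r => _) = cst 0) ?Rintegral_cst ?mul0r//.
  by apply/funext => r; apply: phiM; exact: lt_le_trans (norm_rV_ins_y j _ y).
have IF0 : \int[lebesgue_rV R m]_y F' y = 0 by exact: integral_pderive_eq0 dF cF' FM.
pose A y := s * pderive k gamma y * phi (graph y).
pose B y := K (pderive i phi) (graph y).
have cA : continuous A.
  move=> y; have [_ cgk] := Cg k.
  apply: (@cvgM _ _ (nbhs y) _ (fun y => s * pderive k gamma y) (fun y => phi (graph y))).
    by apply: (@cvgM _ _ (nbhs y) _ (cst s) (pderive k gamma)); [exact: cvg_cst|exact: cgk].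
  exact: (continuous_comp (cgraph (x := y)) (smooth_continuous sphi (x := _))).
have cB : continuous B.
  move=> y; apply: (continuous_comp (cgraph (x := y))).
  apply: smooth_continuous; apply: smooth_vertical_primitive.
  exact: test_function_pderive.
have AM y : M < `|y| -> A y = 0 by move=> My; rewrite /A phi_graph0// mulr0.
have BM y : M < `|y| -> B y = 0 by exact: Kgraph0.
have F'E : F' = (fun y => B y - A y).
  by apply/funext => y; rewrite /F' /A /B; ring.
move: IF0; rewrite F'E RintegralB//; last 2 first.
- exact: continuous_compact_support_integrable_rV BM.
- exact: continuous_compact_support_integrable_rV AM.
by move/eqP; rewrite subr_eq0 => /eqP.
Qed.

End local_divergence.

Lemma continuous_sum (R : realType) (T : topologicalType) (I : Type) (r : seq I)
    (F : I -> T -> R) :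
  (forall i, continuous (F i)) -> continuous (fun x => \sum_(i <- r) F i x).
Proof.
move=> cF; elim: r => [|i r IHr].
  have -> : (fun x => \sum_(i <- [::]) F i x) = cst 0 by apply/funext => x; rewrite big_nil.
  by move=> x; exact: cvg_cst.
have -> : (fun x => \sum_(k <- i :: r) F k x) = (fun x => F i x + \sum_(k <- r) F k x).
  by apply/funext => x; rewrite big_cons.
by move=> x; exact: (@cvgD _ _ _ (nbhs x) _ _ _ _ _ (cF i x) (IHr x)).
Qed.

(** * The surface integral in a chart *)

Section local_surface.
Context {R : realType} {m : nat}.
Variables (D : set 'rV[R]_m.+1) (j : 'I_m.+1) (b : bool) (gamma : 'rV[R]_m -> R).
Variables (O : set 'rV[R]_m.+1) (nu : 'rV[R]_m.+1 -> 'rV[R]_m.+1).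
Variable dS : {measure set 'rV[R]_m.+1 -> \bar R}.
Hypotheses (oD : open D) (oO : open O) (Cg : C1 gamma).
Let s : R := (-1) ^+ b.
Hypothesis DO : forall x, O x -> (D x <-> 0 < s * (x ord0 j - gamma (col' j x))).
Hypotheses (nuD : external_unit_normal D nu) (dSD : surface_measure (boundary D) dS).
Let graph y : 'rV[R]_m.+1 := rV_ins j (gamma y) y.
Let w y : R := Num.sqrt (1 + \sum_i pderive i gamma y ^+ 2).
Local Notation S := (boundary D).

Let dS_graph A : measurable A -> A `<=` O ->
  dS A = (\int[lebesgue_rV R m]_(y in graph @^-1` A) (w y)%:E)%E.
Proof.
move=> mA AO; have [_ /(_ j gamma O Cg oO _ A mA AO) -> //] := dSD.
exact: (boundary_graphP oD oO Cg DO).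
Qed.

Let cw : continuous w.
Proof.
have c1 : continuous (fun y => \sum_i pderive i gamma y ^+ 2).
  apply: (@continuous_sum R _ _ _ (fun i y => pderive i gamma y ^+ 2)) => i y.
  have [_ /(_ y) cgi] := Cg i.
  exact: (@cvgM _ _ (nbhs y) _ (pderive i gamma) (pderive i gamma) _ _ cgi cgi).
have c2 : continuous (fun y => 1 + \sum_i pderive i gamma y ^+ 2).
  move=> y; have := @cvgD _ _ _ (nbhs y) _ (cst (1 : R)) _ _ _ (@cvg_cst _ (1 : R) _ (nbhs y) _) (c1 y).
  exact.
by move=> y; exact: (continuous_comp (c2 y) (@sqrt_continuous R _)).
Qed.

Let mgraph : measurable_fun setT graph.
Proof.
apply: measurable_fun_rVP => i; apply: continuous_measurable_rV.
have cg : continuous graph by apply: rV_ins_continuous; exact: C1_continuous.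
by move=> y; exact: (continuous_comp (cg y) (@coord_continuous_row R m.+1 i _)).
Qed.

(** [surface_measure] does not state finiteness. In a chart it follows from the continuity of the
    density w, which is therefore bounded for |y| <= M. *)
Lemma surface_measure_local_finite M :
  (dS (O `&` [set x : 'rV[R]_m.+1 | `|x| <= M]%R) < +oo)%E.
Proof.
pose B k := [set x : 'rV[R]_k | `|x| <= M].
have mB k : measurable (B k) by apply: compact_measurable_rV; exact: norm_le_compact.
have mA : measurable (O `&` B m.+1) by apply: measurableI => //; exact: open_measurable_rV.
rewrite dS_graph//.
apply: (@le_lt_trans _ _ (\int[lebesgue_rV R m]_(y in B m) (w y)%:E)%E).
  apply: ge0_subset_integral => //.
  - by rewrite -[X in measurable X]setTI; exact: mgraph.
  - exact: mB.
  - by apply: measurable_funTS; apply/measurable_EFinP; exact: continuous_measurable_rV.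
  - by move=> y _; rewrite lee_fin sqrtr_ge0.
  - by move=> y [_ /= yM]; rewrite /B/= (le_trans (norm_rV_ins_y j (gamma y) y)).
have /integrableP[_] : (lebesgue_rV R m).-integrable (B m) (EFin \o w).
  apply: measurable_bounded_integrable => //.
  - exact: mB.
  - exact: lebesgue_rV_norm_le.
  - by apply: measurable_funTS; exact: continuous_measurable_rV.
  have := continuous_compact (continuous_subspaceT cw) (@norm_le_compact R m M).
  move=> /compact_bounded[C [Cr wC]]; exists C; split=> // C' CC' y yM.
  by apply: wC => //; exists y.
congr (_ < _)%E; apply: eq_integral => y _.
by rewrite /= ger0_norm// sqrtr_ge0.
Qed.

(** The i-th component of the normal at graph y times the area density: the square root cancels. *)
Definition conormal i y : R :=
  if unlift j i is Some k then s * pderive k gamma y else - s.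

Lemma surface_integral_local i (phi : 'rV[R]_m.+1 -> R) :
  measurable_fun S (fun x => nu x ord0 i) -> continuous phi ->
  (forall x, ~ O x -> phi x = 0) ->
  \int[dS]_(x in S) (nu x ord0 i * phi x) =
  \int[lebesgue_rV R m]_y (conormal i y * phi (graph y)).
Proof.
move=> mnu cphi phiO.
pose f x := nu x ord0 i * phi x.
have fO x : ~ O x -> f x = 0 by move=> /phiO; rewrite /f => ->; rewrite mulr0.
have mS : measurable S by exact: measurable_boundary.
have mO : measurable O by exact: open_measurable_rV.
have mf : measurable_fun S f.
  by apply: measurable_funM => //; apply: measurable_funTS; exact: continuous_measurable_rV.
(* Since phi vanishes off O, the integral moves from S to O with f extended by 0 off S; on O the
   formula for [dS] applies. *)
have H1 : (\int[dS]_(x in S) (f x)%:E = \int[dS]_(x in O) ((EFin \o f) \_ S) x)%E.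
  rewrite -integral_mkcondr setIC integral_mkcondr; apply: eq_integral => x _.
  rewrite patchE; case: ifPn => // /negP; rewrite inE => /fO.
  by rewrite /f => ->.
have mfS : measurable_fun O ((EFin \o f) \_ S).
  have mEf : measurable_fun S (EFin \o f) by exact/measurable_EFinP.
  by apply: measurable_funTS; exact: ((measurable_restrictT (EFin \o f) mS).1 mEf).
have w0 y : 0 <= w y by exact: sqrtr_ge0.
have mw : measurable_fun setT w by exact: continuous_measurable_rV.
have H2 := integral_density mgraph mw w0 mO dS_graph mfS.
rewrite /Rintegral H1 H2; congr fine.
rewrite integral_mkcond; apply: eq_integral => y _.
rewrite patchE; case: ifPn => [/set_mem Oy|/negP nOy]; last first.
  by rewrite phiO ?mulr0// => Oy; apply: nOy; rewrite inE.
rewrite patchE mem_set; last exact: (boundary_graph oD oO Cg DO).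
rewrite /= /f -EFinM; congr EFin; rewrite mulrAC; congr (_ * _).
rewrite /conormal; case: unliftP => [k ->|->].
  exact: (normal_horizontal oD oO Cg DO nuD Oy).
exact: (normal_vertical oD oO Cg DO nuD Oy).
Qed.

Lemma divergence_local i (phi : 'rV[R]_m.+1 -> R) :
  measurable_fun S (fun x => nu x ord0 i) -> test_function phi -> fsupp phi `<=` O ->
  \int[dS]_(x in S) (nu x ord0 i * phi x) =
  \int[lebesgue_rV R m.+1]_x (char_domain D x * pderive i phi x).
Proof.
move=> mnu tphi phiO; have [sphi _] := tphi.
have [M M0 phiM] := test_function_bound tphi.
rewrite surface_integral_local//; last 2 first.
- exact: smooth_continuous.
- by move=> x nOx; apply: fsupp0 => /phiO.
have cg := C1_continuous Cg.
have := continuous_compact (continuous_subspaceT cg) (@norm_le_compact R m M).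
move=> /compact_bounded[G [_ gG]].
have gG' y : `|y| <= M -> `|gamma y| <= `|G| + 1.
  by move=> yM; apply: gG; [rewrite ltr_pwDr// ler_norm|exists y].
have ML : M + (`|G| + 1) < M + (`|G| + 1) + 1 by rewrite ltrDl.
rewrite /conormal; case: unliftP => [k ->|->].
  by rewrite (local_divergence_horizontal oD oO Cg DO tphi phiM phiO (ltW M0) gG' ML).
by rewrite (local_divergence_vertical oD oO Cg DO tphi phiM phiO (ltW M0) gG' ML).
Qed.

End local_surface.

Lemma Rintegral_eq0 d (T : measurableType d) (R : realType)
    (mu : {measure set T -> \bar R}) (A : set T) (f : T -> R) :
  (forall x, A x -> f x = 0) -> \int[mu]_(x in A) f x = 0.
Proof.
by move=> f0; rewrite /Rintegral integral0_eq// => x /f0 ->.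
Qed.

(** * The divergence theorem *)

Section divergence.
Context {R : realType} {m : nat}.
Variables (D : set 'rV[R]_m.+1) (nu : 'rV[R]_m.+1 -> 'rV[R]_m.+1).
Variable dS : {measure set 'rV[R]_m.+1 -> \bar R}.
Hypotheses (bD : bounded_domain D) (nuD : external_unit_normal D nu).
Hypotheses (LD : lyapunov_boundary D nu) (dSD : surface_measure (boundary D) dS).
Local Notation S := (boundary D).

Let oD : open D. Proof. by have [] := bD. Qed.

Lemma boundary_chart x0 : S x0 -> exists (j : 'I_m.+1) (b : bool) (gamma : 'rV[R]_m -> R) O,
  [/\ C1 gamma, open O, O x0 &
    forall x, O x -> (D x <-> 0 < (-1) ^+ b * (x ord0 j - gamma (col' j x)))].
Proof.
have [CD _] := LD; move=> /CD [j [b [gamma [Cg nD]]]].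
exists j, b, gamma, (interior [set x | D x <-> 0 < (-1) ^+ b * (x ord0 j - gamma (col' j x))]).
split=> //; first exact: open_interior.
by move=> x /interior_subset.
Qed.

Lemma closed_boundary : closed S.
Proof. by apply: closedI; [exact: closed_closure|exact/open_closedC/open_interior]. Qed.

Lemma bounded_domain_norm : exists2 M, 0 < M & forall x, closure D x -> `|x| <= M.
Proof.
have [_ _ [M0 [_ DM]] _] := bD; exists (`|M0| + 1); first by rewrite ltr_wpDl.
have cB : closed [set x : 'rV[R]_m.+1 | `|x| <= `|M0| + 1].
  by apply: compact_closed; [exact: norm_hausdorff|exact: norm_le_compact].
have /closureS : D `<=` [set x : 'rV[R]_m.+1 | `|x| <= `|M0| + 1].
  by move=> y Dy; apply: DM => //; rewrite ltr_pwDr// ler_norm.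
by rewrite -((closure_id _).1 cB).
Qed.

Lemma compact_boundary : compact S.
Proof.
have [M _ DM] := bounded_domain_norm.
apply: (@subclosed_compact _ _ [set x : 'rV[R]_m.+1 | `|x| <= M]).
- exact: closed_boundary.
- exact: norm_le_compact.
- by move=> x [/DM].
Qed.

(** Finitely many charts cover S. A chart may be unbounded, so it is cut by a ball that contains the
    closure of D. *)
Lemma surface_measure_finite : (dS S < +oo)%E.
Proof.
have [M _ DM] := bounded_domain_norm.
pose B := [set x : 'rV[R]_m.+1 | `|x| <= M].
have mB : measurable B by apply: compact_measurable_rV; exact: norm_le_compact.
have /choice[V VP] : forall x0, exists O : set 'rV[R]_m.+1,
    S x0 -> [/\ open O, O x0 & (dS (O `&` B) < +oo)%E].
  move=> x0; have [Sx|nS] := pselect (S x0); last by exists setT.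
  have [j [b [gamma [V [Cg oV Vx DV]]]]] := boundary_chart Sx.
  by exists V => _; split=> //; exact: (surface_measure_local_finite oD oV Cg DV dSD).
have := compact_boundary; rewrite compact_cover.
move=> /(_ _ S V)[|x Sx|l lS Sl]; first by move=> x /VP[].
  by exists x => //; have [] := VP x Sx.
have fin (r : seq 'rV[R]_m.+1) : {subset r <= S} ->
    measurable (\big[setU/set0]_(x <- r) (V x `&` B)) /\
    (dS (\big[setU/set0]_(x <- r) (V x `&` B)) < +oo)%E.
  elim: r => [|x r IHr] rS; first by rewrite big_nil measure0.
  have [|mr finr] := IHr; first by move=> y yr; apply: rS; rewrite inE yr orbT.
  have /set_mem/VP[oO _ finO] := rS x (mem_head _ _).
  have mO : measurable (V x `&` B) by apply: measurableI => //; exact: open_measurable_rV.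
  rewrite big_cons; split; first exact: measurableU.
  by apply: le_lt_trans (measureU2 _ mO mr) _; exact: lte_add_pinfty.
have [ml finl] := fin (finmap.enum_fset l) lS.
apply: le_lt_trans finl; apply: le_measure; rewrite ?inE//; first exact: measurable_boundary.
move=> x Sx; have [y yl Oxy] := Sl x Sx.
rewrite -bigcup_seq; exists y => //; split=> //.
by case: Sx => /DM.
Qed.

Lemma coord_le_enorm p (v : 'rV[R]_p) i : `|v ord0 i| <= enorm v.
Proof.
rewrite -sqrtr_sqr ler_wsqrtr// (bigD1 i)//= lerDl sumr_ge0// => k _.
exact: sqr_ge0.
Qed.

(** The normal is constrained on S only; there the Lyapunov condition makes it Hoelder
    continuous. *)
Lemma measurable_normal i : measurable_fun S (fun x => nu x ord0 i).
Proof.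
apply: continuous_within_measurable_rV; first exact: measurable_boundary.
apply/subspace_continuousP => x Sx.
have [_ [C [a [a0 a1 H]]]] := LD.
apply/(@cvgrPdist_le _ _ _ (within S (nbhs x))) => e e0.
(* Solution of (|C| + 1) d^a = e; nothing is known of the sign of C. *)
pose d := (e / (`|C| + 1)) `^ a^-1.
have C0 : 0 < `|C| + 1 by rewrite ltr_wpDl.
have d0 : 0 < d by rewrite powR_gt0// divr_gt0.
have K0 : 0 < d / m.+2%:R by rewrite divr_gt0.
rewrite near_withinE; near=> y => Sy.
have xy : enorm (x - y) <= d.
  apply: le_trans (enorm_le_sum _) _.
  apply: (@le_trans _ _ (\sum_(k < m.+1) d / m.+2%:R)).
    apply: ler_sum => k _; apply: le_trans (coord_le_norm _ _) _.
    by near: y; apply: (@cvgr_dist_le _ _ _ (nbhs x)); [exact: cvg_id|].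
  rewrite sumr_const card_ord -[leLHS]mulr_natr mulrAC ler_pdivrMr// ler_pM2l//.
  by rewrite ler_nat.
have := coord_le_enorm (nu x - nu y) i; rewrite !mxE => /le_trans; apply.
apply: le_trans (H _ _ Sx Sy) _.
apply: (@le_trans _ _ (`|C| * (e / (`|C| + 1)))); last first.
  by rewrite mulrA ler_pdivrMr// mulrC ler_pM2l// lerDl.
apply: (@le_trans _ _ (`|C| * enorm (x - y) `^ a)).
  by rewrite ler_wpM2r ?powR_ge0// ler_norm.
rewrite ler_wpM2l//.
have -> : e / (`|C| + 1) = d `^ a.
  by rewrite /d -powRrM mulVf ?gt_eqF// powRr1// divr_ge0// ltW.
by apply: ge0_ler_powR => //; rewrite ?nnegrE ?(ltW a0)// ?(ltW d0)//; exact: sqrtr_ge0.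
Unshelve. all: by end_near. Qed.

Lemma surface_integrable i (f : 'rV[R]_m.+1 -> R) C : continuous f ->
  (forall x, `|f x| <= C) -> dS.-integrable S (fun x => (nu x ord0 i * f x)%:E).
Proof.
move=> cf fC; apply: (@measurable_bounded_integrable _ _ _ _ (fun x => nu x ord0 i * f x)).
- exact: measurable_boundary.
- exact: surface_measure_finite.
- apply: measurable_funM; first exact: measurable_normal.
  by apply: measurable_funTS; exact: continuous_measurable_rV.
- exists C; split; first exact: num_real.
  move=> C' /ltW CC' x Sx /=; rewrite normrM (le_trans _ CC')//.
  rewrite (le_trans _ (fC x))// ler_piMl//.
  by have [<- _ _] := nuD Sx; exact: coord_le_enorm.
Qed.

Lemma char_integrable (f : 'rV[R]_m.+1 -> R) : test_function f ->
  (lebesgue_rV R m.+1).-integrable setT (fun x => (char_domain D x * f x)%:E).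
Proof.
move=> tf; have [M _ fM] := test_function_bound tf; have [/smooth_continuous cf _] := tf.
have [C _ fC] := test_function_bounded [::] tf.
apply: (@bounded_support_integrable_rV _ _ (fun x => char_domain D x * f x) C M).
- apply: measurable_funM; first exact: measurable_char_domain.
  exact: continuous_measurable_rV.
- move=> x; rewrite normrM (le_trans _ (fC x))// ler_piMl//.
  exact: char_domain_bounded.
- by move=> x /fM ->; rewrite mulr0.
Qed.

Let gauss i (f : 'rV[R]_m.+1 -> R) : Prop :=
  \int[dS]_(x in S) (nu x ord0 i * f x) =
  \int[lebesgue_rV R m.+1]_x (char_domain D x * pderive i f x).

Lemma gaussD i f g : test_function f -> test_function g ->
  gauss i f -> gauss i g -> gauss i (fun x => f x + g x).
Proof.
move=> tf tg; rewrite /gauss => Gf Gg; have [sf _] := tf; have [sg _] := tg.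
have [C _ fC] := test_function_bounded [::] tf.
have [C' _ gC] := test_function_bounded [::] tg.
have If := surface_integrable i (smooth_continuous sf) fC.
have Ig := surface_integrable i (smooth_continuous sg) gC.
have If' := char_integrable (test_function_pderive i tf).
have Ig' := char_integrable (test_function_pderive i tg).
have e1 x : x \in S -> nu x ord0 i * (f x + g x) = nu x ord0 i * f x + nu x ord0 i * g x.
  by rewrite mulrDr.
rewrite (eq_Rintegral _ e1) (@RintegralD _ _ _ dS S _ _ (measurable_boundary D) If Ig).
rewrite Gf Gg -(@RintegralD _ _ _ (lebesgue_rV R m.+1) setT _ _ measurableT If' Ig').
by apply: eq_Rintegral => x _; rewrite pderiveD// mulrDr.
Qed.

(** Near a point of D the volume integral is that of a derivative with compact support, and away
    from the closure of D both sides are 0; only boundary points need a chart. Beyond 2 r the bump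
    of radius r at x0 vanishes, which is why the support condition has this form. *)
Lemma gauss_locally x0 : exists2 r, 0 < r & forall i f, test_function f ->
  (forall x, 2 * r < `|x - x0| -> f x = 0) -> gauss i f.
Proof.
have intD : interior D = D by exact/interior_id.
suff [V nV VG] : exists2 V, nbhs x0 V & forall i f, test_function f ->
    fsupp f `<=` V -> gauss i f.
  have [e /= e0 eV] := (nbhs_ballP _ _).1 nV.
  (* The support then stays within e / 2 of x0, well inside the ball of radius e. *)
  exists (e / 4) => [|i f tf fe]; first by rewrite divr_gt0.
  apply: VG => // x xf; apply: eV; rewrite -ball_normE /= distrC.
  apply: contrapT => /negP; rewrite -leNgt => ex; move: xf.
  have ne : \forall y \near x, 2 * (e / 4) < `|y - x0|.
    apply: (@cvgr_gt _ _ (nbhs x) _ (fun y => `|y - x0|) `|x - x0|).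
      by apply: cvg_norm; apply: cvgB; [exact: cvg_id|exact: cvg_cst].
    by apply: lt_le_trans ex; lra.
  by move=> /(_ _ ne)[y [/= /eqP fy /fe]].
have bnd0 (i : 'I_m.+1) (f : 'rV[R]_m.+1 -> R) : (forall x, S x -> f x = 0) ->
    \int[dS]_(x in S) (nu x ord0 i * f x) = 0.
  by move=> f0; apply: Rintegral_eq0 => x /f0 ->; rewrite mulr0.
have [Dx|nDx] := pselect (D x0).
  exists D => [|i f tf fD]; first exact: open_nbhs_nbhs.
  have [M _ fM] := test_function_bound tf; have [sf _] := tf.
  rewrite /gauss bnd0; last by move=> x [_]; rewrite intD => nD; apply: fsupp0 => /fD.
  have cpf := smooth_continuous (smooth_pderive i sf).
  have <- := integral_pderive_eq0 (fun x => smooth_is_derive i x sf) cpf fM.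
  apply: eq_Rintegral => x _; have [xD|nD] := pselect (D x).
    by rewrite /char_domain mem_set// mul1r.
  by rewrite pderive0 ?mulr0// => /fD.
have [cDx|ncDx] := pselect (closure D x0); last first.
  exists (~` closure D) => [|i f tf fD].
    by apply: open_nbhs_nbhs; split=> //; exact/closed_openC/closed_closure.
  rewrite /gauss bnd0; last by move=> x [cDx _]; apply: fsupp0 => /fD.
  rewrite Rintegral_eq0// => x _; have [cDx|nD] := pselect (closure D x).
    by rewrite pderive0 ?mulr0// => /fD.
  rewrite /char_domain memNset; last by move=> /subset_closure.
  by rewrite memNset ?mul0r// => -[].
have Sx : S x0 by split=> //; rewrite intD.
have [j [b [gamma [V [Cg oV Vx DV]]]]] := boundary_chart Sx.
exists V => [|i f tf fV]; first exact: open_nbhs_nbhs.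
apply: (divergence_local oD oV Cg DV nuD dSD _ tf fV); exact: measurable_normal.
Qed.

Theorem divergence_theorem i f : test_function f ->
  \int[dS]_(x in S) (nu x ord0 i * f x) =
  \int[lebesgue_rV R m.+1]_x (char_domain D x * pderive i f x).
Proof.
move=> tf; have /choice[r rP] : forall x0, exists r, 0 < r /\ forall i f, test_function f ->
    (forall x, 2 * r < `|x - x0| -> f x = 0) -> gauss i f.
  by move=> x0; have [r r0 rG] := gauss_locally x0; exists r.
have [_] := tf; rewrite compact_cover.
move=> /(_ _ setT (fun x => ball x (r x)))[|x _|l _ fl].
- by move=> x _; apply: ball_open; have [] := rP x.
- by exists x => //; apply: ballxx; have [] := rP x.
have : forall x, f x != 0 -> exists2 a, a \in finmap.enum_fset l & `|x - a| <= r a.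
  move=> x fx; have [|a al] := fl x; first exact: subset_closure.
  by rewrite -ball_normE /= distrC => /ltW; exists a.
elim: (finmap.enum_fset l) f tf {fl} => [|a s IHs] f tf fl.
  have f0 : f = cst 0.
    by apply/funext => x; apply/eqP; apply: contrapT => /negP /fl[].
  rewrite !Rintegral_eq0// => x _; last by rewrite f0 mulr0.
  by rewrite pderive0 ?mulr0// f0 /fsupp => /(_ setT filterT)[y []] /=; rewrite eqxx.
have [ra rG] := rP a.
have [sf _] := tf; have sb := smooth_box_bump a (r a).
have tg := test_functionM tf sb.
have th : test_function (fun x => f x * (1 - box_bump a (r a) x)).
  exact: (test_functionM tf (smoothB (smooth_cst 1) sb)).
(* This replaces a normalised partition of unity: the first summand lives near a, and the second
   vanishes where the bump is 1, so its nonzero points are covered by the remaining balls. *)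
have -> : f = (fun x => f x * box_bump a (r a) x + f x * (1 - box_bump a (r a) x)).
  by apply/funext => x; ring.
apply: (gaussD tg th).
  by apply: rG => // x xa; rewrite box_bump0// mulr0.
apply: IHs => // x; rewrite mulf_eq0 negb_or => /andP[/fl[b + xb] ba].
rewrite inE => /orP[/eqP ab|]; last by exists b.
by move: ba; rewrite ab in xb *; rewrite box_bump1 ?subrr ?eqxx//.
Qed.

End divergence.

(** * Convolutions *)

Section row_blocks.
Context {R : realType} {m n : nat}.

Lemma row_mx_norm_le (x : 'rV[R]_m) (y : 'rV[R]_n) r : 0 <= r -> `|x| <= r -> `|y| <= r ->
  `|row_mx x y| <= r.
Proof.
move=> r0 xr yr; apply: rV_norm_le => // i; case: (split_ordP i) => k ->.
  by rewrite row_mxEl (le_trans (coord_le_norm _ _)).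
by rewrite row_mxEr (le_trans (coord_le_norm _ _)).
Qed.

Lemma norm_row_mxl (x : 'rV[R]_m) (y : 'rV[R]_n) : `|x| <= `|row_mx x y|.
Proof.
by apply: rV_norm_le => // i; rewrite -(row_mxEl x y) coord_le_norm.
Qed.

Lemma norm_row_mxr (x : 'rV[R]_m) (y : 'rV[R]_n) : `|y| <= `|row_mx x y|.
Proof.
by apply: rV_norm_le => // i; rewrite -(row_mxEr x y) coord_le_norm.
Qed.

Lemma row_mx_left_continuous (y : 'rV[R]_n) : continuous (fun x : 'rV[R]_m => row_mx x y).
Proof.
apply: continuous_row_by_coord => i; case: (split_ordP i) => k ->.
  by under eq_fun do rewrite row_mxEl; exact: coord_continuous_row.
by under eq_fun do rewrite row_mxEr; exact: cst_continuous.
Qed.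

Lemma measurable_row_mxl (y : 'rV[R]_n) : measurable_fun setT (fun x : 'rV[R]_m => row_mx x y).
Proof.
apply: measurable_fun_rVP => i; case: (split_ordP i) => k ->.
  by under eq_fun do rewrite row_mxEl; exact: measurable_rV_coord.
by under eq_fun do rewrite row_mxEr; exact: measurable_cst.
Qed.

Lemma measurable_row_mxr (x : 'rV[R]_m) : measurable_fun setT (fun y : 'rV[R]_n => row_mx x y).
Proof.
apply: measurable_fun_rVP => i; case: (split_ordP i) => k ->.
  by under eq_fun do rewrite row_mxEl; exact: measurable_cst.
by under eq_fun do rewrite row_mxEr; exact: measurable_rV_coord.
Qed.

Lemma row_mxl_affine z (y : 'rV[R]_n) :
  coord_affine (fun=> 1) (lshift n) (fun x : 'rV[R]_m => z + row_mx x y).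
Proof.
move=> x i h; rewrite scale1r addrCA; congr (_ + _); apply/rowP => k.
case: (split_ordP k) => l ->; rewrite [RHS]mxE ?row_mxEl ?row_mxEr !mxE.
  by rewrite (inj_eq (@lshift_inj _ _)).
by rewrite eq_rlshift andbF mulr0 add0r.
Qed.

Lemma smooth_row_mxl (f : 'rV[R]_(m + n) -> R) z y : smooth f ->
  smooth (fun x : 'rV[R]_m => f (z + row_mx x y)).
Proof.
apply: (@smooth_comp_affine _ m (m + n) (fun=> 1) (lshift n) (fun x => z + row_mx x y)).
  move=> x; rewrite (_ : (fun _ => _) = (fun w => w + z) \o (fun x => row_mx x y)); last first.
    by apply/funext => w /=; rewrite addrC.
  exact: (continuous_comp (@row_mx_left_continuous y x) (@addr_right_continuous _ _ z _)).
exact: row_mxl_affine.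
Qed.

Lemma pderive_row_mxl (f : 'rV[R]_(m + n) -> R) z y i : smooth f ->
  pderive i (fun x : 'rV[R]_m => f (z + row_mx x y)) =
  fun x => pderive (lshift n i) f (z + row_mx x y).
Proof.
move=> sf; rewrite (pderive_comp_affine i (row_mxl_affine z y) sf).
by apply/funext => x; rewrite mul1r.
Qed.

Lemma test_function_row_mxl (f : 'rV[R]_(m + n) -> R) z y : test_function f ->
  test_function (fun x : 'rV[R]_m => f (z + row_mx x y)).
Proof.
move=> tf; have [sf _] := tf; split; first exact: smooth_row_mxl.
have [M _ fM] := test_function_bound tf.
apply: (@compact_fsupp _ _ _ (M + `|z|)) => x Mx; apply: fM.
rewrite addrC (lt_le_trans _ (lerB_normD _ _))// ltrBrDr (lt_le_trans Mx)//.
exact: norm_row_mxl.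
Qed.

End row_blocks.

Section convolution.
Context {R : realType}.

Lemma conv_distrE n (S T : functional R n) f l :
  (forall eta, unit_sequence eta ->
    tensor_distr S T (fun z => eta k z * f (lsubmx z + rsubmx z)) @[k --> \oo] --> l) ->
  conv_distr S T f = l.
Proof.
move=> H; rewrite /conv_distr; case: xgetP => [l' _ /= Hl'|/(_ l)//].
have [eta ue] := unit_sequence_exists R (n + n).
by apply: (cvg_unique _ (Hl' eta ue) (H eta ue)); exact: norm_hausdorff.
Qed.

Lemma smooth_sum_halves n (f : 'rV[R]_n -> R) : smooth f ->
  smooth (fun z : 'rV[R]_(n + n) => f (lsubmx z + rsubmx z)).
Proof.
pose k (i : 'I_(n + n)) := match fintype.split i with inl j => j | inr j => j end.
apply: (@smooth_comp_affine _ (n + n) n (fun=> 1) k).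
  move=> z; apply: (@cvgD _ _ _ (nbhs z) _ lsubmx rsubmx).
  - suff : continuous (@lsubmx R 1 n n) by exact.
    apply: continuous_row_by_coord => i.
    by under eq_fun do rewrite mxE; exact: coord_continuous_row.
  - suff : continuous (@rsubmx R 1 n n) by exact.
    apply: continuous_row_by_coord => i.
    by under eq_fun do rewrite mxE; exact: coord_continuous_row.
move=> z i h; apply/rowP => j; rewrite scale1r !mxE /k.
case: (split_ordP i) => l ->.
  rewrite eq_rlshift (inj_eq (@lshift_inj _ _)) andbF.
  by rewrite mulr0 add0r addrA.
rewrite eq_lrshift (inj_eq (@rshift_inj _ _)) andbF.
by rewrite mulr0 add0r addrCA.
Qed.

Context {N : nat}.

(** Compact support of T is expressed as locality, because a functional here acts on arbitrary
    functions. If |z + (y, 0)| <= M and |y| <= A then |z| <= M + A, so eta is 1 at the relevant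
    points from some k on. *)
Lemma conv_xE (V : functional R (N + 1)) (T : functional R N) (K : set 'rV[R]_N) f :
  test_function f -> compact K ->
  (forall g h, (forall y, K y -> g y = h y) -> T g = T h) ->
  conv_x V T f = V (fun z => T (fun y => f (z + row_mx y 0))).
Proof.
move=> tf /compact_norm_le[A A0 KA] locT; have [M M0 fM] := test_function_bound tf.
apply: conv_distrE => eta [_ eta1 _]; apply: cvg_near_cst.
have := eta1 _ (@norm_le_compact R _ (M + A)); apply: filterS => k etak.
rewrite /tensor_distr /delta_distr; congr V; apply/funext => z; apply: locT => y Ky.
rewrite row_mxKl row_mxKr; have [zM|/fM ->] := leP `|z + row_mx y 0| M; last by rewrite mulr0.
have yA : `|row_mx y (0 : 'rV[R]_1)| <= A.
  by apply: row_mx_norm_le; rewrite ?normr0 ?(ltW A0)//; exact: KA.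
rewrite etak ?mul1r//=; apply: row_mx_norm_le.
- by rewrite addr_ge0 ?ltW.
- by rewrite -[z](addrK (row_mx y 0)) (le_trans (ler_normB _ _))// lerD.
- by rewrite (le_trans yA)// lerDr ltW.
Qed.

Lemma heaviside_bounded t : `|@heaviside R t| <= 1.
Proof.
rewrite /heaviside; case: ifP => _; first by rewrite normr0.
by case: ifP => _; rewrite ger0_norm// invf_le1// ler1n.
Qed.

Lemma measurable_heaviside : measurable_fun setT (@heaviside R).
Proof.
have -> : @heaviside R = fun t => \1_(`]0, +oo[%classic) t + 2^-1 * \1_[set 0] t.
  apply/funext => t; rewrite /heaviside !indicE mem_setE in_itv/= andbT in_set1.
  by case: ltgtP => //=; rewrite ?mulr1 ?mulr0 ?add0r ?addr0.
apply: measurable_funD; first exact: measurable_indic.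
by apply: measurable_funM => //; apply: measurable_indic.
Qed.

(** The cut makes H integrable, as a weight of [param_integral] must be. With this weight
    [time_average T] is the operator Q. *)
Definition heaviside_upto (T : R) (b : 'rV[R]_1) : R :=
  heaviside (b ord0 ord0) * \1_[set b : 'rV[R]_1 | `|b| <= T] b.

Lemma heaviside_upto_bounded T b : `|heaviside_upto T b| <= 1.
Proof.
rewrite /heaviside_upto normrM mulr_ile1 ?heaviside_bounded//.
by rewrite indicE; case: (_ \in _); rewrite ?normr1 ?normr0.
Qed.

Lemma measurable_heaviside_upto T : measurable_fun setT (heaviside_upto T).
Proof.
apply: measurable_funM.
  by apply: (measurableT_comp measurable_heaviside); exact: measurable_rV_coord.
by apply: measurable_indic; apply: compact_measurable_rV; exact: norm_le_compact.
Qed.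

Lemma heaviside_upto_integrable T :
  (lebesgue_rV R 1).-integrable setT (EFin \o heaviside_upto T).
Proof.
apply: (bounded_support_integrable_rV (measurable_heaviside_upto T) (heaviside_upto_bounded T) (M := T)).
by move=> b Tb; rewrite /heaviside_upto indicE memNset ?mulr0//= leNgt Tb.
Qed.

Definition time_average T : ('rV[R]_(N + 1) -> R) -> 'rV[R]_(N + 1) -> R :=
  param_integral (lebesgue_rV R 1) setT (heaviside_upto T) (fun b => row_mx 0 b).

Lemma test_function_time_average T h : test_function h -> test_function (time_average T h).
Proof.
move=> th; have [sh _] := th; split.
  apply: param_integral_smooth => //; first exact: heaviside_upto_integrable.
    exact: measurable_row_mxr.
  exact: test_function_bounded_derivatives.
have [M M0 hM] := test_function_bound th.
apply: (@compact_fsupp _ _ _ (M + T)) => x Mx; apply: Rintegral_eq0 => b _.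
rewrite /heaviside_upto indicE; case: (boolP (b \in _)); last by rewrite mulr0 mul0r.
rewrite inE /= => bT; rewrite hM ?mulr0// (lt_le_trans _ (lerB_normD _ _))// ltrBrDr.
rewrite (le_lt_trans _ Mx)// lerD2l; apply: row_mx_norm_le => //; first exact: le_trans bT.
by rewrite normr0 (le_trans _ bT).
Qed.

Lemma pderive_time_average T h i : test_function h ->
  pderive i (time_average T h) = time_average T (pderive i h).
Proof.
move=> th; have [sh _] := th; apply: pderive_param_integral => //.
- exact: heaviside_upto_integrable.
- exact: measurable_row_mxr.
- exact: test_function_bounded_derivatives.
Qed.

Lemma time_part_row_mx (y : 'rV[R]_N) (b : 'rV[R]_1) : time_part (row_mx y b) = b ord0 ord0.
Proof. exact: row_mxEr. Qed.

Lemma time_part_add (x z : 'rV[R]_(N + 1)) : time_part (x + z) = time_part x + time_part z.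
Proof. exact: mxE. Qed.

Lemma time_part_continuous : continuous (@time_part R N).
Proof. exact: coord_continuous_row. Qed.

(** The set where f and g differ lies in t <= -1, and so does its closure, which is thus inside the
    open half-space where U vanishes. *)
Lemma eq_from_time (U : functional R (N + 1)) f g : is_distribution U ->
  vanishes_on U [set z | time_part z < 0] -> test_function f -> test_function g ->
  (forall x, -1 < time_part x -> f x = g x) -> U f = U g.
Proof.
move=> [Ulin _] Uvan tf tg fg.
pose d x := -1 * g x + f x.
have td : test_function d by exact: test_functionZD.
have d0 : U d = 0.
  apply: Uvan => // x xd; apply: contrapT => /negP /=; rewrite -leNgt => tx.
  have ne : \forall y \near x, -1 < time_part y.
    apply: (@cvgr_gt _ _ (nbhs x) _ (@time_part R N) (time_part x)).
      exact: time_part_continuous.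
    exact: lt_le_trans tx.
  by have [y [/= /eqP dy /fg e]] := xd _ ne; apply: dy; rewrite /d e mulN1r addrC subrr.
have -> : f = (fun x => 1 * d x + g x).
  by apply/funext => x; rewrite /d; ring.
by rewrite Ulin// d0 mulr0 add0r.
Qed.

(** This makes [eq_from_time] applicable to the terms of Vladimirov's sequence. As theta vanishes
    beyond L, cutting H there does not change the integral, which becomes a [param_integral] in
    twice as many variables restricted to rows (x, 0). *)
Lemma test_function_heaviside_slice (theta : 'rV[R]_((N + 1) + (N + 1)) -> R) :
  test_function theta ->
  test_function (fun x => \int[lebesgue_rV R 1]_b
    (heaviside (b ord0 ord0) * theta (row_mx x (row_mx 0 b)))).
Proof.
move=> tth; have [sth _] := tth; have [L L0 thL] := test_function_bound tth.
split; last first.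
  apply: (@compact_fsupp _ _ _ L) => x Lx; apply: Rintegral_eq0 => b _.
  by rewrite thL ?mulr0// (lt_le_trans Lx)// norm_row_mxl.
pose F := param_integral (lebesgue_rV R 1) setT (heaviside_upto L)
  (fun b => row_mx (0 : 'rV[R]_(N + 1)) (row_mx (0 : 'rV[R]_N) b)) theta.
have sF : smooth F.
  apply: param_integral_smooth => //; first exact: heaviside_upto_integrable.
    exact: (measurableT_comp (@measurable_row_mxr R _ _ 0) (@measurable_row_mxr R _ _ 0)).
  exact: test_function_bounded_derivatives.
have := smooth_row_mxl 0 0 sF; congr (smooth _); apply/funext => x.
apply: eq_Rintegral => b _; rewrite add0r add_row_mx addr0 add0r.
rewrite /heaviside_upto indicE; case: (boolP (b \in _)); first by rewrite mulr1.
move=> /negP; rewrite inE /= => /negP; rewrite -ltNge => Lb.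
rewrite mulr0 mul0r thL ?mulr0// (lt_le_trans Lb)//.
exact: le_trans (norm_row_mxr 0 b) (norm_row_mxr _ _).
Qed.

(** Compactness comes from the two half-lines of time: if x has time above -1, b >= 0 and x + (0, b)
    lies in the ball of radius M, then b and |x| are at most M + 1 <= T, where eta is eventually 1.
    Times up to -1 do not matter under U. *)
Lemma time_primitiveE (U : functional R (N + 1)) h M T : is_distribution U ->
  vanishes_on U [set z | time_part z < 0] -> test_function h ->
  (forall x, M < `|x| -> h x = 0) -> M + 1 <= T ->
  time_primitive U h = U (time_average T h).
Proof.
move=> dU Uvan th hM MT; apply: conv_distrE => eta [teta eta1 _]; apply: cvg_near_cst.
have := eta1 _ (@norm_le_compact R _ T); apply: filterS => k etak.
pose theta z := eta k z * h (lsubmx z + rsubmx z).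
have tth : test_function theta.
  by apply: test_functionM (teta k) _; apply: smooth_sum_halves; case: th.
apply: (eq_from_time dU Uvan).
- exact: test_function_heaviside_slice tth.
- exact: test_function_time_average.
move=> x xt; apply: eq_Rintegral => b _; rewrite row_mxKl row_mxKr /heaviside_upto.
have [b0|b0] := ltP (b ord0 ord0) 0; first by rewrite /heaviside b0 !mul0r.
have [xbM|/hM ->] := leP `|x + row_mx 0 b| M; last by rewrite !mulr0.
have M0 : 0 <= M by apply: le_trans xbM.
have tM : `|time_part x + b ord0 ord0| <= M.
  have := coord_le_norm (x + row_mx 0 b) (time_index : 'I_(N + 1)).
  rewrite -/(time_part _) time_part_add time_part_row_mx => /le_trans; exact.
have bT : `|b| <= T.
  apply: rV_norm_le => [|i]; first by rewrite (le_trans _ MT)// addr_ge0.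
  by rewrite !ord1; move: tM; rewrite !ler_norml => /andP[_ tM]; lra.
have xT : `|x| <= T.
  apply: rV_norm_le => [|i]; first by rewrite (le_trans _ MT)// addr_ge0.
  case: (split_ordP i) => j ->.
    have := le_trans (coord_le_norm _ (lshift 1 j)) xbM.
    by rewrite mxE row_mxEl mxE addr0 => /le_trans; apply; lra.
  rewrite [j]ord1 -/(time_part x).
  by move: tM; rewrite !ler_norml => /andP[_ tM]; apply/andP; split; lra.
have T0 : 0 <= T by apply: le_trans bT.
rewrite etak /=; last first.
  by apply: row_mx_norm_le => //; apply: row_mx_norm_le; rewrite ?normr0.
by rewrite mul1r indicE mem_set// mulr1.
Qed.

(** By the fundamental theorem of calculus; the upper end contributes 0, since a time above -1 plus
    T exceeds M. *)
Lemma time_average_pderive_time h M T x : test_function h ->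
  (forall x, M < `|x| -> h x = 0) -> M + 1 <= T -> -1 < time_part x ->
  time_average T (pderive (time_index : 'I_(N + 1)) h) x = - h x.
Proof.
move=> th hM MT xt; have [sh _] := th.
set h' := pderive _ h; have ch' : continuous h' by apply/smooth_continuous/smooth_pderive.
have h'M z : M < `|z| -> h' z = 0 by exact: pderive_norm0.
pose p (t : R) : 'rV[R]_1 := rV_ins ord0 t 0.
pose f b := heaviside_upto T b * h' (x + row_mx 0 b).
have pE t i : p t ord0 i = t.
  by rewrite (_ : i = ord0) ?rV_ins_at//; apply/val_inj; case: i => -[].
have [C _ h'C] := test_function_bounded [::] (test_function_pderive time_index th).
have cs : continuous (fun b : 'rV[R]_1 => h' (x + row_mx 0 b)).
  have ca : continuous (fun b : 'rV[R]_1 => x + row_mx 0 b).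
    apply: continuous_row_by_coord => i; case: (split_ordP i) => k ->.
      by under eq_fun do rewrite mxE row_mxEl mxE; exact: cst_continuous.
    under eq_fun do rewrite mxE row_mxEr.
    by move=> b; apply: (@cvgD _ _ _ (nbhs b) _ (cst _)); [exact: cvg_cst|exact: coord_continuous_row].
  by move=> b; exact: (continuous_comp (ca b) (ch' _)).
have mf : measurable_fun setT f.
  apply: measurable_funM; first exact: measurable_heaviside_upto.
  exact: continuous_measurable_rV.
have fC b : `|f b| <= C.
  by rewrite normrM (le_trans _ (h'C (x + row_mx 0 b)))// ler_piMl// heaviside_upto_bounded.
have fT b : T < `|b| -> f b = 0.
  by move=> Tb; rewrite /f /heaviside_upto indicE memNset ?mulr0 ?mul0r//= leNgt Tb.
rewrite /time_average /param_integral -/f (Rintegral_rV_ins ord0 mf fC fT).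
have -> : (fun y => \int[@lebesgue_measure R]_t f (rV_ins ord0 t y)) =
    cst (\int[@lebesgue_measure R]_t f (p t)).
  by apply/funext => y; rewrite (thinmx0 y).
(* The integral over R^1 is sliced into R and R^0, and R^0 has mass 1. *)
have l0 : fine (lebesgue_rV R 0 setT) = 1 by exact: (congr1 fine (@diracT _ _ R (0 : 'rV[R]_0))).
rewrite (_ : \int[lebesgue_rV R 0]_y _ = \int[@lebesgue_measure R]_t f (p t)); last first.
  by have := @Rintegral_cst _ _ _ (lebesgue_rV R 0) setT measurableT
    (\int[@lebesgue_measure R]_t f (p t)); rewrite l0 mulr1.
have cp : continuous p.
  by apply: continuous_row_by_coord => i; under eq_fun do rewrite pE; move=> ?.
have ch : continuous (fun t => h' (x + row_mx 0 (p t))).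
  by move=> t; exact: (continuous_comp (cp t) (cs _)).
have far (g : 'rV[R]_(N + 1) -> R) : (forall z, M < `|z| -> g z = 0) ->
    forall t, `|M| + `|x| < `|t| -> g (x + row_mx 0 (p t)) = 0.
  move=> gM t tM; apply: gM; rewrite addrC (lt_le_trans _ (lerB_normD _ _))// ltrBrDr.
  rewrite (le_lt_trans _ (lt_le_trans tM _))//; first by rewrite lerD2r ler_norm.
  rewrite -{1}(pE t ord0) (le_trans (coord_le_norm _ _))//; exact: norm_row_mxr.
have MM0 : 0 <= `|M| + `|x| by rewrite addr_ge0.
(* Beyond |M| + |x| the shifted functions vanish, so any larger length will do. That the cut at T
   removes nothing is checked pointwise below. *)
pose L := `|M| + `|x| + 1.
rewrite (@Rintegral_half_line R (fun t => h' (x + row_mx 0 (p t))) _ 0 1 (`|M| + `|x|) L)//; first last.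
- move=> t t0; rewrite mul1r subr0 /f /heaviside_upto pE /heaviside.
  case: ltP => t0'; first by rewrite !mul0r ltNge (ltW t0').
  rewrite (negbTE t0) lt_neqAle eq_sym t0 t0' mul1r.
  rewrite indicE; case: (boolP (_ \in _)); first by rewrite mul1r.
  move=> /negP; rewrite inE /= => /negP; rewrite -ltNge => Tp.
  rewrite mul0r h'M//.
  have pt : `|p t| <= t by apply: rV_norm_le => // i; rewrite pE ger0_norm.
  have := coord_le_norm (x + row_mx 0 (p t)) (time_index : 'I_(N + 1)).
  rewrite -/(time_part _) time_part_add time_part_row_mx pE; apply: lt_le_trans.
  rewrite (lt_le_trans _ (ler_norm _))//.
  by have := lt_le_trans Tp pt; lra.
- by rewrite normr0 addr0 ltrDl.
- exact: far.
- by left.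
have dF t : is_derive t (1 : R) (fun t => h (x + row_mx 0 (p t))) (h' (x + row_mx 0 (p t))).
  apply: is_derive_congr (smooth_is_derive time_index (x + row_mx 0 (p t)) sh) => k.
  rewrite [k *: 1]mulr1 addrCA; congr (h (_ + _)); apply/rowP => i.
  case: (split_ordP i) => q ->; rewrite [LHS]mxE ?row_mxEl ?row_mxEr !mxE.
    by rewrite eq_lrshift andbF mulr0 add0r.
  have -> : q = ord0 by apply/val_inj; case: q => -[].
  by rewrite unlift_none /time_index !eqxx mulr1.
have L0 : 0 <= L by rewrite addr_ge0.
under eq_Rintegral do rewrite add0r mul1r.
rewrite (FTC2 L0 (fun t => dF t) ch) (far h hM); last by rewrite [`|L|]ger0_norm// ltrDl.
rewrite sub0r; congr (- h _).
have -> : p 0 = 0 by apply/rowP => i; rewrite pE mxE.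
by rewrite row_mx0 addr0.
Qed.

End convolution.

(** * The domain average and the convolutions in x *)

Section domain_average.
Context {R : realType} {m : nat} (D : set 'rV[R]_m.+1).
Hypothesis bD : bounded_domain D.

Let oD : open D. Proof. by have [] := bD. Qed.

Lemma char_domain0 x : ~ closure D x -> @char_domain R m.+1 D x = 0.
Proof.
move=> nDx; rewrite /char_domain memNset; last by move=> /subset_closure.
by rewrite memNset// => -[].
Qed.

Lemma char_domain_integrable :
  (lebesgue_rV R m.+1).-integrable setT (EFin \o @char_domain R m.+1 D).
Proof.
have [M _ DM] := bounded_domain_norm bD.
apply: (bounded_support_integrable_rV (measurable_char_domain oD) (char_domain_bounded D) (M := M)).
by move=> x Mx; apply: char_domain0 => /DM; rewrite leNgt Mx.
Qed.

Definition domain_average : ('rV[R]_(m.+1 + 1) -> R) -> 'rV[R]_(m.+1 + 1) -> R :=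
  param_integral (lebesgue_rV R m.+1) setT (@char_domain R m.+1 D) (fun y => row_mx y 0).

Lemma test_function_domain_average f : test_function f -> test_function (domain_average f).
Proof.
move=> tf; have [sf _] := tf; split.
  apply: param_integral_smooth => //; first exact: char_domain_integrable.
    exact: measurable_row_mxl.
  exact: test_function_bounded_derivatives.
have [A A0 DA] := bounded_domain_norm bD; have [M M0 fM] := test_function_bound tf.
apply: (@compact_fsupp _ _ _ (M + A)) => x Mx; apply: Rintegral_eq0 => y _.
have [/DA yA|/char_domain0 ->] := pselect (closure D y); last by rewrite mul0r.
rewrite fM ?mulr0// (lt_le_trans _ (lerB_normD _ _))// ltrBrDr.
rewrite (le_lt_trans _ Mx)// lerD2l; apply: row_mx_norm_le => //; first exact: ltW.
by rewrite normr0 ltW.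
Qed.

Lemma pderive_domain_average f i : test_function f ->
  pderive i (domain_average f) = domain_average (pderive i f).
Proof.
move=> tf; have [sf _] := tf; apply: pderive_param_integral => //.
- exact: char_domain_integrable.
- exact: measurable_row_mxl.
- exact: test_function_bounded_derivatives.
Qed.

Lemma conv_x_char (U : functional R (m.+1 + 1)) f : test_function f ->
  conv_x U (regular_distr (@char_domain R m.+1 D)) f = U (domain_average f).
Proof.
move=> tf; have [A _ DA] := bounded_domain_norm bD.
rewrite (conv_xE U (K := closure D) tf)//.
  apply: (@subclosed_compact _ _ [set x : 'rV[R]_m.+1 | `|x| <= A]) => //.
  - exact: closed_closure.
  - exact: norm_le_compact.
move=> g h gh; apply: eq_Rintegral => y _.
by have [/gh ->//|/char_domain0 ->] := pselect (closure D y); rewrite !mul0r.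
Qed.

(** The divergence theorem is applied, for each fixed z, to y -> f(z + (y, 0)). The functions under
    V are thus equal pointwise, so V can be any functional. *)
Lemma conv_x_layer nu (dS : {measure set 'rV[R]_m.+1 -> \bar R})
    (V : functional R (m.+1 + 1)) f i :
  external_unit_normal D nu -> lyapunov_boundary D nu ->
  surface_measure (boundary D) dS -> test_function f ->
  conv_x V (simple_layer dS (boundary D) (fun x => nu x ord0 i)) f =
  V (domain_average (pderive (space_index i) f)).
Proof.
move=> nuD LD dSD tf; have [sf _] := tf.
rewrite (conv_xE V (K := boundary D) tf).
- congr V; apply/funext => z; rewrite /simple_layer.
  rewrite (divergence_theorem bD nuD LD dSD i (test_function_row_mxl z 0 tf)).
  by apply: eq_Rintegral => y _; rewrite pderive_row_mxl.
- exact: compact_boundary.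
- by move=> g h gh; apply: eq_Rintegral => y /set_mem/gh ->.
Qed.

(** Fubini's theorem with time outside and space inside; beyond T >= M the inner integral is 0, so
    the cut changes nothing. *)
Lemma regular_distr_cylinder M T f : test_function f ->
  (forall x, M < `|x| -> f x = 0) -> M <= T ->
  regular_distr (fun z : 'rV[R]_(m.+1 + 1) =>
    char_domain D (space_part z) * heaviside (time_part z)) f =
  time_average T (domain_average f) 0.
Proof.
move=> tf fM MT; have [sf _] := tf.
have [C _ fC] := test_function_bounded [::] tf.
pose g (z : 'rV[R]_(m.+1 + 1)) := char_domain D (space_part z) * heaviside (time_part z) * f z.
have gM z : M < `|z| -> g z = 0 by move=> /fM fz; rewrite /g fz mulr0.
have gC z : `|g z| <= C.
  rewrite /g normrM (le_trans _ (fC z))// ler_piMl// normrM mulr_ile1//.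
    exact: char_domain_bounded.
  exact: heaviside_bounded.
have mg : measurable_fun setT g.
  apply: measurable_funM; last by apply: continuous_measurable_rV; exact: smooth_continuous.
  apply: measurable_funM.
    apply: (measurableT_comp (measurable_char_domain oD)).
    by apply: measurable_fun_rVP => i; under eq_fun do rewrite mxE; exact: measurable_rV_coord.
  by apply: (measurableT_comp (@measurable_heaviside R)); exact: measurable_rV_coord.
have ig := bounded_support_integrable_rV mg gC gM.
rewrite /regular_distr /Rintegral -/g (integral_row_mx ig); congr fine.
apply: eq_integral => b _; rewrite add0r.
transitivity (heaviside (b ord0 ord0) * domain_average f (row_mx 0 b))%:E.
  rewrite /domain_average /param_integral.
  have isl : (lebesgue_rV R m.+1).-integrable setT
      (fun y => (char_domain D y * f (row_mx 0 b + row_mx y 0))%:E).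
    apply: integrable_param => //; first exact: char_domain_integrable.
    - exact: measurable_row_mxl.
    - exact: smooth_continuous.
    - by exists C.
  rewrite EFinM /Rintegral fineK; last exact: integrable_fin_num.
  rewrite -integralZl//; apply: eq_integral => y _.
  rewrite /= /g /space_part row_mxKl time_part_row_mx add_row_mx add0r addr0 -EFinM.
  by rewrite mulrCA mulrA.
congr EFin; rewrite /heaviside_upto indicE; case: (boolP (b \in _)); first by rewrite mulr1.
move=> /negP; rewrite inE /= => /negP; rewrite -ltNge => Tb.
rewrite mulr0 mul0r [domain_average _ _]Rintegral_eq0 ?mulr0// => y _.
rewrite fM ?mulr0// add_row_mx add0r addr0 (le_lt_trans MT)// (lt_le_trans Tb)//.
exact: norm_row_mxr.
Qed.

End domain_average.

Theorem lemma4p1 (R : realType) (N : nat) (c : R)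
    (D : set 'rV[R]_N) (n : 'rV[R]_N -> 'rV[R]_N)
    (dS : {measure set 'rV[R]_N -> \bar R}) (U : functional R (N + 1)) :
  (0 < N)%N -> 0 < c ->
  bounded_domain D ->
  external_unit_normal D n ->
  lyapunov_boundary D n ->
  surface_measure (boundary D) dS ->
  green_function c U ->
  let W := time_primitive U in
  eq_distr
    (- (\sum_(i < N) conv_x (dpderive (space_index i) W)
                            (simple_layer dS (boundary D) (fun x => n x ord0 i)))
     - c ^- 2 *: dpderive time_index (conv_x U (regular_distr (char_domain D))))
    (regular_distr (fun z => char_domain D (space_part z) * heaviside (time_part z))).
Proof.
case: N => [//|m] in D n dS U *.
move=> _ c0 bD nD LD dSD [dU boxU Uvan _] W f tf.
have sumE (A : 'I_m.+1 -> functional R (m.+1 + 1)) h : (\sum_i A i) h = \sum_i A i h.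
  by elim/big_ind2 : _ => // a a' b b' <- <-.
have tg := test_function_domain_average bD tf.
set g := domain_average D f in tg.
have [A A0 gA] := test_function_bound tg; have [B B0 fB] := test_function_bound tf.
(* M bounds the supports of both g and f; the extra 1 in T accounts for the times between -1 and
   0. *)
pose M := Num.max A B; pose T := M + 1.
have gM x : M < `|x| -> g x = 0 by rewrite gt_max => /andP[/gA].
have fM x : M < `|x| -> f x = 0 by rewrite gt_max => /andP[_ /fB].
have tq := test_function_time_average T tg.
rewrite (@regular_distr_cylinder _ _ _ bD M T f tf fM); last by rewrite lerDl.
have boxq : dalembert c U (time_average T g) = time_average T g 0.
  by rewrite (boxU _ tq); apply: (congr1 (time_average T g)); exact: row_mx0.
rewrite -/g -boxq /dalembert.
transitivity (- (\sum_i conv_x (dpderive (space_index i) W)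
    (simple_layer dS (boundary D) (fun x => n x ord0 i)) f)
  - c ^- 2 * dpderive time_index (conv_x U (regular_distr (char_domain D))) f).
  exact: (congr1 (fun y => - y - _) (sumE _ f)).
transitivity (\sum_i dpderive (space_index i) (dpderive (space_index i) U) (time_average T g)
  - c ^- 2 * dpderive time_index (dpderive time_index U) (time_average T g)); last first.
  exact: (congr1 (fun y => y - _) (esym (sumE _ _))).
(* Space and time terms match separately. In a space term one d_i comes from W_{,i} and the other
   from the divergence theorem; the minus signs cancel in pairs. *)
rewrite -sumrN; congr (_ - _ * _).
  apply: eq_bigr => i _; rewrite (conv_x_layer bD _ i nD LD dSD tf) /dpderive !opprK.
  have tgi := test_function_pderive (space_index i) tg.
  rewrite -(pderive_domain_average bD _ tf) -/g /W.
  have gM' x : M < `|x| -> pderive (space_index i) (pderive (space_index i) g) x = 0.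
    by apply: pderive_norm0 => y; exact: pderive_norm0.
  rewrite (time_primitiveE dU Uvan (test_function_pderive (space_index i) tgi) gM' (lexx T)).
  by rewrite !pderive_time_average.
have tf' := test_function_pderive (time_index : 'I_(m.+1 + 1)) tf.
have tg' := test_function_pderive (time_index : 'I_(m.+1 + 1)) tg.
rewrite /dpderive (conv_x_char bD U tf') -(pderive_domain_average bD _ tf) -/g opprK.
rewrite !pderive_time_average//.
(* Here e = d_t g, and r is d_t^2 (Q g) with both derivatives moved inside Q. *)
set e := pderive time_index g in tg' *.
set r := time_average T (pderive time_index e).
have tr : test_function r.
  by apply: test_function_time_average; exact: test_function_pderive.
have eM x : M < `|x| -> e x = 0 by exact: pderive_norm0.
have re x : -1 < time_part x -> r x = - e x.
  exact: (time_average_pderive_time tg' eM (lexx T)).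
have [Ulin _] := dU.
have td := test_functionZD 1 tr tg'.
(* Since r = - e for t > -1, the function r + 2 e may be replaced by e under U; linearity, given in
   the form a f + g, then yields U r = - U e. *)
have : U (fun x => 1 * (1 * r x + e x) + e x) = U e.
  apply: (eq_from_time dU Uvan) => //; first exact: test_functionZD.
  by move=> x /re ->; rewrite !mul1r addNr add0r.
rewrite (Ulin 1 _ _ td tg') (Ulin 1 _ _ tr tg') !mul1r => H.
lra.
Qed.
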